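(* Let $g(t)$ be a meromorphic function on $\mathbb{C}$ which has possible poles only on $2\pi i\mathbb{Z}$. Let $n\in\mathbb{N}$ with $n\ge2$ and $\eta=e^{\pi i/n}$, and let $G(t)=\prod_{j=1}^n g(\eta^jt)$. Assume that there exist real numbers $\gamma_1,\gamma_2$ with $\gamma_1>0$ and a small positive number $\varepsilon$ such that $$|G(t)|\le\gamma_1|t|^{-\gamma_2}\qquad\text{for all } t\in\mathbb{C}\setminus\bigcup_{l=0}^{n-1}\bigcup_{m\in\mathbb{Z}}D(2m\pi i\eta^l,\varepsilon).$$ Then for $h\in\mathbb{Z}$ with $h+\gamma_2>1$, $$\sum_{m\in\mathbb{Z}\setminus\{0\}}(2m\pi i)^{-h}\left(\sum_{l=0}^{n-1}\eta^{l(1-h)}\prod_{\substack{j=1\\ j+l\neq n}}^n g(2m\pi i\eta^{j+l})\right)\mathrm{Res}_{t=2m\pi i}\,g(-t)=-\mathrm{Res}_{t=0}\left\{t^{-h}\prod_{j=1}^n g(\eta^jt)\right\}.$$ In particular, when $g$ is an even function, $$\mathcal{Z}_h\sum_{m\in\mathbb{Z}\setminus\{0\}}(2m\pi i)^{-h}\left(\prod_{j=1}^{n-1}g(2m\pi i\eta^j)\right)\mathrm{Res}_{t=2m\pi i}\,g(t)=-\mathrm{Res}_{t=0}\left\{t^{-h}\prod_{j=0}^{n-1}g(\eta^jt)\right\},$$ where $$\mathcal{Z}_h=\sum_{j=0}^{n-1}\eta^{j(1-h)}=\begin{cases}n&\text{if } h\equiv1\ (\mathrm{mod}\ 2n),\\0&\text{if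 } h\not\equiv1\ (\mathrm{mod}\ 2n)\text{ and } 2\nmid h,\\\dfrac{2}{1-\eta^{1-h}}&\text{if } h\not\equiv1\ (\mathrm{mod}\ 2n)\text{ and } 2\mid h.\end{cases}$$
   Context: $D(z,\varepsilon)$ denotes the closed disk in $\mathbb{C}$ with center $z$ and radius $\varepsilon$. The number $\eta=e^{\pi i/n}$ is a primitive $2n$-th root of unity. $\mathrm{Res}_{t=2m\pi i}\,g(-t)$ is the residue at $t=2m\pi i$ of the function $t\mapsto g(-t)$.
   Formalization: The poles of g at 2mπi with m ≠ 0 are assumed to be at most simple (the identity fails for double poles, e.g. n=2, g(t)=1/sinh²(t/2), h=−3), and ''small'' ε is taken to mean 0 < ε < π. *)

(* Defs.v *)
From Stdlib Require Import Reals ZArith Arith List ClassicalEpsilon.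
From Coquelicot Require Import Coquelicot.

Open Scope C_scope.

Definition Cexp (z : C) : C :=
  (exp (Re z) * cos (Im z), exp (Re z) * sin (Im z))%R.

(* Total: 0 ^ k = / 0 for k < 0, an unspecified value. *)
Definition Cpowz (z : C) (k : Z) : C :=
  match k with
  | Z0 => 1
  | Zpos p => z ^ Pos.to_nat p
  | Zneg p => / z ^ Pos.to_nat p
  end.

Definition Cprod (s : list nat) (f : nat -> C) : C :=
  fold_right Cmult (RtoC 1) (map f s).

Definition holomorphic_at (f : C -> C) (a : C) : Prop :=
  exists r : R, (0 < r)%R /\
    forall z : C, (Cmod (z - a) < r)%R ->
      @ex_derive C_AbsRing C_NormedModule f z.

Definition near_punctured (a : C) (P : C -> Prop) : Prop :=
  exists r : R, (0 < r)%R /\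
    forall z : C, (0 < Cmod (z - a) < r)%R -> P z.

(* f has at a a removable singularity or a pole of order at most N;
   the value f a plays no role. *)
Definition pole_order_le (N : nat) (f : C -> C) (a : C) : Prop :=
  exists phi : C -> C, holomorphic_at phi a /\
    near_punctured a (fun z => f z = phi z / (z - a) ^ N).

Definition meromorphic (f : C -> C) : Prop :=
  forall a : C, exists N : nat, pole_order_le N f a.

(* r is the coefficient of 1/(z - a) in the Laurent expansion of f at a, for f
   meromorphic at a: c k is the coefficient of 1/(z - a)^(k+1), and phi is the
   regular part. *)
Definition is_residue (f : C -> C) (a r : C) : Prop :=
  exists (N : nat) (c : nat -> C) (phi : C -> C),
    c 0%nat = r /\ holomorphic_at phi a /\
    near_punctured a (fun z =>
      f z = sum_n (fun k => c k / (z - a) ^ S k) N + phi z).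

(* Meaningful where f is meromorphic; elsewhere an unspecified value. *)
Definition Res (f : C -> C) (a : C) : C :=
  epsilon (inhabits (RtoC 0)) (is_residue f a).

(* The sum of a over the nonzero integers, which carries no order of
   summation: absolutely convergent, with value s. *)
Definition is_sum_nonzero (a : Z -> C) (s : C) : Prop :=
  ex_series (fun k : nat => Cmod (a (Z.of_nat (S k)))) /\
  ex_series (fun k : nat => Cmod (a (- Z.of_nat (S k))%Z)) /\
  @is_series C_AbsRing C_NormedModule
    (fun k : nat => a (Z.of_nat (S k)) + a (- Z.of_nat (S k))%Z) s.

Definition closed_disk (z : C) (eps : R) (t : C) : Prop :=
  (Cmod (t - z) <= eps)%R.

Definition two_pi_i (m : Z) : C := 2 * IZR m * PI * Ci.

Definition in_two_pi_i_Z (t : C) : Prop := exists m : Z, t = two_pi_i m.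

Definition eta (n : nat) : C := Cexp (PI * Ci / INR n).

Definition Gprod (n : nat) (g : C -> C) (t : C) : C :=
  Cprod (seq 1 n) (fun j => g (eta n ^ j * t)).

Definition calZ (n : nat) (h : Z) : C :=
  sum_n_m (fun j => Cpowz (eta n) (Z.of_nat j * (1 - h))) 0 (n - 1).

(* Values of g at points of 2 pi i Z are immaterial, so evenness is required
   only off this set. *)
Definition even_off_poles (g : C -> C) : Prop :=
  forall t : C, ~ in_two_pi_i_Z t -> g (- t) = g t.

(* Main.v *)
Require Import Defs.
From Stdlib Require Import Reals ZArith Arith Bool List Lia Lra ClassicalEpsilon FunctionalExtensionality.
From Coquelicot Require Import Coquelicot.

Open Scope C_scope.

(** The identity is the statement that all residues of F(t) = t^(-h) G(t) add up to 0.

    The function G(t) = prod_j g(eta^j t) can only be singular at 0 and at the points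
    2 m pi i eta^l with m <> 0 and l < n, where exactly one factor, g(eta^(n-l) t), is singular,
    because eta^k is real only when n divides k. That pole is simple, so the residue of F is the
    product of t^(-h) and of the other factors, evaluated there, with the residue of
    g(-eta^(-l) t), which is eta^l times the residue of g(-t) at 2 m pi i
    ([weighted_G_residue]). Hence the summand of index m is the sum over l of the residues at
    2 m pi i eta^l.

    On the circle of radius (2N+1) pi, which stays at distance at least pi > eps from all poles,
    |F| is at most gamma1 |t|^(-(h + gamma2)), and h + gamma2 > 1 makes the circle integrals tend
    to 0 ([weighted_G_circle_bound]). By the residue theorem the symmetric partial sums converge
    to minus the residue at 0 ([residue_series]). Absolute convergence comes from Cauchy's
    estimate on a fixed small circle around each pole, which bounds each residue by a multiple
    of |m|^(-(h + gamma2)) ([residue_term_bound]). For even g the product over j is the same for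
    all l up to order, so the sum over l factors out as the geometric sum Z_h
    ([residue_term_even], [calZ_values]).

    The complex analysis behind this is built from Goursat's theorem for parametrised rectangles
    ([Goursat]), which makes circle integrals invariant under affine homotopies of circles
    ([oint_homotopy]). This gives Cauchy's formula by shrinking a circle to a point
    ([Cauchy_formula]); Cauchy-type integrals are differentiable, so divided differences of
    holomorphic functions are holomorphic ([divided_difference]), which yields Laurent expansions
    at poles ([pole_has_residue]). The residue theorem follows by subtracting principal
    parts one pole at a time ([residue_theorem]). *)

(** * Complex derivatives and real paths in the plane *)

(* C with the distance given by the modulus. It has the same neighbourhoods as the product
   R * R, and multiplication is continuous for it. *)
Notation Cspace := (AbsRing_UniformSpace C_AbsRing).
Notation Cnorm := (AbsRing_NormedModule C_AbsRing).

Definition Cder (f : C -> C) (z l : C) : Prop :=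
  @is_derive C_AbsRing C_NormedModule f z l.
Definition Cdiff (f : C -> C) (z : C) : Prop :=
  @ex_derive C_AbsRing C_NormedModule f z.
Definition Pder (f : R -> C) (t : R) (l : C) : Prop :=
  @is_derive R_AbsRing C_R_NormedModule f t l.
Definition Ccont (f : C -> C) (z : C) : Prop := @continuous Cspace Cspace f z.
Definition Pcont (f : R -> C) (t : R) : Prop :=
  @continuous R_UniformSpace Cspace f t.

Lemma Cder_eps (f : C -> C) (z l : C) :
  Cder f z l <->
  forall eps : R, (0 < eps)%R -> exists d : R, (0 < d)%R /\
    forall w : C, (Cmod (w - z) < d)%R ->
      (Cmod (f w - f z - (w - z) * l) <= eps * Cmod (w - z))%R.
Proof.
split.
- intros [_ H] eps He.
  specialize (H z (fun P HP => HP) (mkposreal eps He)).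
  destruct H as [d Hd].
  exists d; split; [apply cond_pos|].
  intros w Hw. exact (Hd w Hw).
- intros H. split.
  + apply (is_linear_scal_l (V := C_NormedModule)).
  + intros x Hx. apply (is_filter_lim_locally_unique (V := Cnorm) z x) in Hx. subst x.
    intros eps. destruct (H eps (cond_pos eps)) as [d [Hd Hw]].
    exists (mkposreal d Hd). exact Hw.
Qed.

Lemma Pder_eps (f : R -> C) (t : R) (l : C) :
  Pder f t l <->
  forall eps : R, (0 < eps)%R -> exists d : R, (0 < d)%R /\
    forall u : R, (Rabs (u - t) < d)%R ->
      (Cmod (f u - f t - (u - t)%R * l) <= eps * Rabs (u - t))%R.
Proof.
assert (E : forall u, @scal R_AbsRing C_R_NormedModule (minus u t) l = (u - t)%R * l).
{ intros u. apply scal_R_Cmult. }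
split.
- intros [_ H] eps He.
  specialize (H t (fun P HP => HP) (mkposreal eps He)).
  destruct H as [d Hd].
  exists d; split; [apply cond_pos|].
  intros w Hw. specialize (Hd w Hw). rewrite E in Hd. rewrite <- Cmod_norm in Hd. exact Hd.
- intros H. split.
  + apply (is_linear_scal_l (V := C_R_NormedModule)).
  + intros x Hx. apply (is_filter_lim_locally_unique (V := R_NormedModule) t x) in Hx. subst x.
    intros eps. destruct (H eps (cond_pos eps)) as [d [Hd Hw]].
    exists (mkposreal d Hd). intros u Hu. rewrite E. rewrite <- Cmod_norm. exact (Hw u Hu).
Qed.

(** The same derivative for two normed structures on C that have the same norm: general rules
    for products and compositions apply to the second one. *)
Lemma Cder_Cnorm (f : C -> C) (z l : C) :
  Cder f z l <-> @is_derive C_AbsRing Cnorm f z l.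
Proof.
split; intros [_ H]; (split; [|exact H]).
- apply (is_linear_scal_l (V := Cnorm)).
- apply (is_linear_scal_l (V := C_NormedModule)).
Qed.

Lemma Cder_eq (f : C -> C) (z l l' : C) : Cder f z l -> l = l' -> Cder f z l'.
Proof. intros H E; subst; exact H. Qed.

Lemma Cder_const (c z : C) : Cder (fun _ => c) z 0.
Proof. exact (@is_derive_const C_AbsRing C_NormedModule c z). Qed.

Lemma Cder_id (z : C) : Cder (fun w => w) z 1.
Proof. apply Cder_Cnorm. exact (@is_derive_id C_AbsRing z). Qed.

Lemma Cder_plus (f g : C -> C) (z lf lg : C) :
  Cder f z lf -> Cder g z lg -> Cder (fun w => f w + g w) z (lf + lg).
Proof. exact (@is_derive_plus C_AbsRing C_NormedModule f g z lf lg). Qed.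

Lemma Cder_mult (f g : C -> C) (z lf lg : C) :
  Cder f z lf -> Cder g z lg -> Cder (fun w => f w * g w) z (lf * g z + f z * lg).
Proof.
rewrite !Cder_Cnorm. intros Hf Hg.
exact (@is_derive_mult C_AbsRing f g z lf lg Hf Hg Cmult_comm).
Qed.

Lemma Cder_comp (f g : C -> C) (z lf lg : C) :
  Cder f (g z) lf -> Cder g z lg -> Cder (fun w => f (g w)) z (lg * lf).
Proof.
rewrite !Cder_Cnorm. intros Hf Hg.
exact (@is_derive_comp C_AbsRing Cnorm f g z lf lg Hf Hg).
Qed.

Lemma Cdiff_const (c z : C) : Cdiff (fun _ => c) z.
Proof. eexists; apply Cder_const. Qed.

Lemma Cdiff_id (z : C) : Cdiff (fun w => w) z.
Proof. eexists; apply Cder_id. Qed.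

Lemma Cdiff_plus (f g : C -> C) (z : C) :
  Cdiff f z -> Cdiff g z -> Cdiff (fun w => f w + g w) z.
Proof. intros [lf Hf] [lg Hg]; eexists; apply Cder_plus; eassumption. Qed.

Lemma Cdiff_mult (f g : C -> C) (z : C) :
  Cdiff f z -> Cdiff g z -> Cdiff (fun w => f w * g w) z.
Proof. intros [lf Hf] [lg Hg]; eexists; apply Cder_mult; eassumption. Qed.

Lemma Cdiff_comp (f g : C -> C) (z : C) :
  Cdiff f (g z) -> Cdiff g z -> Cdiff (fun w => f (g w)) z.
Proof. intros [lf Hf] [lg Hg]; eexists; apply Cder_comp; eassumption. Qed.

Lemma Cder_inv (z : C) : z <> 0 -> Cder Cinv z (- / (z * z)).
Proof.
intros Hz. apply Cder_eps. intros eps He.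
assert (Pz : (0 < Cmod z)%R) by now apply Cmod_gt_0.
set (m := Cmod z) in *.
exists (Rmin (m / 2) (eps * (m * m * m) / 2)). split.
{ apply Rmin_pos; [lra|].
  assert (0 < eps * (m * m * m))%R by (repeat apply Rmult_lt_0_compat; assumption). lra. }
intros w Hw.
assert (H1 : (Cmod (w - z) < m / 2)%R) by (eapply Rlt_le_trans; [exact Hw|apply Rmin_l]).
assert (H2 : (Cmod (w - z) < eps * (m * m * m) / 2)%R) by (eapply Rlt_le_trans; [exact Hw|apply Rmin_r]).
assert (Hwm : (m / 2 < Cmod w)%R).
{ assert (m <= Cmod w + Cmod (w - z))%R.
  { unfold m. replace z with (w + - (w - z)) at 1 by ring.
    eapply Rle_trans; [apply Cmod_triangle|]. rewrite Cmod_opp. lra. }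
  lra. }
assert (Hw0 : w <> 0) by (apply Cmod_gt_0; lra).
replace (/ w - / z - (w - z) * - / (z * z)) with ((w - z) * ((w - z) / (w * (z * z)))) by (now field).
rewrite Cmod_mult, Rmult_comm. apply Rmult_le_compat_r; [apply Cmod_ge_0|].
rewrite Cmod_div by (repeat apply Cmult_neq_0; assumption).
rewrite !Cmod_mult. fold m.
apply Rle_div_l.
- assert (0 < m * m)%R by (now apply Rmult_lt_0_compat). apply Rmult_lt_0_compat; lra.
- apply Rlt_le. eapply Rlt_le_trans; [exact H2|].
  assert (0 <= eps * (m * m))%R by (apply Rmult_le_pos; [lra|]; apply Rmult_le_pos; lra). nra.
Qed.

Lemma Cdiff_inv (f : C -> C) (z : C) :
  Cdiff f z -> f z <> 0 -> Cdiff (fun w => / f w) z.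
Proof.
intros Hf H0. apply (Cdiff_comp Cinv f); [|exact Hf].
eexists; apply Cder_inv; exact H0.
Qed.

Lemma Cdiff_pow (f : C -> C) (k : nat) (z : C) :
  Cdiff f z -> Cdiff (fun w => f w ^ k) z.
Proof.
intros Hf; induction k as [|k IH]; [exact (Cdiff_const 1 z)|].
exact (Cdiff_mult f (fun w => f w ^ k) z Hf IH).
Qed.

Lemma Cdiff_ext_loc (f g : C -> C) (z : C) (r : R) :
  (0 < r)%R -> (forall w, (Cmod (w - z) < r)%R -> f w = g w) ->
  Cdiff f z -> Cdiff g z.
Proof.
intros Hr E [l H]. exists l.
apply (is_derive_ext_loc (K := C_AbsRing) (V := C_NormedModule) f g z l); [|exact H].
exists (mkposreal r Hr). intros w Hw. apply E. exact Hw.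
Qed.

Lemma Cdiff_Ccont (f : C -> C) (z : C) : Cdiff f z -> Ccont f z.
Proof.
intros [l H]. apply Cder_Cnorm in H.
apply (@ex_derive_continuous C_AbsRing Cnorm f z). now exists l.
Qed.

Lemma Ccont_eps (f : C -> C) (z : C) : Ccont f z -> forall eps : R, (0 < eps)%R ->
  exists d : R, (0 < d)%R /\ forall w, (Cmod (w - z) < d)%R -> (Cmod (f w - f z) < eps)%R.
Proof.
intros H eps He.
destruct (proj1 (filterlim_locally (F := @locally Cspace z) (T:=Cspace) (U := Cspace) f (f z)) H (mkposreal eps He)) as [d Hd].
exists d; split; [apply cond_pos|]. intros w Hw. exact (Hd w Hw).
Qed.

Lemma Pcont_const (c : C) (t : R) : Pcont (fun _ => c) t.
Proof. apply (@continuous_const R_UniformSpace Cspace). Qed.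

Lemma Pcont_plus (f g : R -> C) (t : R) :
  Pcont f t -> Pcont g t -> Pcont (fun u => f u + g u) t.
Proof. exact (@continuous_plus R_UniformSpace C_AbsRing Cnorm f g t). Qed.

Lemma Pcont_mult (f g : R -> C) (t : R) :
  Pcont f t -> Pcont g t -> Pcont (fun u => f u * g u) t.
Proof. exact (@continuous_mult R_UniformSpace C_AbsRing f g t). Qed.

Lemma Pcont_comp (f : C -> C) (g : R -> C) (t : R) :
  Pcont g t -> Ccont f (g t) -> Pcont (fun u => f (g u)) t.
Proof. exact (@continuous_comp R_UniformSpace Cspace Cspace g f t). Qed.

Lemma Pcont_R (f : R -> C) (t : R) :
  Pcont f t <-> @continuous R_UniformSpace C_UniformSpace f t.
Proof.
split; intros H P HP; apply H; now apply locally_C.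
Qed.

Lemma Pder_cont (f : R -> C) (t : R) (l : C) : Pder f t l -> Pcont f t.
Proof.
intros H. apply Pcont_R. apply (@ex_derive_continuous R_AbsRing C_R_NormedModule f t).
now exists l.
Qed.

(** Chain rule for a complex-differentiable function along a real path; the mixture of a
    complex and a real derivative has to be done by hand. *)
Lemma Pder_comp (F : C -> C) (g : R -> C) (t : R) (l d : C) :
  Cder F (g t) l -> Pder g t d -> Pder (fun u => F (g u)) t (d * l).
Proof.
intros HF Hg.
assert (Hc := Pder_cont _ _ _ Hg).
rewrite Cder_eps in HF. rewrite Pder_eps in Hg |- *.
intros eps He.
set (A := (Cmod d + 1)%R). assert (HA : (0 < A)%R) by (unfold A; pose proof (Cmod_ge_0 d); lra).
set (B := (Cmod l + 1)%R). assert (HB : (0 < B)%R) by (unfold B; pose proof (Cmod_ge_0 l); lra).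
destruct (HF (eps / (2 * A))%R) as [r [Hr HF']].
{ apply Rdiv_lt_0_compat; lra. }
destruct (Hg (Rmin 1 (eps / (2 * B)))%R) as [d1 [Hd1 Hg1]].
{ apply Rmin_pos; [lra|apply Rdiv_lt_0_compat; lra]. }
exists (Rmin d1 (r / A)). split.
{ apply Rmin_pos; [lra|]. apply Rdiv_lt_0_compat; lra. }
intros u Hu.
assert (Hu1 : (Rabs (u - t) < d1)%R) by (eapply Rlt_le_trans; [exact Hu|apply Rmin_l]).
assert (Hu2 : (Rabs (u - t) < r / A)%R) by (eapply Rlt_le_trans; [exact Hu|apply Rmin_r]).
specialize (Hg1 u Hu1).
set (e := g u - g t - (u - t)%R * d) in *.
assert (He1 : (Cmod e <= Rabs (u - t))%R).
{ eapply Rle_trans; [exact Hg1|]. rewrite <- (Rmult_1_l (Rabs (u - t))) at 2.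
  apply Rmult_le_compat_r; [apply Rabs_pos|apply Rmin_l]. }
assert (He2 : (Cmod e <= eps / (2 * B) * Rabs (u - t))%R).
{ eapply Rle_trans; [exact Hg1|].
  apply Rmult_le_compat_r; [apply Rabs_pos|apply Rmin_r]. }
assert (Hgu : (Cmod (g u - g t) <= A * Rabs (u - t))%R).
{ replace (g u - g t) with (e + (u - t)%R * d) by (unfold e; ring).
  eapply Rle_trans; [apply Cmod_triangle|]. rewrite Cmod_mult, Cmod_R. unfold A. lra. }
assert (Hlt : (Cmod (g u - g t) < r)%R).
{ eapply Rle_lt_trans; [exact Hgu|]. apply Rlt_div_r in Hu2; lra. }
specialize (HF' (g u) Hlt).
replace (F (g u) - F (g t) - (u - t)%R * (d * l))
  with ((F (g u) - F (g t) - (g u - g t) * l) + e * l) by (unfold e; ring).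
eapply Rle_trans; [apply Cmod_triangle|]. rewrite Cmod_mult.
replace (eps * Rabs (u - t))%R
  with (eps / (2 * A) * (A * Rabs (u - t)) + (eps / (2 * B) * Rabs (u - t)) * B)%R by (field; lra).
apply Rplus_le_compat.
- eapply Rle_trans; [exact HF'|]. apply Rmult_le_compat_l; [|exact Hgu].
  apply Rlt_le, Rdiv_lt_0_compat; lra.
- apply Rmult_le_compat; try apply Cmod_ge_0; [exact He2|unfold B; lra].
Qed.

Lemma Pder_const (c : C) (t : R) : Pder (fun _ => c) t 0.
Proof. exact (@is_derive_const R_AbsRing C_R_NormedModule c t). Qed.

Lemma Pder_plus (f g : R -> C) (t : R) (lf lg : C) :
  Pder f t lf -> Pder g t lg -> Pder (fun u => f u + g u) t (lf + lg).
Proof. exact (@is_derive_plus R_AbsRing C_R_NormedModule f g t lf lg). Qed.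

Lemma Pder_scal (f : R -> C) (c : C) (t : R) (l : C) :
  Pder f t l -> Pder (fun u => c * f u) t (c * l).
Proof.
intros H. replace (c * l) with (l * c) by ring.
apply (Pder_comp (fun z => c * z) f t c l); [|exact H].
apply Cder_eq with (0 * f t + c * 1); [|ring].
apply (Cder_mult (fun _ => c) (fun z => z)); [apply Cder_const|apply Cder_id].
Qed.

Lemma Pder_RtoC (t : R) : Pder RtoC t 1.
Proof.
apply Pder_eps. intros eps He. exists 1%R. split; [lra|]. intros u _.
replace (RtoC u - RtoC t - (u - t)%R * 1) with (RtoC 0) by (rewrite RtoC_minus; ring).
rewrite Cmod_0. apply Rmult_le_pos; [lra|apply Rabs_pos].
Qed.

(** * Integrals of complex paths *)

Definition Cint (f : R -> C) (a b : R) : C := @RInt C_R_CompleteNormedModule f a b.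

Definition Pcont_on (f : R -> C) (a b : R) : Prop :=
  forall t : R, (a <= t <= b)%R -> Pcont f t.

Lemma Cint_correct (f : R -> C) (a b : R) : (a <= b)%R -> Pcont_on f a b ->
  @is_RInt C_R_NormedModule f a b (Cint f a b).
Proof.
intros Hab H. apply (@RInt_correct C_R_CompleteNormedModule).
apply (@ex_RInt_continuous C_R_CompleteNormedModule).
rewrite Rmin_left, Rmax_right by assumption.
intros t Ht. apply Pcont_R. now apply H.
Qed.

Lemma Cint_unique (f : R -> C) (a b : R) (l : C) :
  @is_RInt C_R_NormedModule f a b l -> Cint f a b = l.
Proof. exact (@is_RInt_unique C_R_CompleteNormedModule f a b l). Qed.

Lemma Cint_ext (f g : R -> C) (a b : R) : (a <= b)%R ->
  (forall t : R, (a <= t <= b)%R -> f t = g t) -> Cint f a b = Cint g a b.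
Proof.
intros Hab H. apply (@RInt_ext C_R_CompleteNormedModule).
rewrite Rmin_left, Rmax_right by assumption.
intros t Ht. apply H. lra.
Qed.

Lemma Cint_plus (f g : R -> C) (a b : R) : (a <= b)%R ->
  Pcont_on f a b -> Pcont_on g a b ->
  Cint (fun t => f t + g t) a b = Cint f a b + Cint g a b.
Proof.
intros Hab Hf Hg. apply Cint_unique.
apply (@is_RInt_plus C_R_NormedModule); now apply Cint_correct.
Qed.

(** The integral is only R-linear by construction; C-linearity is read off the components. *)
Lemma is_RInt_Cmult (f : R -> C) (c : C) (a b : R) (l : C) :
  @is_RInt C_R_NormedModule f a b l ->
  @is_RInt C_R_NormedModule (fun t => c * f t) a b (c * l).
Proof.
intros H.
assert (H1 := is_RInt_fct_extend_fst (U := R_NormedModule) (V := R_NormedModule) f a b l H).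
assert (H2 := is_RInt_fct_extend_snd (U := R_NormedModule) (V := R_NormedModule) f a b l H).
apply (is_RInt_fct_extend_pair (U := R_NormedModule) (V := R_NormedModule)); simpl.
- apply (is_RInt_minus (V := R_NormedModule)); now apply (is_RInt_scal (V := R_NormedModule)).
- apply (is_RInt_plus (V := R_NormedModule)); now apply (is_RInt_scal (V := R_NormedModule)).
Qed.

Lemma Cint_scal (f : R -> C) (c : C) (a b : R) : (a <= b)%R -> Pcont_on f a b ->
  Cint (fun t => c * f t) a b = c * Cint f a b.
Proof.
intros Hab Hf. apply Cint_unique, is_RInt_Cmult. now apply Cint_correct.
Qed.

Lemma Cint_Chasles (f : R -> C) (a b c : R) : (a <= b <= c)%R -> Pcont_on f a c ->
  Cint f a c = Cint f a b + Cint f b c.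
Proof.
intros [Hab Hbc] Hf. apply Cint_unique.
apply (@is_RInt_Chasles C_R_NormedModule) with b; apply Cint_correct; try assumption;
  intros t Ht; apply Hf; lra.
Qed.

Lemma Cint_bound (f : R -> C) (a b M : R) : (a <= b)%R -> Pcont_on f a b ->
  (forall t : R, (a <= t <= b)%R -> (Cmod (f t) <= M)%R) ->
  (Cmod (Cint f a b) <= (b - a) * M)%R.
Proof.
intros Hab Hf HM. rewrite Cmod_norm.
apply (@norm_RInt_le_const C_R_NormedModule f); [assumption| |now apply Cint_correct].
intros t Ht. rewrite <- Cmod_norm. now apply HM.
Qed.

Lemma Cint_FTC (F f : R -> C) (a b : R) : (a <= b)%R -> Pcont_on f a b ->
  (forall t : R, (a <= t <= b)%R -> Pder F t (f t)) ->
  Cint f a b = F b - F a.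
Proof.
intros Hab Hf HF. apply Cint_unique.
apply (@is_RInt_derive C_R_CompleteNormedModule);
  rewrite Rmin_left, Rmax_right by assumption; intros t Ht.
- now apply HF.
- apply Pcont_R. now apply Hf.
Qed.

Definition cis (t : R) : C := (cos t, sin t).

Lemma Cmod_cis (t : R) : Cmod (cis t) = 1%R.
Proof.
transitivity (sqrt 1); [|now rewrite sqrt_1].
unfold Cmod, cis; simpl. f_equal.
transitivity ((sin t)² + (cos t)²)%R; [unfold Rsqr; ring|apply sin2_cos2].
Qed.

Lemma cis_neq0 (t : R) : cis t <> 0.
Proof. apply Cmod_gt_0. rewrite Cmod_cis. lra. Qed.

Lemma Pder_cis (t : R) : Pder cis t (Ci * cis t).
Proof.
assert (E : cis = fun t => RtoC (cos t) + Ci * RtoC (sin t)).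
{ apply functional_extensionality. intros u.
  unfold cis, Ci, RtoC, Cplus, Cmult; simpl. f_equal; ring. }
assert (HR : forall (f : R -> R) l, is_derive f t l -> Pder (fun t => RtoC (f t)) t (RtoC l)).
{ intros f l H. apply Pder_eps. intros eps He.
  apply is_derive_Reals in H. destruct (H eps He) as [d Hd].
  exists d. split; [apply cond_pos|]. intros u Hu.
  destruct (Req_dec u t) as [->|Hne].
  - replace (RtoC (f t) - RtoC (f t) - (t - t)%R * RtoC l) with (RtoC 0) by (rewrite RtoC_minus; ring).
    rewrite Cmod_0, Rminus_diag, Rabs_R0. lra.
  - specialize (Hd (u - t)%R ltac:(lra) Hu).
    replace (t + (u - t))%R with u in Hd by ring.
    rewrite <- RtoC_mult, <- !RtoC_minus, Cmod_R.
    replace (f u - f t - (u - t) * l)%R with (((f u - f t) / (u - t) - l) * (u - t))%R by (field; lra).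
    rewrite Rabs_mult. apply Rmult_le_compat_r; [apply Rabs_pos|lra]. }
replace (Ci * cis t) with (RtoC (- sin t) + Ci * RtoC (cos t)).
2:{ unfold cis, Ci, RtoC, Cplus, Cmult; simpl. f_equal; ring. }
rewrite E. apply Pder_plus; [|apply Pder_scal]; apply HR; apply is_derive_Reals.
- apply derivable_pt_lim_cos.
- apply derivable_pt_lim_sin.
Qed.

Lemma Pcont_cis (t : R) : Pcont cis t.
Proof. exact (Pder_cont _ _ _ (Pder_cis t)). Qed.

Lemma cis_plus (t u : R) : cis (t + u) = cis t * cis u.
Proof. unfold cis, Cmult; simpl. rewrite cos_plus, sin_plus. f_equal; ring. Qed.

Lemma cis_0 : cis 0 = 1.
Proof. unfold cis. now rewrite cos_0, sin_0. Qed.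

Lemma cis_2PI : cis (2 * PI) = 1.
Proof. unfold cis. now rewrite cos_2PI, sin_2PI. Qed.

Lemma cis_PI : cis PI = - (1).
Proof. unfold cis. rewrite cos_PI, sin_PI. unfold Copp; simpl. f_equal; ring. Qed.

(** * Goursat's theorem *)

(** The left ends form a bounded increasing sequence; their supremum lies in every interval. *)
Lemma nested_intervals (s e : nat -> R) :
  (forall k, s k <= s (S k))%R -> (forall k, e (S k) <= e k)%R ->
  (forall k, s k <= e k)%R ->
  exists u : R, forall k, (s k <= u <= e k)%R.
Proof.
intros Hs He Hse.
assert (Hs' : forall j k, (j <= k)%nat -> (s j <= s k)%R).
{ intros j k H. induction H as [|k _ IH]; [lra|]. specialize (Hs k). lra. }
assert (He' : forall j k, (j <= k)%nat -> (e k <= e j)%R).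
{ intros j k H. induction H as [|k _ IH]; [lra|]. specialize (He k). lra. }
assert (Hub : forall k, is_upper_bound (fun x => exists j, x = s j) (e k)).
{ intros k x [j ->]. destruct (Nat.le_ge_cases j k) as [L|L].
  - specialize (Hs' j k L). specialize (Hse k). lra.
  - specialize (He' k j L). specialize (Hse j). lra. }
destruct (completeness (fun x => exists j, x = s j)) as [u [Hu1 Hu2]].
- exists (e 0%nat). apply Hub.
- exists (s 0%nat). now exists 0%nat.
- exists u. intros k. split; [apply Hu1; now exists k|apply Hu2, Hub].
Qed.

(** Goursat's bisection, for any additive rectangle function J. If J of the whole rectangle
    were nonzero, one of the four quarters would carry at least a quarter of it, and so on;
    the nested rectangles shrink to a point (u,v), where the k-th one has J at least of order
    4^(-k), that is, of the order of the square of its size, against the local estimate. *)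
Lemma bisection_rect (J : R -> R -> R -> R -> C) (S T : R) :
  (0 < S)%R -> (0 < T)%R ->
  (forall s1 s s2 t1 t t2, (0 <= s1 <= s)%R -> (s <= s2 <= S)%R ->
     (0 <= t1 <= t)%R -> (t <= t2 <= T)%R ->
     J s1 s2 t1 t2 = J s1 s t1 t + J s s2 t1 t + J s1 s t t2 + J s s2 t t2) ->
  (forall u v eps : R, (0 <= u <= S)%R -> (0 <= v <= T)%R -> (0 < eps)%R ->
     exists d : R, (0 < d)%R /\
     forall s1 s2 t1 t2, (0 <= s1 <= u)%R -> (u <= s2 <= S)%R ->
       (0 <= t1 <= v)%R -> (v <= t2 <= T)%R -> (s2 - s1 < d)%R -> (t2 - t1 < d)%R ->
       (Cmod (J s1 s2 t1 t2) <= eps * ((s2 - s1) + (t2 - t1)) ^ 2)%R) ->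
  J 0 S 0 T = 0.
Proof.
intros HS HT Hadd Hloc.
apply Cmod_eq_0. destruct (Req_dec (Cmod (J 0 S 0 T)) 0) as [E|Hne]; [exact E|exfalso].
assert (HE0 : (0 < Cmod (J 0 S 0 T))%R) by (pose proof (Cmod_ge_0 (J 0 S 0 T)); lra).
(* the k-th rectangle has sides S h_k and T h_k *)
set (h := fun k : nat => (/ 2 ^ k)%R).
assert (Hh0 : forall k, (0 < h k)%R) by (intros k; apply Rinv_0_lt_compat, pow_lt; lra).
assert (HhS : forall k, (h k = h (Datatypes.S k) + h (Datatypes.S k))%R).
{ intros k. unfold h. simpl. field. apply pow_nonzero; lra. }
set (E := (Cmod (J 0 S 0 T) / 2)%R) in *.
set (Q := fun (k : nat) (c : R * R) =>
  J (fst c) (fst c + S * h k)%R (snd c) (snd c + T * h k)%R).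
set (bad := fun k c => (E * (h k * h k) < Cmod (Q k c))%R).
(* the first quarter that is still too large, the last one by default *)
set (next := fun (k : nat) (c : R * R) =>
  let s := (fst c + S * h (Datatypes.S k))%R in
  let t := (snd c + T * h (Datatypes.S k))%R in
  if Rlt_dec (E * (h (Datatypes.S k) * h (Datatypes.S k))) (Cmod (Q (Datatypes.S k) c)) then c
  else if Rlt_dec (E * (h (Datatypes.S k) * h (Datatypes.S k))) (Cmod (Q (Datatypes.S k) (s, snd c))) then (s, snd c)
  else if Rlt_dec (E * (h (Datatypes.S k) * h (Datatypes.S k))) (Cmod (Q (Datatypes.S k) (fst c, t))) then (fst c, t)
  else (s, t)).
set (c := fix c k := match k with O => (0%R, 0%R) | Datatypes.S k => next k (c k) end).
assert (Hnext : forall k x,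
  (fst (next k x) = fst x \/ fst (next k x) = fst x + S * h (Datatypes.S k))%R /\
  (snd (next k x) = snd x \/ snd (next k x) = snd x + T * h (Datatypes.S k))%R).
{ intros k x. unfold next. repeat destruct Rlt_dec; simpl; auto. }
assert (Hin : forall k, (0 <= fst (c k) /\ fst (c k) + S * h k <= S /\
                         0 <= snd (c k) /\ snd (c k) + T * h k <= T)%R).
{ induction k as [|k IH].
  - simpl. unfold h; simpl. lra.
  - simpl c. destruct (Hnext k (c k)) as [H1 H2]. specialize (Hh0 (Datatypes.S k)).
    assert (0 < S * h (Datatypes.S k))%R by (now apply Rmult_lt_0_compat).
    assert (0 < T * h (Datatypes.S k))%R by (now apply Rmult_lt_0_compat).
    rewrite HhS in IH.
    destruct H1 as [-> | ->]; destruct H2 as [-> | ->]; repeat split; lra. }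
assert (Hbad : forall k, bad k (c k)).
{ induction k as [|k IH].
  - unfold bad, Q. simpl. unfold h; simpl. rewrite Rinv_1, !Rplus_0_l, !Rmult_1_r. unfold E; lra.
  - destruct (Hin k) as [I1 [I2 [I3 I4]]]. simpl c.
    unfold bad in IH. unfold Q in IH.
    rewrite HhS in I2, I4.
    pose proof (Hh0 (Datatypes.S k)) as Hp.
    assert (P1 : (0 < S * h (Datatypes.S k))%R) by (now apply Rmult_lt_0_compat).
    assert (P2 : (0 < T * h (Datatypes.S k))%R) by (now apply Rmult_lt_0_compat).
    rewrite (Hadd _ (fst (c k) + S * h (Datatypes.S k))%R _ _ (snd (c k) + T * h (Datatypes.S k))%R) in IH;
      try (rewrite (HhS k)); try lra.
    unfold next. unfold bad.
    destruct Rlt_dec as [L1|N1]; [exact L1|].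
    destruct Rlt_dec as [L2|N2]; [exact L2|].
    destruct Rlt_dec as [L3|N3]; [exact L3|].
    apply Rnot_lt_le in N1, N2, N3.
    rewrite HhS in IH.
    set (s := (fst (c k) + S * h (Datatypes.S k))%R) in *.
    set (t := (snd (c k) + T * h (Datatypes.S k))%R) in *.
    replace (fst (c k) + S * (h (Datatypes.S k) + h (Datatypes.S k)))%R with (s + S * h (Datatypes.S k))%R in IH by (unfold s; ring).
    replace (snd (c k) + T * (h (Datatypes.S k) + h (Datatypes.S k)))%R with (t + T * h (Datatypes.S k))%R in IH by (unfold t; ring).
    unfold Q in N1, N2, N3 |- *. simpl in N2, N3 |- *.
    fold s t in N1. fold s in N3. fold t in N2.
    match type of IH with (_ < Cmod (?a + ?b + ?c + ?d))%R =>
      pose proof (Cmod_triangle (a + b + c) d); pose proof (Cmod_triangle (a + b) c);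
      pose proof (Cmod_triangle a b) end.
    lra. }
destruct (nested_intervals (fun k => fst (c k)) (fun k => (fst (c k) + S * h k)%R)) as [u Hu].
{ intros k. simpl c. destruct (Hnext k (c k)) as [[-> | ->] _]; [lra|].
  specialize (Hh0 (Datatypes.S k)). nra. }
{ intros k. simpl c. rewrite (HhS k). specialize (Hh0 (Datatypes.S k)).
  destruct (Hnext k (c k)) as [[-> | ->] _]; nra. }
{ intros k. specialize (Hh0 k). nra. }
destruct (nested_intervals (fun k => snd (c k)) (fun k => (snd (c k) + T * h k)%R)) as [v Hv].
{ intros k. simpl c. destruct (Hnext k (c k)) as [_ [-> | ->]]; [lra|].
  specialize (Hh0 (Datatypes.S k)). nra. }
{ intros k. simpl c. rewrite (HhS k). specialize (Hh0 (Datatypes.S k)).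
  destruct (Hnext k (c k)) as [_ [-> | ->]]; nra. }
{ intros k. specialize (Hh0 k). nra. }
(* with this eps the local estimate reads |J| <= E h_k^2 for the k-th rectangle *)
destruct (Hloc u v (E / (S + T) ^ 2)%R) as [d [Hd Hsmall]].
{ destruct (Hin 0%nat). specialize (Hu 0%nat). lra. }
{ destruct (Hin 0%nat). specialize (Hv 0%nat). lra. }
{ apply Rdiv_lt_0_compat; [unfold E; lra|apply pow_lt; lra]. }
destruct (pow_lt_1_zero (/ 2) ltac:(rewrite Rabs_pos_eq; lra) (d / (S + T))) as [N HN].
{ apply Rdiv_lt_0_compat; lra. }
specialize (HN N (Nat.le_refl N)).
rewrite Rabs_pos_eq in HN by (apply pow_le; lra). rewrite pow_inv in HN. fold (h N) in HN.
apply Rlt_div_r in HN; [|lra].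
specialize (Hbad N). unfold bad, Q in Hbad.
pose proof (Hh0 N). destruct (Hin N) as [I1 [I2 [I3 I4]]].
specialize (Hu N). specialize (Hv N). simpl in Hu, Hv.
assert (0 < S * h N)%R by (now apply Rmult_lt_0_compat).
assert (0 < T * h N)%R by (now apply Rmult_lt_0_compat).
specialize (Hsmall (fst (c N)) (fst (c N) + S * h N)%R (snd (c N)) (snd (c N) + T * h N)%R
  ltac:(lra) ltac:(lra) ltac:(lra) ltac:(lra) ltac:(lra) ltac:(lra)).
replace (E / (S + T) ^ 2 * (fst (c N) + S * h N - fst (c N) + (snd (c N) + T * h N - snd (c N))) ^ 2)%R
  with (E * (h N * h N))%R in Hsmall by (field; lra).
lra.
Qed.

Lemma Cdiff_Pcont (f : C -> C) (g : R -> C) (t : R) (d : C) :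
  Cdiff f (g t) -> Pder g t d -> Pcont (fun u => f (g u)) t.
Proof.
intros Hf Hg. apply Pcont_comp; [exact (Pder_cont _ _ _ Hg)|now apply Cdiff_Ccont].
Qed.

(** The integral of f(z) dz along the image of the boundary of [s1,s2] x [t1,t2], with the
    orientation for which it is formally the double integral of
    d/ds (f(Phi) Pt) - d/dt (f(Phi) Ps). *)
Definition boundary_int (f : C -> C) (Phi Ps Pt : R -> R -> C) (s1 s2 t1 t2 : R) : C :=
  Cint (fun t => f (Phi s2 t) * Pt s2 t) t1 t2 - Cint (fun t => f (Phi s1 t) * Pt s1 t) t1 t2
  - (Cint (fun s => f (Phi s t2) * Ps s t2) s1 s2 - Cint (fun s => f (Phi s t1) * Ps s t1) s1 s2).

(** A parametrised rectangle Phi : [0,S] x [0,T] -> C with partial derivatives Ps and Pt.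
    Each partial derivative is continuous in its own variable, which is what the integrals
    along the sides of subrectangles use; the common bound L makes Phi Lipschitz. *)
Record patch (S T L : R) (Phi Ps Pt : R -> R -> C) : Prop := {
  patch_ds : forall s t, (0 <= s <= S)%R -> (0 <= t <= T)%R -> Pder (fun s => Phi s t) s (Ps s t);
  patch_dt : forall s t, (0 <= s <= S)%R -> (0 <= t <= T)%R -> Pder (fun t => Phi s t) t (Pt s t);
  patch_cs : forall s t, (0 <= s <= S)%R -> (0 <= t <= T)%R -> Pcont (fun s => Ps s t) s;
  patch_ct : forall s t, (0 <= s <= S)%R -> (0 <= t <= T)%R -> Pcont (fun t => Pt s t) t;
  patch_bs : forall s t, (0 <= s <= S)%R -> (0 <= t <= T)%R -> (Cmod (Ps s t) <= L)%R;
  patch_bt : forall s t, (0 <= s <= S)%R -> (0 <= t <= T)%R -> (Cmod (Pt s t) <= L)%R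
}.

Lemma path_Lipschitz (g dg : R -> C) (a b L : R) :
  (forall t, (a <= t <= b)%R -> Pder g t (dg t)) ->
  (forall t, (a <= t <= b)%R -> Pcont dg t) ->
  (forall t, (a <= t <= b)%R -> (Cmod (dg t) <= L)%R) ->
  forall t u, (a <= t <= b)%R -> (a <= u <= b)%R ->
    (Cmod (g t - g u) <= L * Rabs (t - u))%R.
Proof.
intros Hd Hc Hb.
assert (H : forall t u, (u <= t)%R -> (a <= t <= b)%R -> (a <= u <= b)%R ->
  (Cmod (g t - g u) <= L * (t - u))%R).
{ intros t u Hut Ht Hu.
  rewrite <- (Cint_FTC g dg u t); [|assumption| |].
  - rewrite Rmult_comm. apply Cint_bound; [assumption| |]; intros x Hx; [apply Hc|apply Hb]; lra.
  - intros x Hx; apply Hc; lra.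
  - intros x Hx; apply Hd; lra. }
intros t u Ht Hu. destruct (Rle_lt_dec u t) as [Hle|Hlt].
- rewrite Rabs_pos_eq; [auto|lra].
- rewrite Rabs_left by lra. replace (g t - g u) with (- (g u - g t)) by ring.
  rewrite Cmod_opp. replace (- (t - u))%R with (u - t)%R by ring. apply H; lra.
Qed.

(** Move first in s, then in t: each leg is bounded by L times its length. *)
Lemma patch_Lipschitz (S T L : R) (Phi Ps Pt : R -> R -> C) : patch S T L Phi Ps Pt ->
  forall s t u v, (0 <= s <= S)%R -> (0 <= t <= T)%R -> (0 <= u <= S)%R -> (0 <= v <= T)%R ->
  (Cmod (Phi s t - Phi u v) <= L * (Rabs (s - u) + Rabs (t - v)))%R.
Proof.
intros H s t u v Hs Ht Hu Hv.
replace (Phi s t - Phi u v) with ((Phi s t - Phi u t) + (Phi u t - Phi u v)) by ring.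
eapply Rle_trans; [apply Cmod_triangle|]. rewrite Rmult_plus_distr_l.
apply Rplus_le_compat.
- apply (path_Lipschitz (fun s => Phi s t) (fun s => Ps s t) 0 S L); auto; intros x Hx.
  + now apply (patch_ds _ _ _ _ _ _ H).
  + now apply (patch_cs _ _ _ _ _ _ H).
  + now apply (patch_bs _ _ _ _ _ _ H).
- apply (path_Lipschitz (fun t => Phi u t) (fun t => Pt u t) 0 T L); auto; intros x Hx.
  + now apply (patch_dt _ _ _ _ _ _ H).
  + now apply (patch_ct _ _ _ _ _ _ H).
  + now apply (patch_bt _ _ _ _ _ _ H).
Qed.

Lemma patch_Pcont_s (S T L : R) (Phi Ps Pt : R -> R -> C) (f : C -> C) :
  patch S T L Phi Ps Pt ->
  (forall s t, (0 <= s <= S)%R -> (0 <= t <= T)%R -> Cdiff f (Phi s t)) ->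
  forall t s1 s2, (0 <= t <= T)%R -> (0 <= s1)%R -> (s2 <= S)%R ->
  Pcont_on (fun s => f (Phi s t) * Ps s t) s1 s2.
Proof.
intros H Hf t s1 s2 Ht H1 H2 s Hs. apply Pcont_mult.
- apply (Cdiff_Pcont f (fun s => Phi s t) s (Ps s t)); [apply Hf|apply (patch_ds _ _ _ _ _ _ H)]; lra.
- apply (patch_cs _ _ _ _ _ _ H); lra.
Qed.

Lemma patch_Pcont_t (S T L : R) (Phi Ps Pt : R -> R -> C) (f : C -> C) :
  patch S T L Phi Ps Pt ->
  (forall s t, (0 <= s <= S)%R -> (0 <= t <= T)%R -> Cdiff f (Phi s t)) ->
  forall s t1 t2, (0 <= s <= S)%R -> (0 <= t1)%R -> (t2 <= T)%R ->
  Pcont_on (fun t => f (Phi s t) * Pt s t) t1 t2.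
Proof.
intros H Hf s t1 t2 Hs H1 H2 t Ht. apply Pcont_mult.
- apply (Cdiff_Pcont f (fun t => Phi s t) t (Pt s t)); [apply Hf|apply (patch_dt _ _ _ _ _ _ H)]; lra.
- apply (patch_ct _ _ _ _ _ _ H); lra.
Qed.

Lemma boundary_int_split (S T L : R) (Phi Ps Pt : R -> R -> C) (f : C -> C) :
  patch S T L Phi Ps Pt ->
  (forall s t, (0 <= s <= S)%R -> (0 <= t <= T)%R -> Cdiff f (Phi s t)) ->
  forall s1 s s2 t1 t t2, (0 <= s1 <= s)%R -> (s <= s2 <= S)%R ->
     (0 <= t1 <= t)%R -> (t <= t2 <= T)%R ->
  let J := boundary_int f Phi Ps Pt in
     J s1 s2 t1 t2 = J s1 s t1 t + J s s2 t1 t + J s1 s t t2 + J s s2 t t2.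
Proof.
intros H Hf s1 s s2 t1 t t2 Hs1 Hs2 Ht1 Ht2. unfold boundary_int.
rewrite (Cint_Chasles (fun t => f (Phi s2 t) * Pt s2 t) t1 t t2);
  [|lra|apply (patch_Pcont_t S T L Phi Ps Pt f H Hf); lra].
rewrite (Cint_Chasles (fun t => f (Phi s1 t) * Pt s1 t) t1 t t2);
  [|lra|apply (patch_Pcont_t S T L Phi Ps Pt f H Hf); lra].
rewrite (Cint_Chasles (fun s => f (Phi s t2) * Ps s t2) s1 s s2);
  [|lra|apply (patch_Pcont_s S T L Phi Ps Pt f H Hf); lra].
rewrite (Cint_Chasles (fun s => f (Phi s t1) * Ps s t1) s1 s s2);
  [|lra|apply (patch_Pcont_s S T L Phi Ps Pt f H Hf); lra].
ring.
Qed.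

Lemma boundary_int_plus (S T L : R) (Phi Ps Pt : R -> R -> C) (f g : C -> C) :
  patch S T L Phi Ps Pt ->
  (forall s t, (0 <= s <= S)%R -> (0 <= t <= T)%R -> Cdiff f (Phi s t)) ->
  (forall s t, (0 <= s <= S)%R -> (0 <= t <= T)%R -> Cdiff g (Phi s t)) ->
  forall s1 s2 t1 t2, (0 <= s1 <= s2)%R -> (s2 <= S)%R ->
     (0 <= t1 <= t2)%R -> (t2 <= T)%R ->
  boundary_int (fun z => f z + g z) Phi Ps Pt s1 s2 t1 t2 =
  boundary_int f Phi Ps Pt s1 s2 t1 t2 + boundary_int g Phi Ps Pt s1 s2 t1 t2.
Proof.
intros H Hf Hg s1 s2 t1 t2 Hs1 Hs2 Ht1 Ht2. unfold boundary_int.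
assert (Et : forall s, (0 <= s <= S)%R ->
  Cint (fun t => (f (Phi s t) + g (Phi s t)) * Pt s t) t1 t2 =
  Cint (fun t => f (Phi s t) * Pt s t) t1 t2 + Cint (fun t => g (Phi s t) * Pt s t) t1 t2).
{ intros s Hs. rewrite <- Cint_plus; [|lra| |].
  - apply Cint_ext; [lra|]. intros; ring.
  - apply (patch_Pcont_t S T L Phi Ps Pt f H Hf); lra.
  - apply (patch_Pcont_t S T L Phi Ps Pt g H Hg); lra. }
assert (Es : forall t, (0 <= t <= T)%R ->
  Cint (fun s => (f (Phi s t) + g (Phi s t)) * Ps s t) s1 s2 =
  Cint (fun s => f (Phi s t) * Ps s t) s1 s2 + Cint (fun s => g (Phi s t) * Ps s t) s1 s2).
{ intros t Ht. rewrite <- Cint_plus; [|lra| |].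
  - apply Cint_ext; [lra|]. intros; ring.
  - apply (patch_Pcont_s S T L Phi Ps Pt f H Hf); lra.
  - apply (patch_Pcont_s S T L Phi Ps Pt g H Hg); lra. }
rewrite !Et, !Es by lra. ring.
Qed.

(** Along each side the integral telescopes to a difference of values of the primitive, and
    the four corners cancel. *)
Lemma boundary_int_primitive (S T L : R) (Phi Ps Pt : R -> R -> C) (F f : C -> C) :
  patch S T L Phi Ps Pt ->
  (forall z, Cder F z (f z)) -> (forall z, Cdiff f z) ->
  forall s1 s2 t1 t2, (0 <= s1 <= s2)%R -> (s2 <= S)%R ->
     (0 <= t1 <= t2)%R -> (t2 <= T)%R ->
  boundary_int f Phi Ps Pt s1 s2 t1 t2 = 0.
Proof.
intros H HF Hf s1 s2 t1 t2 Hs1 Hs2 Ht1 Ht2. unfold boundary_int.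
assert (Et : forall s, (0 <= s <= S)%R ->
  Cint (fun t => f (Phi s t) * Pt s t) t1 t2 = F (Phi s t2) - F (Phi s t1)).
{ intros s Hs. apply (Cint_FTC (fun t => F (Phi s t))); [lra| |].
  - apply (patch_Pcont_t S T L Phi Ps Pt f H (fun s t _ _ => Hf (Phi s t))); lra.
  - intros t Ht. rewrite Cmult_comm. apply (Pder_comp F (fun t => Phi s t)); [apply HF|apply (patch_dt _ _ _ _ _ _ H); lra]. }
assert (Es : forall t, (0 <= t <= T)%R ->
  Cint (fun s => f (Phi s t) * Ps s t) s1 s2 = F (Phi s2 t) - F (Phi s1 t)).
{ intros t Ht. apply (Cint_FTC (fun s => F (Phi s t))); [lra| |].
  - apply (patch_Pcont_s S T L Phi Ps Pt f H (fun s t _ _ => Hf (Phi s t))); lra.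
  - intros s Hs. rewrite Cmult_comm. apply (Pder_comp F (fun s => Phi s t)); [apply HF|apply (patch_ds _ _ _ _ _ _ H); lra]. }
rewrite !Et, !Es by lra. ring.
Qed.

Lemma boundary_int_bound (S T L : R) (Phi Ps Pt : R -> R -> C) (f : C -> C) (M : R) :
  patch S T L Phi Ps Pt ->
  (forall s t, (0 <= s <= S)%R -> (0 <= t <= T)%R -> Cdiff f (Phi s t)) ->
  forall s1 s2 t1 t2, (0 <= s1 <= s2)%R -> (s2 <= S)%R ->
     (0 <= t1 <= t2)%R -> (t2 <= T)%R ->
  (forall s t, (s1 <= s <= s2)%R -> (t1 <= t <= t2)%R -> (Cmod (f (Phi s t)) <= M)%R) ->
  (Cmod (boundary_int f Phi Ps Pt s1 s2 t1 t2) <= 2 * (M * L) * ((s2 - s1) + (t2 - t1)))%R.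
Proof.
intros H Hf s1 s2 t1 t2 Hs1 Hs2 Ht1 Ht2 HM. unfold boundary_int.
assert (Bt : forall s, (s1 <= s <= s2)%R ->
  (Cmod (Cint (fun t => f (Phi s t) * Pt s t)%C t1 t2) <= (t2 - t1) * (M * L))%R).
{ intros s Hs. apply Cint_bound; [lra| |].
  - apply (patch_Pcont_t S T L Phi Ps Pt f H Hf); lra.
  - intros t Ht. rewrite Cmod_mult. apply Rmult_le_compat; try apply Cmod_ge_0; [apply HM; lra|apply (patch_bt _ _ _ _ _ _ H); lra]. }
assert (Bs : forall t, (t1 <= t <= t2)%R ->
  (Cmod (Cint (fun s => f (Phi s t) * Ps s t)%C s1 s2) <= (s2 - s1) * (M * L))%R).
{ intros t Ht. apply Cint_bound; [lra| |].
  - apply (patch_Pcont_s S T L Phi Ps Pt f H Hf); lra.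
  - intros s Hs. rewrite Cmod_mult. apply Rmult_le_compat; try apply Cmod_ge_0; [apply HM; lra|apply (patch_bs _ _ _ _ _ _ H); lra]. }
pose proof (Bt s1 ltac:(lra)) as B1. pose proof (Bt s2 ltac:(lra)) as B2.
pose proof (Bs t1 ltac:(lra)) as B3. pose proof (Bs t2 ltac:(lra)) as B4.
unfold Cminus.
eapply Rle_trans; [apply Cmod_triangle|]. rewrite Cmod_opp.
match goal with |- (Cmod (?a + - ?b) + Cmod (?c + - ?d) <= _)%R =>
  pose proof (Cmod_triangle a (- b)) as T1; pose proof (Cmod_triangle c (- d)) as T2 end.
rewrite !Cmod_opp in T1, T2. lra.
Qed.

(** Near a point z0 = Phi(u,v) the function f is an affine map plus an error eps |z - z0|.
    The affine map has a primitive and contributes nothing, so a rectangle of side d about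
    (u,v) has boundary integral of order eps d^2; bisection turns this local estimate into
    the vanishing of the whole boundary integral. *)
Lemma Goursat (S T L : R) (Phi Ps Pt : R -> R -> C) (f : C -> C) :
  (0 < S)%R -> (0 < T)%R -> patch S T L Phi Ps Pt ->
  (forall s t, (0 <= s <= S)%R -> (0 <= t <= T)%R -> Cdiff f (Phi s t)) ->
  boundary_int f Phi Ps Pt 0 S 0 T = 0.
Proof.
intros HS HT H Hf. apply (bisection_rect (boundary_int f Phi Ps Pt)); auto.
{ intros; now apply (boundary_int_split S T L). }
intros u v eps Hu Hv Heps.
assert (HL : (0 <= L)%R).
{ eapply Rle_trans; [apply Cmod_ge_0|]. now apply (patch_bs _ _ _ _ _ _ H u v). }
destruct (Hf u v Hu Hv) as [l Hl].
(* boundary length and distance to z0 bring two factors L; the factor 2 counts opposite sides *)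
set (K := (2 * (L * L) + 1)%R). assert (HK : (0 < K)%R) by (unfold K; nra).
destruct (proj1 (Cder_eps f (Phi u v) l) Hl (eps / K)%R) as [r [Hr Hw]].
{ now apply Rdiv_lt_0_compat. }
set (z0 := Phi u v) in *.
(* keeps the image of the rectangle within distance r of z0 *)
exists (r / (2 * (L + 1)))%R. split; [apply Rdiv_lt_0_compat; lra|].
intros s1 s2 t1 t2 Hs1 Hs2 Ht1 Ht2 Hds Hdt.
set (aff := fun z => f z0 + (z - z0) * l).
assert (Haff : forall z, Cder aff z l).
{ intros z. unfold aff. apply Cder_eq with (0 + ((1 + 0) * l + (z - z0) * 0)); [|ring].
  apply Cder_plus; [apply Cder_const|].
  apply (Cder_mult (fun z => z - z0)); [|apply Cder_const].
  apply (Cder_plus (fun z => z) (fun _ => - z0)); [apply Cder_id|apply Cder_const]. }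
set (rem := fun z => f z + (- (1)) * aff z).
assert (Hrem : forall s t, (0 <= s <= S)%R -> (0 <= t <= T)%R -> Cdiff rem (Phi s t)).
{ intros s t Hs Ht. apply Cdiff_plus; [now apply Hf|]. apply Cdiff_mult; [apply Cdiff_const|].
  eexists; apply Haff. }
assert (E : boundary_int f Phi Ps Pt s1 s2 t1 t2 = boundary_int rem Phi Ps Pt s1 s2 t1 t2).
{ replace f with (fun z => rem z + aff z).
  2:{ apply functional_extensionality; intros z. unfold rem; ring. }
  rewrite (boundary_int_plus S T L); auto; try lra.
  2:{ intros; eexists; apply Haff. }
  rewrite (boundary_int_primitive S T L Phi Ps Pt
    (fun z => f z0 * (z - z0) + (l * / 2) * ((z - z0) * (z - z0))) aff); auto; try lra.
  - unfold rem. apply Cplus_0_r.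
  - intros z. unfold aff.
    assert (D : Cder (fun z => z - z0) z (1 + 0)).
    { apply (Cder_plus (fun z => z) (fun _ => - z0)); [apply Cder_id|apply Cder_const]. }
    eapply Cder_eq.
    { apply (Cder_plus (fun z => f z0 * (z - z0)) (fun z => l * / 2 * ((z - z0) * (z - z0)))).
      - apply (Cder_mult (fun _ => f z0) (fun z => z - z0)); [apply Cder_const|exact D].
      - apply (Cder_mult (fun _ => l * / 2) (fun z => (z - z0) * (z - z0))); [apply Cder_const|].
        apply (Cder_mult (fun z => z - z0) (fun z => z - z0)); exact D. }
    cbv beta. field.
  - intros z; eexists; apply Haff. }
rewrite E. clear E.
set (D := ((s2 - s1) + (t2 - t1))%R).
assert (HD : (0 <= D)%R) by (unfold D; lra).
eapply Rle_trans.
{ apply (boundary_int_bound S T L Phi Ps Pt rem (eps / K * (L * D))); auto; try lra.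
  intros s t Hs Ht.
  assert (HP : (Cmod (Phi s t - z0) <= L * D)%R).
  { eapply Rle_trans; [apply (patch_Lipschitz S T L Phi Ps Pt H); lra|].
    apply Rmult_le_compat_l; [assumption|]. unfold D.
    apply Rplus_le_compat; apply Rabs_le; lra. }
  assert (Hlt : (Cmod (Phi s t - z0) < r)%R).
  { eapply Rle_lt_trans; [exact HP|].
    apply Rle_lt_trans with ((L + 1) * D)%R; [nra|].
    assert (D < r / (L + 1))%R.
    { replace (r / (L + 1))%R with (r / (2 * (L + 1)) + r / (2 * (L + 1)))%R by (field; lra).
      unfold D; lra. }
    rewrite Rmult_comm. apply Rlt_div_r; lra. }
  specialize (Hw _ Hlt). unfold rem, aff.
  replace (f (Phi s t) + - (1) * (f z0 + (Phi s t - z0) * l))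
    with (f (Phi s t) - f z0 - (Phi s t - z0) * l) by ring.
  eapply Rle_trans; [exact Hw|]. apply Rmult_le_compat_l; [|exact HP].
  apply Rlt_le. now apply Rdiv_lt_0_compat. }
fold D.
replace (2 * (eps / K * (L * D) * L) * D)%R with ((eps / K) * (2 * (L * L)) * D ^ 2)%R by ring.
apply Rmult_le_compat_r; [apply pow2_ge_0|].
replace eps with (eps / K * K)%R at 2 by (field; lra).
apply Rmult_le_compat_l; [|unfold K; lra].
apply Rlt_le; now apply Rdiv_lt_0_compat.
Qed.

(** * Circle integrals and Cauchy's formula *)

Definition circle (a : C) (r : R) (t : R) : C := a + r * cis t.
Definition oint (f : C -> C) (a : C) (r : R) : C :=
  Cint (fun t => f (circle a r t) * (r * (Ci * cis t))) 0 (2 * PI).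

Lemma Cmod_circle (a : C) (r t : R) : (0 <= r)%R -> Cmod (circle a r t - a) = r.
Proof.
intros Hr. unfold circle. replace (a + r * cis t - a) with (r * cis t) by ring.
rewrite Cmod_mult, Cmod_cis, Cmod_R, Rabs_pos_eq; lra.
Qed.

Lemma Pder_circle (a : C) (r t : R) : Pder (circle a r) t (r * (Ci * cis t)).
Proof.
unfold circle. replace (r * (Ci * cis t)) with (0 + r * (Ci * cis t)) by ring.
apply (Pder_plus (fun _ => a)); [apply Pder_const|]. apply Pder_scal, Pder_cis.
Qed.

Lemma Pcont_dcircle (r t : R) : Pcont (fun t => r * (Ci * cis t)) t.
Proof.
apply (Pcont_mult (fun _ => RtoC r)); [apply Pcont_const|].
apply (Pcont_mult (fun _ => Ci) cis); [apply Pcont_const|apply Pcont_cis].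
Qed.

Lemma two_PI_pos : (0 < 2 * PI)%R.
Proof. pose proof PI_RGT_0; lra. Qed.

(** Goursat applied to the affine homotopy between two circles. The sides t = 0 and t = 2 pi of
    the parameter rectangle have the same image, so their contributions cancel. *)
Lemma oint_homotopy (f : C -> C) (a b : C) (r R : R) :
  (forall s t, (0 <= s <= 1)%R -> Cdiff f (circle (a + s * (b - a)) (r + s * (R - r)) t)) ->
  oint f a r = oint f b R.
Proof.
intros Hf.
set (Phi := fun s t : Rdefinitions.R => circle (a + s * (b - a)) (r + s * (R - r)) t).
set (Ps := fun s t : Rdefinitions.R => (b - a) + (R - r)%R * cis t).
set (Pt := fun s t : Rdefinitions.R => (r + s * (R - r))%R * (Ci * cis t)).
set (L := (Cmod (b - a) + Rabs (R - r) + Rabs r)%R).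
assert (HL : patch 1 (2 * PI) L Phi Ps Pt).
{ split; intros s t Hs Ht.
  - apply Pder_eps. intros eps He. exists 1%R. split; [lra|]. intros u _.
    unfold Phi, Ps, circle.
    match goal with |- (Cmod ?x <= _)%R => replace x with (RtoC 0) end.
    + rewrite Cmod_0. apply Rmult_le_pos; [lra|apply Rabs_pos].
    + rewrite !RtoC_plus, !RtoC_mult, !RtoC_minus. ring.
  - apply Pder_circle.
  - unfold Ps. apply (Pcont_const (b - a + (R - r)%R * cis t)).
  - apply Pcont_dcircle.
  - unfold Ps. eapply Rle_trans; [apply Cmod_triangle|].
    rewrite Cmod_mult, Cmod_cis, Cmod_R. unfold L. pose proof (Rabs_pos r). lra.
  - unfold Pt. rewrite !Cmod_mult, Cmod_cis, Cmod_Ci, Cmod_R.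
    pose proof (Rabs_triang r (s * (R - r))). rewrite Rabs_mult, (Rabs_pos_eq s) in H by lra.
    pose proof (Cmod_ge_0 (b - a)). pose proof (Rabs_pos (R - r)). unfold L. nra. }
pose proof (Goursat 1 (2 * PI) L Phi Ps Pt f ltac:(lra) two_PI_pos HL
  (fun s t Hs _ => Hf s t Hs)) as G.
unfold boundary_int in G.
rewrite (Cint_ext (fun s => f (Phi s (2 * PI)%R) * Ps s (2 * PI)%R) (fun s => f (Phi s 0%R) * Ps s 0%R)) in G; [|lra|].
2:{ intros s _. unfold Phi, Ps, circle. now rewrite cis_2PI, cis_0. }
assert (E1 : Cint (fun t => f (Phi 1%R t) * Pt 1%R t) 0 (2 * PI) = oint f b R).
{ apply Cint_ext; [pose proof two_PI_pos; lra|]. intros t _. unfold Phi, Pt.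
  replace (a + 1%R * (b - a)) with b by ring. now replace (r + 1 * (R - r))%R with R by ring. }
assert (E0 : Cint (fun t => f (Phi 0%R t) * Pt 0%R t) 0 (2 * PI) = oint f a r).
{ apply Cint_ext; [pose proof two_PI_pos; lra|]. intros t _. unfold Phi, Pt.
  replace (a + 0%R * (b - a)) with a by ring. now replace (r + 0 * (R - r))%R with r by ring. }
rewrite E1, E0 in G.
replace (oint f b R) with (oint f a r + (oint f b R - oint f a r)) by ring.
match type of G with ?x - (?y - ?y) = _ => replace x with (x - (y - y)) by ring end.
rewrite G. ring.
Qed.

Lemma Pcont_to_eps (f : R -> C) (t : R) : Pcont f t ->
  forall eps : R, (0 < eps)%R -> exists d : R, (0 < d)%R /\
    forall u : R, (Rabs (u - t) < d)%R -> (Cmod (f u - f t) < eps)%R.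
Proof.
intros H eps He.
destruct (proj1 (filterlim_locally (F := @locally R_UniformSpace t) (U := Cspace) f (f t)) H (mkposreal eps He)) as [d Hd].
exists d; split; [apply cond_pos|]. intros w Hw. exact (Hd w Hw).
Qed.

Lemma Cmod_triangle_rev (x y : C) : (Cmod x - Cmod y <= Cmod (x - y))%R.
Proof.
assert (H : (Cmod (x - y + y) <= Cmod (x - y) + Cmod y)%R) by apply Cmod_triangle.
replace (x - y + y) with x in H by ring. lra.
Qed.

Lemma Pcont_bounded (f : R -> C) (a b : R) : (a <= b)%R -> Pcont_on f a b ->
  exists M : R, (0 <= M)%R /\ forall t : R, (a <= t <= b)%R -> (Cmod (f t) <= M)%R.
Proof.
intros Hab Hf.
destruct (continuity_ab_maj (fun t => Cmod (f t)) a b Hab) as [x [Hx _]].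
- intros t Ht eps He. destruct (Pcont_to_eps f t (Hf t Ht) eps He) as [d [Hd H]].
  exists d. split; [exact Hd|]. intros u [_ Hu]. simpl in Hu |- *. unfold Rdist in *.
  specialize (H u Hu).
  pose proof (Cmod_triangle_rev (f u) (f t)). pose proof (Cmod_triangle_rev (f t) (f u)).
  replace (f t - f u) with (- (f u - f t)) in H1 by ring. rewrite Cmod_opp in H1.
  apply Rabs_def1; lra.
- exists (Cmod (f x)). split; [apply Cmod_ge_0|exact Hx].
Qed.

Definition Cdiff_circle (f : C -> C) (a : C) (r : R) : Prop :=
  forall z : C, Cmod (z - a) = r -> Cdiff f z.

Lemma circle_Pcont (f : C -> C) (a : C) (r t : R) :
  Cdiff f (circle a r t) -> Pcont (fun t => f (circle a r t)) t.
Proof. intros H. exact (Cdiff_Pcont f (circle a r) t _ H (Pder_circle a r t)). Qed.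

Lemma oint_Pcont (f : C -> C) (a : C) (r : R) : (0 <= r)%R -> Cdiff_circle f a r ->
  Pcont_on (fun t => f (circle a r t) * (r * (Ci * cis t))) 0 (2 * PI).
Proof.
intros Hr Hf t _. apply (Pcont_mult (fun t => f (circle a r t))); [|apply Pcont_dcircle].
now apply circle_Pcont, Hf, Cmod_circle.
Qed.

Lemma oint_ext (f g : C -> C) (a : C) (r : R) : (0 <= r)%R ->
  (forall z, Cmod (z - a) = r -> f z = g z) -> oint f a r = oint g a r.
Proof.
intros Hr H. apply Cint_ext; [pose proof two_PI_pos; lra|].
intros t _. now rewrite H by now apply Cmod_circle.
Qed.

Lemma oint_plus (f g : C -> C) (a : C) (r : R) : (0 <= r)%R ->
  Cdiff_circle f a r -> Cdiff_circle g a r ->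
  oint (fun z => f z + g z) a r = oint f a r + oint g a r.
Proof.
intros Hr Hf Hg. unfold oint.
rewrite <- Cint_plus; [|pose proof two_PI_pos; lra|now apply oint_Pcont|now apply oint_Pcont].
apply Cint_ext; [pose proof two_PI_pos; lra|]. intros t _. ring.
Qed.

Lemma oint_scal (f : C -> C) (c a : C) (r : R) : (0 <= r)%R -> Cdiff_circle f a r ->
  oint (fun z => c * f z) a r = c * oint f a r.
Proof.
intros Hr Hf. unfold oint.
rewrite <- Cint_scal; [|pose proof two_PI_pos; lra|now apply oint_Pcont].
apply Cint_ext; [pose proof two_PI_pos; lra|]. intros t _. ring.
Qed.

Lemma oint_bound (f : C -> C) (a : C) (r M : R) : (0 <= r)%R -> Cdiff_circle f a r ->
  (forall z, Cmod (z - a) = r -> (Cmod (f z) <= M)%R) ->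
  (Cmod (oint f a r) <= 2 * PI * (M * r))%R.
Proof.
intros Hr Hf HM. replace (2 * PI)%R with (2 * PI - 0)%R by ring.
apply Cint_bound; [pose proof two_PI_pos; lra|now apply oint_Pcont|].
intros t _. rewrite !Cmod_mult, Cmod_Ci, Cmod_cis, Cmod_R, (Rabs_pos_eq r) by assumption.
specialize (HM _ (Cmod_circle a r t Hr)). nra.
Qed.

Lemma oint_primitive (F f : C -> C) (a : C) (r : R) : (0 <= r)%R -> Cdiff_circle f a r ->
  (forall z, Cmod (z - a) = r -> Cder F z (f z)) -> oint f a r = 0.
Proof.
intros Hr Hf HF. unfold oint.
rewrite (Cint_FTC (fun t => F (circle a r t))).
- unfold circle. rewrite cis_2PI, cis_0. ring.
- pose proof two_PI_pos; lra.
- now apply oint_Pcont.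
- intros t _. rewrite Cmult_comm. apply (Pder_comp F (circle a r)); [|apply Pder_circle].
  now apply HF, Cmod_circle.
Qed.

Lemma Cder_sub (a z : C) : Cder (fun z => z - a) z 1.
Proof.
apply Cder_eq with (1 + 0); [|ring].
apply (Cder_plus (fun z => z) (fun _ => - a)); [apply Cder_id|apply Cder_const].
Qed.

Lemma Cdiff_sub (a z : C) : Cdiff (fun z => z - a) z.
Proof. eexists; apply Cder_sub. Qed.

Lemma Cdiff_div (f g : C -> C) (z : C) :
  Cdiff f z -> Cdiff g z -> g z <> 0 -> Cdiff (fun w => f w / g w) z.
Proof.
intros Hf Hg H0. apply (Cdiff_mult f (fun w => / g w)); [exact Hf|now apply Cdiff_inv].
Qed.

Lemma Cminus_neq0 (z a : C) : z <> a -> z - a <> 0.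
Proof. intros H E. apply H. replace z with (z - a + a) by ring. rewrite E. ring. Qed.

Lemma Cmod_minus_sym (z a : C) : Cmod (z - a) = Cmod (a - z).
Proof. replace (z - a) with (- (a - z)) by ring. apply Cmod_opp. Qed.

Lemma circle_neq (z w a : C) (r : R) : Cmod (z - a) = r -> Cmod (w - a) <> r -> z - w <> 0.
Proof. intros Hz Hw. apply Cminus_neq0. intros ->. now apply Hw. Qed.

Lemma Cder_inv_pow (w z : C) (k : nat) : z <> w ->
  Cder (fun z => / (z - w) ^ k) z (- INR k / (z - w) ^ S k).
Proof.
intros Hzw. assert (H0 := Cminus_neq0 z w Hzw).
induction k as [|k IH].
- apply Cder_eq with (RtoC 0); [|change (INR 0) with 0%R; unfold Cdiv; ring].
  assert (E : (fun z : C => / (z - w) ^ 0) = (fun _ => / 1)) by reflexivity.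
  rewrite E. apply Cder_const.
- assert (E : (fun z => / (z - w) ^ S k) = (fun z => / (z - w) * / (z - w) ^ k)).
  { apply functional_extensionality. intros x.
    change ((x - w) ^ S k) with ((x - w) * (x - w) ^ k).
    destruct (Ceq_dec x w) as [->|Hx].
    - replace (w - w) with (RtoC 0) by ring. rewrite Cmult_0_l.
      assert (Hi : / 0 = 0).
      { unfold Cinv, RtoC; simpl. f_equal; unfold Rdiv; rewrite ?Ropp_0; ring. }
      rewrite Hi. ring.
    - assert (Hx0 := Cminus_neq0 x w Hx). field. split; [now apply Cpow_nz|exact Hx0]. }
  rewrite E.
  eapply Cder_eq.
  { apply (Cder_mult (fun z => / (z - w)) (fun z => / (z - w) ^ k)); [|exact IH].
    apply (Cder_comp Cinv (fun z => z - w)); [now apply Cder_inv|apply Cder_sub]. }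
  cbv beta. change ((z - w) ^ S (S k)) with ((z - w) * ((z - w) * (z - w) ^ k)).
  change ((z - w) ^ S k) with ((z - w) * (z - w) ^ k).
  rewrite S_INR, RtoC_plus. field. split; [now apply Cpow_nz|exact H0].
Qed.

(** Powers beyond the first have the primitive -1/(k+1) (z - w)^(-(k+1)). *)
Lemma oint_inv_pow (w a : C) (r : R) (k : nat) : (0 <= r)%R -> Cmod (w - a) <> r ->
  oint (fun z => / (z - w) ^ S (S k)) a r = 0.
Proof.
intros Hr Hw.
apply (oint_primitive (fun z => (- / INR (S k)) * / (z - w) ^ S k)); [assumption| |].
- intros z Hz. apply (Cdiff_inv (fun z => (z - w) ^ S (S k))).
  + apply (Cdiff_pow (fun z => z - w)), Cdiff_sub.
  + apply Cpow_nz. now apply (circle_neq z w a r).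
- intros z Hz. assert (H0 := circle_neq z w a r Hz Hw).
  eapply Cder_eq.
  + apply (Cder_mult (fun _ => - / INR (S k)) (fun z => / (z - w) ^ S k)); [apply Cder_const|].
    apply Cder_inv_pow. intros ->. apply H0. ring.
  + cbv beta. change ((z - w) ^ S (S k)) with ((z - w) * ((z - w) * (z - w) ^ k)).
    change ((z - w) ^ S k) with ((z - w) * (z - w) ^ k).
    field. repeat split; try exact H0; try now apply Cpow_nz.
    intros E. apply RtoC_inj in E. revert E. apply not_0_INR. lia.
Qed.

(** The circle of radius r about a is shrunk onto a small circle about w, away from the
    singularity w of the integrand; there f is nearly f(w) and dz/(z - w) is i dt. *)
Lemma Cauchy_formula (f : C -> C) (a w : C) (r : R) :
  (forall z, (Cmod (z - a) <= r)%R -> Cdiff f z) -> (Cmod (w - a) < r)%R ->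
  oint (fun z => f z / (z - w)) a r = 2 * PI * Ci * f w.
Proof.
intros Hf Hw. pose proof two_PI_pos as HPI.
assert (Hr : (0 < r)%R) by (pose proof (Cmod_ge_0 (w - a)); lra).
set (I := oint (fun z => f z / (z - w)) a r).
assert (Hcont : Ccont f w) by (apply Cdiff_Ccont, Hf; lra).
assert (Hle : forall eps, (0 < eps)%R -> (Cmod (I - 2 * PI * Ci * f w) <= 2 * PI * eps)%R).
{ intros eps He. destruct (Ccont_eps f w Hcont eps He) as [d [Hd Hdw]].
  (* inside the big circle, and small enough for f to be within eps of f(w) *)
  set (rho := (Rmin (d / 2) ((r - Cmod (w - a)) / 2))%R).
  assert (Hrho : (0 < rho)%R) by (apply Rmin_pos; lra).
  assert (Hr1 : (rho <= d / 2)%R) by apply Rmin_l.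
  assert (Hr2 : (rho <= (r - Cmod (w - a)) / 2)%R) by apply Rmin_r.
  assert (EI : I = oint (fun z => f z / (z - w)) w rho).
  { unfold I. symmetry. apply oint_homotopy. intros s t Hs.
    set (R0 := (rho + s * (r - rho))%R).
    assert (HR0 : (0 <= R0)%R) by (unfold R0; nra).
    set (z := circle (w + s * (a - w)) R0 t).
    assert (Hz := Cmod_circle (w + s * (a - w)) R0 t HR0). fold z in Hz.
    assert (Hza : (Cmod (z - a) <= r)%R).
    { replace (z - a) with ((z - (w + s * (a - w))) + (1 - s)%R * (w - a)) by (rewrite RtoC_minus; ring).
      eapply Rle_trans; [apply Cmod_triangle|].
      rewrite Hz, Cmod_mult, Cmod_R, Rabs_pos_eq by lra. unfold R0. nra. }
    apply Cdiff_div; [now apply Hf|apply Cdiff_sub|].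
    apply Cmod_gt_0.
    replace (z - w) with ((z - (w + s * (a - w))) - s * (w - a)) by ring.
    eapply Rlt_le_trans; [|apply Cmod_triangle_rev].
    rewrite Hz, Cmod_mult, Cmod_R, Rabs_pos_eq by lra. unfold R0. nra. }
  rewrite EI.
  assert (E2 : Cint (fun t => f (circle w rho t) / (circle w rho t - w) * (rho * (Ci * cis t))) 0 (2 * PI)
     = Cint (fun t => Ci * f (circle w rho t)) 0 (2 * PI)).
  { apply Cint_ext; [lra|]. intros t _. unfold circle.
    replace (w + rho * cis t - w) with (rho * cis t) by ring.
    field. split; [apply cis_neq0|]. intros E. apply RtoC_inj in E. lra. }
  unfold oint. rewrite E2.
  assert (E3 : Cint (fun _ => Ci * f w) 0 (2 * PI) = 2 * PI * Ci * f w).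
  { rewrite (Cint_FTC (fun t => (Ci * f w) * RtoC t) (fun _ => Ci * f w)).
    - rewrite RtoC_mult. ring.
    - lra.
    - intros t _; apply Pcont_const.
    - intros t _. pose proof (Pder_scal RtoC (Ci * f w) t 1 (Pder_RtoC t)) as HP.
      rewrite Cmult_1_r in HP. exact HP. }
  rewrite <- E3.
  assert (Hc : Pcont_on (fun t => Ci * f (circle w rho t)) 0 (2 * PI)).
  { intros t _. apply (Pcont_mult (fun _ => Ci)); [apply Pcont_const|].
    apply circle_Pcont, Hf. replace (circle w rho t - a) with ((circle w rho t - w) + (w - a)) by ring.
    eapply Rle_trans; [apply Cmod_triangle|]. rewrite Cmod_circle by lra. lra. }
  assert (E4 : Cint (fun t => Ci * f (circle w rho t)) 0 (2 * PI) - Cint (fun _ => Ci * f w) 0 (2 * PI)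
    = Cint (fun t => Ci * f (circle w rho t) + - (1) * (Ci * f w)) 0 (2 * PI)).
  { rewrite (Cint_plus (fun t => Ci * f (circle w rho t)) (fun _ => - (1) * (Ci * f w))); [|lra|exact Hc|intros t _; apply Pcont_const].
    rewrite (Cint_scal (fun _ => Ci * f w)); [ring|lra|intros t _; apply Pcont_const]. }
  rewrite E4. replace (2 * PI)%R with (2 * PI - 0)%R at 2 by ring.
  apply Cint_bound; [lra| |].
  - intros t Ht. apply (Pcont_plus (fun t => Ci * f (circle w rho t))); [now apply Hc|apply Pcont_const].
  - intros t Ht. replace (Ci * f (circle w rho t) + - (1) * (Ci * f w)) with (Ci * (f (circle w rho t) - f w)) by ring.
    rewrite Cmod_mult, Cmod_Ci, Rmult_1_l. apply Rlt_le, Hdw. rewrite Cmod_circle; lra. }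
assert (E0 : Cmod (I - 2 * PI * Ci * f w) = 0%R).
{ apply Rle_antisym; [|apply Cmod_ge_0]. apply Rnot_lt_le. intros Hlt.
  specialize (Hle (Cmod (I - 2 * PI * Ci * f w) / (2 * (2 * PI)))%R).
  assert (Hx : (0 < Cmod (I - 2 * PI * Ci * f w) / (2 * (2 * PI)))%R) by (apply Rdiv_lt_0_compat; lra).
  specialize (Hle Hx).
  replace (2 * PI * (Cmod (I - 2 * PI * Ci * f w) / (2 * (2 * PI))))%R with (Cmod (I - 2 * PI * Ci * f w) / 2)%R in Hle by (field; lra).
  lra. }
apply Cmod_eq_0 in E0. replace I with (I - 2 * PI * Ci * f w + 2 * PI * Ci * f w) by ring.
rewrite E0. ring.
Qed.

(** Cauchy's formula at the centre for (z - a) f(z). *)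
Lemma Cauchy_theorem (f : C -> C) (a : C) (r : R) : (0 < r)%R ->
  (forall z, (Cmod (z - a) <= r)%R -> Cdiff f z) -> oint f a r = 0.
Proof.
intros Hr Hf.
rewrite (oint_ext f (fun z => f z * (z - a) / (z - a))); [|lra|].
- rewrite (Cauchy_formula (fun z => f z * (z - a)) a a r).
  + ring.
  + intros z Hz. apply (Cdiff_mult f); [now apply Hf|apply Cdiff_sub].
  + replace (a - a) with (RtoC 0) by ring. now rewrite Cmod_0.
- intros z Hz. field. apply Cmod_gt_0. lra.
Qed.

Lemma oint_inv (w a : C) (r : R) : (Cmod (w - a) < r)%R ->
  oint (fun z => / (z - w)) a r = 2 * PI * Ci.
Proof.
intros Hw. pose proof (Cmod_ge_0 (w - a)).
rewrite (oint_ext _ (fun z => (fun _ => RtoC 1) z / (z - w))); [|lra|].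
- rewrite Cauchy_formula; [ring|intros; apply Cdiff_const|assumption].
- intros z Hz. unfold Cdiv. ring.
Qed.

Lemma two_pi_i_neq0 : 2 * PI * Ci <> 0.
Proof.
apply Cmod_gt_0. rewrite !Cmod_mult, Cmod_Ci, !Cmod_R.
pose proof PI_RGT_0. rewrite !Rabs_pos_eq by lra. lra.
Qed.

(** Differentiation under the integral sign, done directly: the difference quotient minus the
    proposed derivative is (w' - w) times an integral that stays bounded for w' near w. This is
    the source of all higher regularity of holomorphic functions below. *)
Lemma Cauchy_type_Cder (psi : C -> C) (a w : C) (r : R) :
  Cdiff_circle psi a r -> (Cmod (w - a) < r)%R ->
  Cder (fun w => oint (fun z => psi z / (z - w)) a r) w
       (oint (fun z => psi z / ((z - w) * (z - w))) a r).
Proof.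
intros Hpsi Hw. pose proof (Cmod_ge_0 (w - a)) as Hw0. pose proof two_PI_pos as HPI.
destruct (Pcont_bounded (fun t => psi (circle a r t)) 0 (2 * PI)) as [M [HM0 HM]]; [lra| |].
{ intros t _. apply circle_Pcont, Hpsi, Cmod_circle; lra. }
(* half the distance from w to the circle: points w' within d of w are at distance at least d
   from the circle *)
set (d := ((r - Cmod (w - a)) / 2)%R). assert (Hd : (0 < d)%R) by (unfold d; lra).
set (B := (2 * PI * (M * (/ d * (/ d * / d)) * r) + 1)%R).
assert (Hid : (0 < / d)%R) by now apply Rinv_0_lt_compat.
assert (HB : (0 < B)%R).
{ unfold B. assert (0 <= 2 * PI * (M * (/ d * (/ d * / d)) * r))%R; [|lra].
  apply Rmult_le_pos; [lra|]. apply Rmult_le_pos; [|lra]. apply Rmult_le_pos; [lra|].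
  apply Rmult_le_pos; [lra|]. apply Rmult_le_pos; lra. }
apply Cder_eps. intros eps He.
exists (Rmin d (eps / B)). split; [apply Rmin_pos; [assumption|now apply Rdiv_lt_0_compat]|].
intros w' Hw'.
assert (H1 : (Cmod (w' - w) < d)%R) by (eapply Rlt_le_trans; [exact Hw'|apply Rmin_l]).
assert (H2 : (Cmod (w' - w) < eps / B)%R) by (eapply Rlt_le_trans; [exact Hw'|apply Rmin_r]).
assert (Hfar : forall z, Cmod (z - a) = r -> (d <= Cmod (z - w))%R /\ (d <= Cmod (z - w'))%R).
{ intros z Hz.
  pose proof (Cmod_triangle_rev (z - a) (w - a)) as T1.
  replace (z - a - (w - a)) with (z - w) in T1 by ring.
  pose proof (Cmod_triangle_rev (z - w) (w' - w)) as T2.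
  replace (z - w - (w' - w)) with (z - w') in T2 by ring.
  unfold d in *. lra. }
assert (Hnz : forall z, Cmod (z - a) = r -> z - w <> 0 /\ z - w' <> 0).
{ intros z Hz. destruct (Hfar z Hz). split; apply Cmod_gt_0; lra. }
assert (D1 : Cdiff_circle (fun z => psi z / (z - w)) a r).
{ intros z Hz. apply Cdiff_div; [now apply Hpsi|apply Cdiff_sub|now apply Hnz]. }
assert (D2 : Cdiff_circle (fun z => psi z / ((z - w) * (z - w))) a r).
{ intros z Hz. apply Cdiff_div; [now apply Hpsi|apply (Cdiff_mult (fun z => z - w)); apply Cdiff_sub|].
  apply Cmult_neq_0; now apply Hnz. }
assert (D3 : Cdiff_circle (fun z => psi z / ((z - w) * ((z - w) * (z - w')))) a r).
{ intros z Hz. apply Cdiff_div; [now apply Hpsi| |].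
  - apply (Cdiff_mult (fun z => z - w)); [apply Cdiff_sub|].
    apply (Cdiff_mult (fun z => z - w)); apply Cdiff_sub.
  - repeat apply Cmult_neq_0; now apply Hnz. }
assert (E : oint (fun z => psi z / (z - w')) a r - oint (fun z => psi z / (z - w)) a r
   - (w' - w) * oint (fun z => psi z / ((z - w) * (z - w))) a r
   = (w' - w) * (w' - w) * oint (fun z => psi z / ((z - w) * ((z - w) * (z - w')))) a r).
{ rewrite <- (oint_scal _ ((w' - w) * (w' - w))) by (try assumption; lra).
  rewrite <- (oint_scal _ (w' - w)) by (try assumption; lra).
  rewrite (oint_ext (fun z => psi z / (z - w'))
    (fun z => (psi z / (z - w) + (w' - w) * (psi z / ((z - w) * (z - w))))
      + (w' - w) * (w' - w) * (psi z / ((z - w) * ((z - w) * (z - w')))))); [|lra|].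
  - rewrite (oint_plus (fun z => psi z / (z - w) + (w' - w) * (psi z / ((z - w) * (z - w))))).
    + rewrite (oint_plus (fun z => psi z / (z - w))).
      * ring.
      * lra.
      * assumption.
      * intros z Hz. apply Cdiff_mult; [apply Cdiff_const|now apply D2].
    + lra.
    + intros z Hz. apply Cdiff_plus; [now apply D1|]. apply Cdiff_mult; [apply Cdiff_const|now apply D2].
    + intros z Hz. apply Cdiff_mult; [apply Cdiff_const|now apply D3].
  - intros z Hz. destruct (Hnz z Hz). field. split; assumption. }
rewrite E, !Cmod_mult, (Rmult_comm eps), Rmult_assoc.
apply Rmult_le_compat_l; [apply Cmod_ge_0|].
assert (HI : (Cmod (oint (fun z => psi z / ((z - w) * ((z - w) * (z - w'))))%C a r) <= B)%R).
{ eapply Rle_trans; [|unfold B; apply Rlt_le, Rlt_plus_1].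
  unfold oint.
  replace (2 * PI * (M * (/ d * (/ d * / d)) * r))%R with ((2 * PI - 0) * (M * (/ d * (/ d * / d)) * r))%R by ring.
  apply Cint_bound; [lra|apply (oint_Pcont (fun z => psi z / ((z - w) * ((z - w) * (z - w'))))%C a r); [lra|assumption]|].
  intros t Ht. specialize (HM t Ht).
  assert (Hz := Cmod_circle a r t ltac:(lra)). set (z := circle a r t) in *.
  destruct (Hfar z Hz) as [F1 F2]. destruct (Hnz z Hz) as [N1 N2].
  rewrite !Cmod_mult, Cmod_Ci, Cmod_cis, Cmod_R, (Rabs_pos_eq r), !Rmult_1_r by lra.
  apply Rmult_le_compat_r; [lra|].
  unfold Cdiv. rewrite Cmod_mult, Cmod_inv by (repeat apply Cmult_neq_0; assumption).
  rewrite !Cmod_mult, !Rinv_mult.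
  assert (I1 : (/ Cmod (z - w) <= / d)%R) by now apply Rinv_le_contravar.
  assert (I2 : (/ Cmod (z - w') <= / d)%R) by now apply Rinv_le_contravar.
  assert (P1 : (0 < / Cmod (z - w))%R) by (apply Rinv_0_lt_compat; lra).
  assert (P2 : (0 < / Cmod (z - w'))%R) by (apply Rinv_0_lt_compat; lra).
  apply Rmult_le_compat; [apply Cmod_ge_0|repeat apply Rmult_le_pos; lra|assumption|].
  apply Rmult_le_compat; [lra|apply Rmult_le_pos; lra|assumption|].
  apply Rmult_le_compat; lra. }
apply Rle_trans with (Cmod (w' - w) * B)%R.
- apply Rmult_le_compat_l; [apply Cmod_ge_0|exact HI].
- apply Rlt_div_r in H2; lra.
Qed.

Lemma holomorphic_at_Cdiff (f : C -> C) (a : C) : holomorphic_at f a -> Cdiff f a.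
Proof.
intros [r [Hr H]]. apply H. replace (a - a) with (RtoC 0) by ring. now rewrite Cmod_0.
Qed.

(** * Residues *)

(** The removable singularity of (phi(z) - phi(a)) / (z - a): by Cauchy's formula at z and at a,
    together with partial fractions, this quotient is a Cauchy-type integral of
    phi(z)/(z - a), which is differentiable also at a. *)
Lemma divided_difference (phi : C -> C) (a : C) : holomorphic_at phi a ->
  exists psi : C -> C, holomorphic_at psi a /\
  exists r : R, (0 < r)%R /\
    forall z : C, (Cmod (z - a) < r)%R -> phi z = phi a + (z - a) * psi z.
Proof.
intros [r [Hr Hphi]]. set (rho := (r / 2)%R).
assert (Hrho : (0 < rho)%R) by (unfold rho; lra).
assert (Hin : forall z, (Cmod (z - a) <= rho)%R -> Cdiff phi z).
{ intros z Hz. apply Hphi. unfold rho in Hz; lra. }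
exists (fun w => / (2 * PI * Ci) * oint (fun z => phi z / (z - a) / (z - w)) a rho).
split.
- exists rho. split; [exact Hrho|]. intros w Hw.
  apply (Cdiff_mult (fun _ => / (2 * PI * Ci))); [apply Cdiff_const|].
  eexists. apply (Cauchy_type_Cder (fun z => phi z / (z - a))); [|exact Hw].
  intros z Hz. apply Cdiff_div; [apply Hin; lra|apply Cdiff_sub|apply Cmod_gt_0; lra].
- exists rho. split; [exact Hrho|]. intros w Hw.
  destruct (Ceq_dec w a) as [->|Hwa]; [ring|].
  assert (H0 := Cminus_neq0 w a Hwa).
  rewrite (oint_ext _ (fun z => / (w - a) * (phi z / (z - w) + - (1) * (phi z / (z - a))))); [|lra|].
  2:{ intros z Hz. assert (z - a <> 0) by (apply Cmod_gt_0; lra).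
      assert (z - w <> 0) by (apply (circle_neq z w a rho); lra).
      field. repeat split; assumption. }
  assert (D1 : Cdiff_circle (fun z => phi z / (z - w)) a rho).
  { intros z Hz. apply Cdiff_div; [apply Hin; lra|apply Cdiff_sub|apply (circle_neq z w a rho); lra]. }
  assert (D2 : Cdiff_circle (fun z => phi z / (z - a)) a rho).
  { intros z Hz. apply Cdiff_div; [apply Hin; lra|apply Cdiff_sub|apply Cmod_gt_0; lra]. }
  assert (D3 : Cdiff_circle (fun z => - (1) * (phi z / (z - a))) a rho).
  { intros z Hz. apply Cdiff_mult; [apply Cdiff_const|now apply D2]. }
  rewrite (oint_scal (fun z => phi z / (z - w) + - (1) * (phi z / (z - a)))); [|lra|].
  2:{ intros z Hz. apply Cdiff_plus; [now apply D1|now apply D3]. }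
  rewrite (oint_plus (fun z => phi z / (z - w))); [|lra|assumption|assumption].
  rewrite (oint_scal (fun z => phi z / (z - a))); [|lra|assumption].
  rewrite !Cauchy_formula; try assumption.
  + assert (HPI : RtoC PI <> 0) by (intros E; apply RtoC_inj in E; pose proof PI_RGT_0; lra).
    assert (HCi : Ci <> 0) by (apply Cmod_gt_0; rewrite Cmod_Ci; lra).
    field. repeat split; assumption.
  + replace (a - a) with (RtoC 0) by ring. now rewrite Cmod_0.
Qed.

Definition principal_part (c : nat -> C) (N : nat) (a z : C) : C :=
  sum_n (fun k => c k / (z - a) ^ S k) N.

Lemma principal_part_S (c : nat -> C) (N : nat) (a z : C) :
  principal_part c (S N) a z = principal_part c N a z + c (S N) / (z - a) ^ S (S N).
Proof. unfold principal_part. now rewrite sum_Sn. Qed.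

Lemma principal_part_0 (c : nat -> C) (a z : C) :
  principal_part c 0 a z = c 0%nat / (z - a).
Proof. unfold principal_part. rewrite sum_O. simpl. now rewrite Cmult_1_r. Qed.

Lemma Cdiff_inv_pow (a z : C) (k : nat) : z <> a -> Cdiff (fun z => / (z - a) ^ k) z.
Proof.
intros Hz. apply (Cdiff_inv (fun z => (z - a) ^ k)).
- apply (Cdiff_pow (fun z => z - a)), Cdiff_sub.
- now apply Cpow_nz, Cminus_neq0.
Qed.

Lemma Cdiff_principal_part (c : nat -> C) (N : nat) (a z : C) :
  z <> a -> Cdiff (principal_part c N a) z.
Proof.
intros Hz. induction N as [|N IH].
- apply (Cdiff_ext_loc (fun z => c 0%nat * / (z - a) ^ 1) _ z 1); [lra| |].
  + intros w _. rewrite principal_part_0. simpl. now rewrite Cmult_1_r.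
  + apply Cdiff_mult; [apply Cdiff_const|now apply Cdiff_inv_pow].
- apply (Cdiff_ext_loc (fun z => principal_part c N a z + c (S N) * / (z - a) ^ S (S N)) _ z 1); [lra| |].
  + intros w _. now rewrite principal_part_S.
  + apply Cdiff_plus; [exact IH|]. apply Cdiff_mult; [apply Cdiff_const|now apply Cdiff_inv_pow].
Qed.

Lemma oint_principal_part (c : nat -> C) (N : nat) (a b : C) (r : R) :
  (Cmod (a - b) < r)%R -> oint (principal_part c N a) b r = 2 * PI * Ci * c 0%nat.
Proof.
intros Ha. pose proof (Cmod_ge_0 (a - b)).
assert (Hne : forall z, Cmod (z - b) = r -> z <> a) by (intros z Hz ->; lra).
induction N as [|N IH].
- rewrite (oint_ext _ (fun z => c 0%nat * / (z - a))); [|lra|intros z _; apply principal_part_0].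
  rewrite (oint_scal (fun z => / (z - a))); [|lra|].
  + rewrite oint_inv by assumption. ring.
  + intros z Hz. apply (Cdiff_inv (fun z => z - a)); [apply Cdiff_sub|apply Cminus_neq0; auto].
- assert (Hd : Cdiff_circle (fun z => / (z - a) ^ S (S N)) b r) by (intros z Hz; apply Cdiff_inv_pow; auto).
  rewrite (oint_ext _ (fun z => principal_part c N a z + c (S N) * / (z - a) ^ S (S N)));
    [|lra|intros z _; apply principal_part_S].
  rewrite (oint_plus (principal_part c N a)); [|lra| |].
  + rewrite IH, (oint_scal (fun z => / (z - a) ^ S (S N))); [|lra|exact Hd].
    rewrite oint_inv_pow by lra. ring.
  + intros z Hz. apply Cdiff_principal_part; auto.
  + intros z Hz. apply Cdiff_mult; [apply Cdiff_const|now apply Hd].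
Qed.

(** Sums over lists, the additive companion of [Cprod]; poles will be enumerated by lists. *)
Definition Csum {A : Type} (L : list A) (f : A -> C) : C := fold_right Cplus 0 (map f L).

(** Induction on the poles. Near a pole p the function is its principal part plus something
    holomorphic, so subtracting the principal part removes p from the list; the principal
    part itself, being a combination of powers of 1/(z - p), integrates to 2 pi i times its
    residue. *)
Theorem residue_theorem (L : list C) (r : C -> C) : forall (f : C -> C) (a : C) (R : R),
  (0 < R)%R -> NoDup L -> (forall p, In p L -> (Cmod (p - a) < R)%R) ->
  (forall p, In p L -> is_residue f p (r p)) ->
  (forall z, (Cmod (z - a) <= R)%R -> ~ In z L -> Cdiff f z) ->
  oint f a R = 2 * PI * Ci * Csum L r.
Proof.
induction L as [|p L IH]; intros f a R HR HND Hin Hres Hf.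
{ rewrite Cauchy_theorem; [unfold Csum; simpl; ring|exact HR|]. intros z Hz. now apply Hf. }
apply NoDup_cons_iff in HND. destruct HND as [HpL HND].
destruct (Hres p (or_introl eq_refl)) as [N [c [phi [Hc [Hphi [rho [Hrho E]]]]]]].
fold (principal_part c N p) in E.
(* f without its principal part at p, extended across p *)
set (f1 := fun z => if Ceq_dec z p then phi p else f z + - (1) * principal_part c N p z).
assert (Hf1 : forall z, z <> p -> f1 z = f z + - (1) * principal_part c N p z).
{ intros z Hz. unfold f1. now destruct (Ceq_dec z p). }
assert (HPd : forall z, z <> p -> Cdiff (fun z => - (1) * principal_part c N p z) z).
{ intros z Hz. apply Cdiff_mult; [apply Cdiff_const|now apply Cdiff_principal_part]. }
assert (Hpos : forall z, z <> p -> (0 < Cmod (z - p))%R).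
{ intros z Hz. now apply Cmod_gt_0, Cminus_neq0. }
assert (Haway : forall z w, (Cmod (w - z) < Cmod (z - p))%R -> w <> p).
{ intros z w Hw ->. rewrite Cmod_minus_sym in Hw. lra. }
assert (Hon : forall z, Cmod (z - a) = R -> z <> p).
{ intros z Hz ->. specialize (Hin p (or_introl eq_refl)). lra. }
assert (I1 : oint f1 a R = 2 * PI * Ci * Csum L r).
{ apply IH; try assumption.
  - intros q Hq. apply Hin. now right.
  - intros q Hq. assert (Hqp : q <> p) by (intros ->; contradiction).
    destruct (Hres q (or_intror Hq)) as [N' [c' [phi' [Hc' [[r1 [Hr1 Hphi']] [r2 [Hr2 E']]]]]]].
    exists N', c', (fun z => phi' z + - (1) * principal_part c N p z).
    split; [exact Hc'|]. specialize (Hpos q Hqp). split.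
    + exists (Rmin r1 (Cmod (q - p))). split; [now apply Rmin_pos|].
      intros z Hz. apply Cdiff_plus.
      * apply Hphi'. eapply Rlt_le_trans; [exact Hz|apply Rmin_l].
      * apply HPd, (Haway q). eapply Rlt_le_trans; [exact Hz|apply Rmin_r].
    + exists (Rmin r2 (Cmod (q - p))). split; [now apply Rmin_pos|].
      intros z [Hz1 Hz2]. rewrite Hf1, E'.
      * ring.
      * split; [assumption|]. eapply Rlt_le_trans; [exact Hz2|apply Rmin_l].
      * apply (Haway q). eapply Rlt_le_trans; [exact Hz2|apply Rmin_r].
  - intros z Hz HzL. destruct (Ceq_dec z p) as [->|Hzp].
    + apply (Cdiff_ext_loc phi _ p rho Hrho); [|now apply holomorphic_at_Cdiff].
      intros w Hw. destruct (Ceq_dec w p) as [->|Hwp].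
      * unfold f1. now destruct (Ceq_dec p p).
      * rewrite Hf1 by assumption. rewrite E; [|split; [now apply Hpos|assumption]].
        unfold principal_part. ring.
    + apply (Cdiff_ext_loc (fun z => f z + - (1) * principal_part c N p z) _ z (Cmod (z - p))).
      * now apply Hpos.
      * intros w Hw. symmetry. now apply Hf1, (Haway z).
      * apply Cdiff_plus; [|now apply HPd]. apply Hf; [assumption|]. intros [H|H]; [now apply Hzp|contradiction]. }
rewrite (oint_ext f (fun z => f1 z + principal_part c N p z)); [|lra|].
2:{ intros z Hz. rewrite Hf1 by now apply Hon. ring. }
rewrite oint_plus; [|lra| |].
- rewrite I1, oint_principal_part by (apply Hin; now left).
  rewrite Hc. unfold Csum. simpl. ring.
- intros z Hz. apply (Cdiff_ext_loc (fun z => f z + - (1) * principal_part c N p z) _ z (Cmod (z - p))).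
  + now apply Hpos, Hon.
  + intros w Hw. symmetry. now apply Hf1, (Haway z).
  + apply Cdiff_plus; [|now apply HPd, Hon]. apply Hf; [lra|].
    intros HzL. specialize (Hin z HzL). lra.
- intros z Hz. now apply Cdiff_principal_part, Hon.
Qed.

(** Characterises a residue by an integral, which gives its uniqueness. *)
Lemma residue_small_circle (f : C -> C) (a r : C) : is_residue f a r ->
  exists rho0 : R, (0 < rho0)%R /\
    forall rho, (0 < rho < rho0)%R -> oint f a rho = 2 * PI * Ci * r.
Proof.
intros Hres. destruct Hres as [N [c [phi [Hc [Hphi [r2 [Hr2 E]]]]]]].
destruct Hphi as [r1 [Hr1 Hphi]].
exists (Rmin r1 r2). split; [now apply Rmin_pos|]. intros rho [Hrho0 Hrho].
assert (L1 : (rho < r1)%R) by (eapply Rlt_le_trans; [exact Hrho|apply Rmin_l]).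
assert (L2 : (rho < r2)%R) by (eapply Rlt_le_trans; [exact Hrho|apply Rmin_r]).
rewrite (oint_ext f (fun z => principal_part c N a z + phi z)); [|lra|].
- rewrite (oint_plus (principal_part c N a) phi); [|lra| |].
  + rewrite oint_principal_part.
    * rewrite Cauchy_theorem; [rewrite Hc; ring|exact Hrho0|].
      intros z Hz. apply Hphi; lra.
    * replace (a - a) with (RtoC 0) by ring. now rewrite Cmod_0.
  + intros z Hz. apply Cdiff_principal_part. intros ->.
    replace (a - a) with (RtoC 0) in Hz by ring. rewrite Cmod_0 in Hz. lra.
  + intros z Hz. apply Hphi; lra.
- intros z Hz. apply E. lra.
Qed.

Lemma is_residue_unique (f : C -> C) (a r1 r2 : C) :
  is_residue f a r1 -> is_residue f a r2 -> r1 = r2.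
Proof.
intros H1 H2.
destruct (residue_small_circle f a r1 H1) as [d1 [Hd1 E1]].
destruct (residue_small_circle f a r2 H2) as [d2 [Hd2 E2]].
set (rho := (Rmin d1 d2 / 2)%R).
assert (Hm : (0 < Rmin d1 d2)%R) by now apply Rmin_pos.
assert (M1 := Rmin_l d1 d2). assert (M2 := Rmin_r d1 d2).
assert (E : 2 * PI * Ci * r1 = 2 * PI * Ci * r2).
{ rewrite <- (E1 rho), <- (E2 rho) by (unfold rho; lra). reflexivity. }
replace r1 with (/ (2 * PI * Ci) * (2 * PI * Ci * r1)).
- rewrite E. rewrite Cmult_assoc, Cinv_l by apply two_pi_i_neq0. ring.
- rewrite Cmult_assoc, Cinv_l by apply two_pi_i_neq0. ring.
Qed.

(** Uniqueness identifies the value chosen by epsilon. *)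
Lemma Res_eq (f : C -> C) (a r : C) : is_residue f a r -> Res f a = r.
Proof.
intros H. apply (is_residue_unique f a); [|exact H].
unfold Res. apply epsilon_spec. now exists r.
Qed.

Lemma is_residue_ext (f g : C -> C) (a r : C) :
  near_punctured a (fun z => f z = g z) -> is_residue f a r -> is_residue g a r.
Proof.
intros [r1 [Hr1 E]] [N [c [phi [Hc [Hphi [r2 [Hr2 Ef]]]]]]].
exists N, c, phi. split; [exact Hc|]. split; [exact Hphi|].
exists (Rmin r1 r2). split; [now apply Rmin_pos|].
intros z [Hz1 Hz2]. rewrite <- E.
- apply Ef. split; [assumption|]. eapply Rlt_le_trans; [exact Hz2|apply Rmin_r].
- split; [assumption|]. eapply Rlt_le_trans; [exact Hz2|apply Rmin_l].
Qed.

Lemma is_residue_simple (f phi : C -> C) (a : C) : holomorphic_at phi a ->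
  near_punctured a (fun z => f z = phi z / (z - a)) -> is_residue f a (phi a).
Proof.
intros Hphi [r1 [Hr1 E]].
destruct (divided_difference phi a Hphi) as [psi [Hpsi [r2 [Hr2 E2]]]].
exists 0%nat, (fun _ => phi a), psi. split; [reflexivity|]. split; [exact Hpsi|].
exists (Rmin r1 r2). split; [now apply Rmin_pos|].
intros z [Hz1 Hz2].
fold (principal_part (fun _ => phi a) 0 a z). rewrite principal_part_0.
rewrite E, E2.
- field. apply Cmod_gt_0. lra.
- eapply Rlt_le_trans; [exact Hz2|apply Rmin_r].
- split; [assumption|]. eapply Rlt_le_trans; [exact Hz2|apply Rmin_l].
Qed.

(** Multiplying a denominator by z - a once more produces one new term b/(z - a)^(N+1), absorbed
    in the coefficient of index N; the coefficient of index N+1 is set to 0, so that the number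
    of terms follows the order of the pole in the induction of [pole_has_residue]. *)
Lemma principal_part_add (c : nat -> C) (N : nat) (b a z : C) :
  principal_part (fun k => if (k =? N)%nat then c k + b else
                           if (k =? S N)%nat then 0 else c k) (S N) a z =
  principal_part c N a z + b / (z - a) ^ S N.
Proof.
rewrite principal_part_S.
replace (S N =? N)%nat with false by (symmetry; apply Nat.eqb_neq; lia).
rewrite Nat.eqb_refl.
assert (H : forall M, (M < N)%nat -> principal_part (fun k => if (k =? N)%nat then c k + b else
                           if (k =? S N)%nat then 0 else c k) M a z = principal_part c M a z).
{ intros M HM. apply sum_n_ext_loc. intros k Hk.
  replace (k =? N)%nat with false by (symmetry; apply Nat.eqb_neq; lia).
  now replace (k =? S N)%nat with false by (symmetry; apply Nat.eqb_neq; lia). }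
destruct N as [|N].
- rewrite !principal_part_0. simpl. rewrite !Cmult_1_r. unfold Cdiv. ring.
- rewrite !principal_part_S, H by lia. rewrite Nat.eqb_refl. unfold Cdiv. ring.
Qed.

(** Taylor expansion of the numerator by repeated divided differences, one power of z - a at
    a time. *)
Lemma pole_has_residue (N : nat) (f : C -> C) (a : C) :
  pole_order_le N f a -> exists r : C, is_residue f a r.
Proof.
intros [phi [Hphi E]].
assert (H : exists (c : nat -> C) (chi : C -> C), holomorphic_at chi a /\
  near_punctured a (fun z => phi z / (z - a) ^ N = principal_part c N a z + chi z)).
{ clear E f. revert phi Hphi. induction N as [|N IH]; intros phi Hphi.
  - exists (fun _ => RtoC 0), phi. split; [exact Hphi|]. exists 1%R. split; [lra|].
    intros z [Hz _]. rewrite principal_part_0. simpl. field. apply Cmod_gt_0; lra.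
  - destruct (divided_difference phi a Hphi) as [psi [Hpsi [r1 [Hr1 E1]]]].
    destruct (IH psi Hpsi) as [c [chi [Hchi [r2 [Hr2 E2]]]]].
    exists (fun k => if (k =? N)%nat then c k + phi a else
                           if (k =? S N)%nat then 0 else c k), chi.
    split; [exact Hchi|].
    exists (Rmin r1 r2). split; [now apply Rmin_pos|].
    intros z [Hz1 Hz2]. rewrite principal_part_add.
    rewrite E1 by (eapply Rlt_le_trans; [exact Hz2|apply Rmin_l]).
    assert (H0 : z - a <> 0) by (apply Cmod_gt_0; lra).
    transitivity (phi a / (z - a) ^ S N + psi z / (z - a) ^ N).
    + change ((z - a) ^ S N) with ((z - a) * (z - a) ^ N). field.
      split; [now apply Cpow_nz|exact H0].
    + rewrite E2; [ring|]. split; [assumption|]. eapply Rlt_le_trans; [exact Hz2|apply Rmin_r]. }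
destruct H as [c [chi [Hchi H]]].
exists (c 0%nat), N, c, chi. split; [reflexivity|]. split; [exact Hchi|].
destruct H as [r1 [Hr1 E1]]. destruct E as [r2 [Hr2 E2]].
exists (Rmin r1 r2). split; [now apply Rmin_pos|].
intros z [Hz1 Hz2]. rewrite E2, E1; [reflexivity| |]; (split; [assumption|]).
- eapply Rlt_le_trans; [exact Hz2|apply Rmin_l].
- eapply Rlt_le_trans; [exact Hz2|apply Rmin_r].
Qed.

(** Cauchy's estimate, from the residue theorem with a single pole. *)
Lemma residue_bound (f : C -> C) (a r : C) (rho M : R) : (0 < rho)%R ->
  is_residue f a r ->
  (forall z, (Cmod (z - a) <= rho)%R -> z <> a -> Cdiff f z) ->
  (forall z, Cmod (z - a) = rho -> (Cmod (f z) <= M)%R) ->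
  (Cmod r <= M * rho)%R.
Proof.
intros Hrho Hres Hf HM.
assert (E : oint f a rho = 2 * PI * Ci * r).
{ rewrite (residue_theorem (a :: nil) (fun _ => r)); try assumption.
  - unfold Csum; simpl; ring.
  - apply NoDup_cons; [easy|constructor].
  - intros p [<-|[]]. replace (a - a) with (RtoC 0) by ring. now rewrite Cmod_0.
  - now intros p [<-|[]].
  - intros z Hz Hin. apply Hf; [assumption|]. intros ->. apply Hin. now left. }
assert (B : (Cmod (oint f a rho) <= 2 * PI * (M * rho))%R).
{ apply oint_bound; [lra| |exact HM]. intros z Hz. apply Hf; [lra|].
  intros ->. replace (a - a) with (RtoC 0) in Hz by ring. rewrite Cmod_0 in Hz. lra. }
rewrite E, !Cmod_mult, Cmod_Ci, !Cmod_R, !Rabs_pos_eq in B by (pose proof PI_RGT_0; lra).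
pose proof two_PI_pos. rewrite Rmult_1_r in B.
apply Rmult_le_reg_l in B; lra.
Qed.

(** * Powers, products and the rotation by eta *)

Lemma holomorphic_at_mult (f g : C -> C) (a : C) :
  holomorphic_at f a -> holomorphic_at g a -> holomorphic_at (fun z => f z * g z) a.
Proof.
intros [r1 [H1 F1]] [r2 [H2 F2]]. exists (Rmin r1 r2). split; [now apply Rmin_pos|].
intros z Hz. apply Cdiff_mult; [apply F1|apply F2]; (eapply Rlt_le_trans; [exact Hz|]).
- apply Rmin_l.
- apply Rmin_r.
Qed.

Lemma holomorphic_at_const (c a : C) : holomorphic_at (fun _ => c) a.
Proof. exists 1%R. split; [lra|]. intros; apply Cdiff_const. Qed.

Lemma Cdiff_scal_arg (f : C -> C) (u z : C) : Cdiff f (u * z) -> Cdiff (fun z => f (u * z)) z.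
Proof.
intros H. apply (Cdiff_comp f (fun z => u * z)); [exact H|].
apply (Cdiff_mult (fun _ => u) (fun z => z)); [apply Cdiff_const|apply Cdiff_id].
Qed.

Lemma holomorphic_at_rotate (f : C -> C) (u a : C) : Cmod u = 1%R ->
  holomorphic_at f (u * a) -> holomorphic_at (fun z => f (u * z)) a.
Proof.
intros Hu [r [Hr F]]. exists r. split; [exact Hr|].
intros z Hz. apply Cdiff_scal_arg. apply F.
replace (u * z - u * a) with (u * (z - a)) by ring. rewrite Cmod_mult, Hu. lra.
Qed.

Lemma Cdiff_Cpowz (k : Z) (z : C) : z <> 0 -> Cdiff (fun z => Cpowz z k) z.
Proof.
intros Hz. destruct k as [|p|p]; simpl.
- apply Cdiff_const.
- apply (Cdiff_pow (fun z => z)), Cdiff_id.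
- apply (Cdiff_inv (fun z => z ^ Pos.to_nat p)); [apply (Cdiff_pow (fun z => z)), Cdiff_id|].
  now apply Cpow_nz.
Qed.

Lemma holomorphic_at_Cpowz (k : Z) (a : C) : a <> 0 -> holomorphic_at (fun z => Cpowz z k) a.
Proof.
intros Ha. apply Cmod_gt_0 in Ha. exists (Cmod a). split; [exact Ha|].
intros z Hz. apply Cdiff_Cpowz. intros ->.
replace (0 - a) with (- a) in Hz by ring. rewrite Cmod_opp in Hz. lra.
Qed.

Lemma Cpowz_of_nat (z : C) (k : nat) : Cpowz z (Z.of_nat k) = z ^ k.
Proof.
destruct k as [|k]; [reflexivity|]. simpl. now rewrite SuccNat2Pos.id_succ.
Qed.

Lemma Cpowz_opp (z : C) (k : Z) : z <> 0 -> Cpowz z (- k) = / Cpowz z k.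
Proof.
intros Hz. destruct k as [|p|p]; simpl; [|reflexivity|].
- field.
- field. now apply Cpow_nz.
Qed.

Lemma Cpowz_sub_nat (z : C) (a b : nat) : z <> 0 ->
  Cpowz z (Z.of_nat a - Z.of_nat b) = z ^ a / z ^ b.
Proof.
intros Hz. destruct (Nat.le_ge_cases b a) as [H|H].
- rewrite <- Nat2Z.inj_sub by assumption. rewrite Cpowz_of_nat.
  replace a with (a - b + b)%nat at 2 by lia. rewrite Cpow_add_r. field. now apply Cpow_nz.
- replace (Z.of_nat a - Z.of_nat b)%Z with (- Z.of_nat (b - a))%Z by lia.
  rewrite Cpowz_opp, Cpowz_of_nat by assumption.
  replace b with (b - a + a)%nat at 2 by lia. rewrite Cpow_add_r. field.
  split; now apply Cpow_nz.
Qed.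

(** Reduces laws of integer powers to those of natural powers. *)
Lemma Z_sub_nat (k : Z) : exists a b : nat, k = (Z.of_nat a - Z.of_nat b)%Z.
Proof.
destruct (Z_le_gt_dec 0 k) as [H|H].
- exists (Z.to_nat k), 0%nat. lia.
- exists 0%nat, (Z.to_nat (- k)). lia.
Qed.

Lemma Cpowz_add (z : C) (k l : Z) : z <> 0 -> Cpowz z (k + l) = Cpowz z k * Cpowz z l.
Proof.
intros Hz. destruct (Z_sub_nat k) as [a [b ->]]. destruct (Z_sub_nat l) as [c [d ->]].
replace (Z.of_nat a - Z.of_nat b + (Z.of_nat c - Z.of_nat d))%Z
  with (Z.of_nat (a + c) - Z.of_nat (b + d))%Z by lia.
rewrite !Cpowz_sub_nat, !Cpow_add_r by assumption. field. split; now apply Cpow_nz.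
Qed.

Lemma Cpowz_mult (z w : C) (k : Z) : z <> 0 -> w <> 0 -> Cpowz (z * w) k = Cpowz z k * Cpowz w k.
Proof.
intros Hz Hw. destruct (Z_sub_nat k) as [a [b ->]].
rewrite !Cpowz_sub_nat, !Cpow_mult_l by (try assumption; now apply Cmult_neq_0).
field. split; now apply Cpow_nz.
Qed.

Lemma Cpowz_pow (z : C) (l : nat) (k : Z) : z <> 0 ->
  Cpowz z (Z.of_nat l * k) = Cpowz (z ^ l) k.
Proof.
intros Hz. destruct (Z_sub_nat k) as [a [b ->]].
replace (Z.of_nat l * (Z.of_nat a - Z.of_nat b))%Z with (Z.of_nat (l * a) - Z.of_nat (l * b))%Z by lia.
rewrite !Cpowz_sub_nat by (try assumption; now apply Cpow_nz).
now rewrite !Cpow_mult_r.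
Qed.

Lemma Cmod_Cpowz (z : C) (k : Z) : z <> 0 -> Cmod (Cpowz z k) = Rpower (Cmod z) (IZR k).
Proof.
intros Hz. assert (Hp : (0 < Cmod z)%R) by now apply Cmod_gt_0.
rewrite <- powerRZ_Rpower by assumption.
destruct k; simpl.
- apply Cmod_1.
- apply Cmod_pow.
- rewrite Cmod_inv by now apply Cpow_nz. now rewrite Cmod_pow.
Qed.

Lemma Cprod_cons (j : nat) (s : list nat) (f : nat -> C) : Cprod (j :: s) f = f j * Cprod s f.
Proof. reflexivity. Qed.

Lemma Cprod_app (s s' : list nat) (f : nat -> C) : Cprod (s ++ s') f = Cprod s f * Cprod s' f.
Proof.
induction s as [|j s IH]; simpl app.
- unfold Cprod at 2; simpl. ring.
- rewrite !Cprod_cons, IH. ring.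
Qed.

Lemma Cprod_ext (s : list nat) (f g : nat -> C) :
  (forall j, In j s -> f j = g j) -> Cprod s f = Cprod s g.
Proof.
intros H. unfold Cprod. f_equal. now apply map_ext_in.
Qed.

Lemma holomorphic_at_Cprod (s : list nat) (F : nat -> C -> C) (a : C) :
  (forall j, In j s -> holomorphic_at (F j) a) ->
  holomorphic_at (fun z => Cprod s (fun j => F j z)) a.
Proof.
induction s as [|j s IH]; intros H.
- exact (holomorphic_at_const 1 a).
- apply (holomorphic_at_mult (F j) (fun z => Cprod s (fun j => F j z))).
  + apply H. now left.
  + apply IH. intros i Hi. apply H. now right.
Qed.

(** Serves to isolate the one singular factor of a product. *)
Lemma Cprod_remove (P : nat -> bool) (j0 : nat) (s : list nat) (f : nat -> C) :
  NoDup s -> In j0 s -> (forall j, In j s -> P j = negb (j =? j0)%nat) ->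
  Cprod s f = f j0 * Cprod (filter P s) f.
Proof.
induction s as [|j s IH]; intros HND Hin HP; [contradiction|].
apply NoDup_cons_iff in HND. destruct HND as [Hj HND].
simpl filter. rewrite (HP j (or_introl eq_refl)).
destruct (Nat.eqb_spec j j0) as [->|Hne]; simpl negb; cbv iota.
- rewrite Cprod_cons. f_equal. f_equal. symmetry. apply forallb_filter_id.
  apply forallb_forall. intros i Hi. rewrite (HP i (or_intror Hi)).
  destruct (Nat.eqb_spec i j0) as [->|]; [contradiction|reflexivity].
- rewrite !Cprod_cons, IH; try assumption.
  + ring.
  + destruct Hin as [E|Hin]; [contradiction|exact Hin].
  + intros i Hi. apply HP. now right.
Qed.

Lemma Cpow_cis (x : R) (k : nat) : cis x ^ k = cis (INR k * x).
Proof.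
induction k as [|k IH].
- simpl. now rewrite Rmult_0_l, cis_0.
- change (cis x ^ S k) with (cis x * cis x ^ k). rewrite IH, <- cis_plus, S_INR. f_equal. ring.
Qed.

Lemma eta_cis (n : nat) : n <> 0%nat -> eta n = cis (PI / INR n).
Proof.
intros Hn. assert (H : INR n <> 0%R) by now apply not_0_INR.
unfold eta. replace (PI * Ci / INR n) with ((0, PI / INR n)%R : C).
- unfold Cexp, cis; simpl. rewrite exp_0. f_equal; ring.
- unfold Cdiv. rewrite <- RtoC_inv by exact H. unfold Ci, RtoC, Cmult; simpl. f_equal; field; exact H.
Qed.

Lemma eta_pow (n k : nat) : n <> 0%nat -> eta n ^ k = cis (INR k * (PI / INR n)).
Proof. intros Hn. rewrite eta_cis by assumption. apply Cpow_cis. Qed.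

Lemma Cmod_eta_pow (n k : nat) : n <> 0%nat -> Cmod (eta n ^ k) = 1%R.
Proof. intros Hn. rewrite eta_pow by assumption. apply Cmod_cis. Qed.

Lemma eta_pow_n (n : nat) : n <> 0%nat -> eta n ^ n = - (1).
Proof.
intros Hn. rewrite eta_pow by assumption. rewrite <- cis_PI. f_equal. field. now apply not_0_INR.
Qed.

Lemma eta_neq0 (n : nat) : n <> 0%nat -> eta n <> 0.
Proof. intros Hn. rewrite eta_cis by assumption. apply cis_neq0. Qed.

Lemma Cmod_two_pi_i (m : Z) : Cmod (two_pi_i m) = (2 * PI * IZR (Z.abs m))%R.
Proof.
unfold two_pi_i. rewrite !Cmod_mult, Cmod_Ci, !Cmod_R, abs_IZR.
pose proof PI_RGT_0. rewrite (Rabs_pos_eq 2), (Rabs_pos_eq PI) by lra. ring.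
Qed.

Lemma two_pi_i_opp (m : Z) : two_pi_i (- m) = - two_pi_i m.
Proof. unfold two_pi_i. rewrite opp_IZR, RtoC_opp. ring. Qed.

Lemma two_pi_i_nz (m : Z) : m <> 0%Z -> two_pi_i m <> 0.
Proof.
intros Hm. apply Cmod_gt_0. rewrite Cmod_two_pi_i.
apply Rmult_lt_0_compat; [apply two_PI_pos|]. apply IZR_lt. lia.
Qed.

Lemma two_pi_i_0 : two_pi_i 0 = 0.
Proof. unfold two_pi_i. ring. Qed.

Lemma sin_multiple_pos (n k : nat) : (0 < k < n)%nat -> (0 < sin (INR k * (PI / INR n)))%R.
Proof.
intros Hk. assert (Hn : (0 < INR n)%R) by (apply lt_0_INR; lia).
assert (Hk0 : (0 < INR k)%R) by (apply lt_0_INR; lia).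
assert (Hkn : (INR k < INR n)%R) by (apply lt_INR; lia).
pose proof PI_RGT_0 as HPI. apply sin_gt_0.
- apply Rmult_lt_0_compat; [lra|]. now apply Rdiv_lt_0_compat.
- replace PI with (INR n * (PI / INR n))%R at 2 by (field; lra).
  apply Rmult_lt_compat_r; [now apply Rdiv_lt_0_compat|exact Hkn].
Qed.

Lemma min_positive (N : nat) (F : nat -> R) : (forall k, (0 < k < N)%nat -> (0 < F k)%R) ->
  exists s : R, (0 < s)%R /\ forall k, (0 < k < N)%nat -> (s <= F k)%R.
Proof.
induction N as [|N IH]; intros H.
- exists 1%R. split; [lra|]. intros; lia.
- destruct IH as [s [Hs Hk]]; [intros; apply H; lia|].
  destruct N as [|N].
  + exists 1%R. split; [lra|]. intros; lia.
  + exists (Rmin s (F (S N))). split; [apply Rmin_pos; [exact Hs|apply H; lia]|].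
    intros k Hk'. destruct (Nat.eq_dec k (S N)) as [->|Hne]; [apply Rmin_r|].
    eapply Rle_trans; [apply Rmin_l|apply Hk; lia].
Qed.

(** After rotating the second ray onto the imaginary axis, the distance is at least that of the
    first point to this axis: the modulus 2 pi |m| times the sine of the angle. *)
Lemma Cmod_ray_dist (n l l' : nat) (m m' : Z) (s : R) : (l' < l < n)%nat ->
  (s <= sin (INR (l - l') * (PI / INR n)))%R ->
  (2 * PI * IZR (Z.abs m) * s <= Cmod (two_pi_i m * eta n ^ l - two_pi_i m' * eta n ^ l'))%R.
Proof.
intros Hl Hs. assert (Hn : n <> 0%nat) by lia.
replace l with (l' + (l - l'))%nat at 1 by lia. rewrite Cpow_add_r.
set (k := (l - l')%nat) in *.
replace (two_pi_i m * (eta n ^ l' * eta n ^ k) - two_pi_i m' * eta n ^ l')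
  with (eta n ^ l' * ((2 * PI)%R * Ci) * (IZR m * eta n ^ k - IZR m'))
  by (unfold two_pi_i; rewrite RtoC_mult; ring).
rewrite !Cmod_mult, Cmod_eta_pow, Cmod_Ci, Cmod_R, Rabs_pos_eq by (assumption || (pose proof two_PI_pos; lra)).
rewrite Rmult_1_l, Rmult_1_r, Rmult_assoc.
apply Rmult_le_compat_l; [pose proof two_PI_pos; lra|].
eapply Rle_trans; [|apply Rmax_Cmod]. eapply Rle_trans; [|apply Rmax_r].
rewrite eta_pow by assumption. unfold cis; simpl.
match goal with |- (_ <= Rabs ?x)%R => replace x with (IZR m * sin (INR k * (PI / INR n)))%R by ring end.
rewrite Rabs_mult, abs_IZR. apply Rmult_le_compat_l; [apply Rabs_pos|].
eapply Rle_trans; [exact Hs|apply Rle_abs].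
Qed.

(** Distinct rays through the poles diverge linearly; the same s serves for all pairs of rays
    because there are finitely many angles. *)
Lemma eta_rays_separated (n : nat) : exists s : R, (0 < s)%R /\
  forall (l l' : nat) (m m' : Z), (l < n)%nat -> (l' < n)%nat -> l <> l' ->
  (2 * PI * IZR (Z.abs m) * s <= Cmod (two_pi_i m * eta n ^ l - two_pi_i m' * eta n ^ l'))%R.
Proof.
destruct (min_positive n (fun k => sin (INR k * (PI / INR n))) (sin_multiple_pos n)) as [s [Hs H]].
exists s. split; [exact Hs|].
intros l l' m m' Hl Hl' Hne. destruct (Nat.lt_ge_cases l' l) as [L|L].
- apply Cmod_ray_dist; [lia|]. apply H. lia.
- (* multiplying by eta^(n - (l' - l)) exchanges the roles of the rays, as eta^n = -1 *)
  assert (E : two_pi_i m * eta n ^ l - two_pi_i m' * eta n ^ l' =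
     eta n ^ l * (two_pi_i m * eta n ^ 0 - two_pi_i m' * eta n ^ (l' - l))).
  { replace l' with (l + (l' - l))%nat at 1 by lia. rewrite Cpow_add_r. simpl. ring. }
  rewrite E, Cmod_mult, Cmod_eta_pow, Rmult_1_l by lia.
  assert (E2 : eta n ^ (n - (l' - l)) * (two_pi_i m * eta n ^ 0 - two_pi_i m' * eta n ^ (l' - l))
    = two_pi_i m * eta n ^ (n - (l' - l)) - two_pi_i (- m') * eta n ^ 0).
  { rewrite two_pi_i_opp. simpl.
    replace (- two_pi_i m' * 1) with (two_pi_i m' * eta n ^ n) by (rewrite eta_pow_n by lia; ring).
    replace (eta n ^ n) with (eta n ^ (n - (l' - l)) * eta n ^ (l' - l))
      by (rewrite <- Cpow_add_r; f_equal; lia).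
    ring. }
  rewrite <- (Rmult_1_l (Cmod _)), <- (Cmod_eta_pow n (n - (l' - l))), <- Cmod_mult, E2 by lia.
  apply Cmod_ray_dist; [lia|]. apply H. lia.
Qed.

Lemma ray_pole_inj (n l l' : nat) (m m' : Z) : (l < n)%nat -> (l' < n)%nat -> m <> 0%Z ->
  two_pi_i m * eta n ^ l = two_pi_i m' * eta n ^ l' -> l = l' /\ m = m'.
Proof.
intros Hl Hl' Hm E.
assert (Hll : l = l').
{ destruct (Nat.eq_dec l l') as [|Hne]; [assumption|exfalso].
  destruct (eta_rays_separated n) as [s [Hs H]].
  specialize (H l l' m m' Hl Hl' Hne). rewrite E in H.
  replace (two_pi_i m' * eta n ^ l' - two_pi_i m' * eta n ^ l') with (RtoC 0) in H by ring.
  rewrite Cmod_0 in H.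
  assert (0 < 2 * PI * IZR (Z.abs m) * s)%R; [|lra].
  apply Rmult_lt_0_compat; [|exact Hs]. apply Rmult_lt_0_compat; [apply two_PI_pos|].
  apply IZR_lt; lia. }
split; [exact Hll|]. subst l'.
assert (Hc : Cmod (two_pi_i (m - m')) = 0%R).
{ replace (two_pi_i (m - m')) with (two_pi_i m - two_pi_i m')
    by (unfold two_pi_i; rewrite minus_IZR, RtoC_minus; ring).
  rewrite <- (Rmult_1_r (Cmod _)), <- (Cmod_eta_pow n l), <- Cmod_mult by lia.
  replace ((two_pi_i m - two_pi_i m') * eta n ^ l) with (two_pi_i m * eta n ^ l - two_pi_i m' * eta n ^ l) by ring.
  rewrite E. replace (two_pi_i m' * eta n ^ l - two_pi_i m' * eta n ^ l) with (RtoC 0) by ring.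
  apply Cmod_0. }
rewrite Cmod_two_pi_i in Hc. apply Rmult_integral in Hc. destruct Hc as [Hc|Hc].
- pose proof two_PI_pos; lra.
- apply eq_IZR in Hc. lia.
Qed.

(** The products of values of g in the statement are taken away from the poles of g: eta^k is
    real only for multiples k of n. *)
Lemma off_lattice (n k : nat) (m : Z) : (0 < k < 2 * n)%nat -> k <> n -> m <> 0%Z ->
  ~ in_two_pi_i_Z (two_pi_i m * eta n ^ k).
Proof.
intros Hk Hkn Hm [m' E].
assert (H : forall k m m', (0 < k < n)%nat -> m <> 0%Z -> two_pi_i m * eta n ^ k <> two_pi_i m').
{ clear. intros k m m' Hk Hm E.
  replace (two_pi_i m') with (two_pi_i m' * eta n ^ 0) in E by (simpl; ring).
  apply ray_pole_inj in E; try assumption; lia. }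
destruct (Nat.lt_ge_cases k n) as [L|L].
- now apply (H k m m'); [lia| |].
- apply (H (k - n)%nat (- m)%Z m'); [lia|lia|]. rewrite <- E, two_pi_i_opp.
  replace k with (n + (k - n))%nat at 2 by lia. rewrite Cpow_add_r, eta_pow_n by lia. ring.
Qed.

Lemma lattice_preimage (n j : nat) (z : C) : (1 <= j <= n)%nat ->
  in_two_pi_i_Z (eta n ^ j * z) -> exists m : Z, z = two_pi_i m * eta n ^ (n - j).
Proof.
intros Hj [m E]. exists (- m)%Z. rewrite two_pi_i_opp, <- E.
replace (- (eta n ^ j * z) * eta n ^ (n - j)) with (- (eta n ^ j * eta n ^ (n - j)) * z) by ring.
rewrite <- Cpow_add_r. replace (j + (n - j))%nat with n by lia. rewrite eta_pow_n by lia. ring.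
Qed.

(** * Convergence of series *)

Lemma Rpower_neg_antitone (x y c : R) : (0 < x <= y)%R -> (0 <= c)%R ->
  (Rpower y (- c) <= Rpower x (- c))%R.
Proof.
intros Hxy Hc. rewrite !Rpower_Ropp. apply Rinv_le_contravar.
- apply exp_pos.
- apply Rle_Rpower_l; [exact Hc|lra].
Qed.

(** Mean value theorem; compares the series of n^(-kappa) with a telescoping one. *)
Lemma Rpower_telescope (x s : R) : (0 < x)%R -> (0 < s)%R ->
  (s * Rpower (x + 1) (- (s + 1)) <= Rpower x (- s) - Rpower (x + 1) (- s))%R.
Proof.
intros Hx Hs.
destruct (MVT_cor2 (fun x => Rpower x (- s)) (fun x => - s * Rpower x (- s - 1))%R x (x + 1)) as [c [E Hc]].
- lra.
- intros c Hc. apply derivable_pt_lim_power. lra.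
- assert (H : (Rpower (x + 1) (- (s + 1)) <= Rpower c (- (s + 1)))%R) by (apply Rpower_neg_antitone; lra).
  replace (- s - 1)%R with (- (s + 1))%R in E by ring.
  assert (s * Rpower (x + 1) (- (s + 1)) <= s * Rpower c (- (s + 1)))%R by (apply Rmult_le_compat_l; lra).
  lra.
Qed.

Lemma ex_series_Rpower (kappa : R) : (1 < kappa)%R ->
  ex_series (fun k : nat => Rpower (INR (S k)) (- kappa)).
Proof.
intros Hk. apply ex_series_incr_1. set (s := (kappa - 1)%R).
assert (Hs : (0 < s)%R) by (unfold s; lra).
assert (B : forall N, (s * sum_n (fun k => Rpower (INR (S (S k))) (- kappa)) N <= 1 - Rpower (INR (S (S N))) (- s))%R).
{ induction N as [|N IH].
  - rewrite sum_O. pose proof (Rpower_telescope 1 s ltac:(lra) Hs) as H.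
    assert (E1 : Rpower 1 (- s) = 1%R) by (unfold Rpower; rewrite ln_1, Rmult_0_r; apply exp_0).
    replace (INR 2) with (1 + 1)%R by (simpl; ring).
    replace kappa with (s + 1)%R by (unfold s; ring). lra.
  - rewrite sum_Sn. unfold plus; simpl.
    pose proof (Rpower_telescope (INR (S (S N))) s ltac:(apply lt_0_INR; lia) Hs) as H.
    rewrite <- (S_INR (S (S N))) in H. replace (s + 1)%R with kappa in H by (unfold s; ring).
    rewrite Rmult_plus_distr_l. change (match N with O => _ | S _ => _ end) with (INR (S N)) in *.
    simpl in *. lra. }
destruct (ex_finite_lim_seq_incr (sum_n (fun k => Rpower (INR (S (S k))) (- kappa))) (/ s)) as [l Hl].
- intros N. rewrite sum_Sn. unfold plus; simpl.
  match goal with |- (_ <= _ + Rpower ?x ?y)%R => pose proof (exp_pos (y * ln x)) as P end.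
  unfold Rpower at 3. lra.
- intros N. specialize (B N).
  pose proof (exp_pos (- s * ln (INR (S (S N))))) as P. unfold Rpower at 2 in B.
  apply Rmult_le_reg_l with s; [exact Hs|]. rewrite Rinv_r by lra. lra.
- exists l. exact Hl.
Qed.

Lemma Rpower_neg_lim (s : R) : (0 < s)%R -> is_lim_seq (fun k : nat => Rpower (INR (S k)) (- s)) 0.
Proof.
intros Hs. apply is_lim_seq_spec. intros eps. simpl.
destruct (nfloor_ex (Rpower eps (- / s))) as [N HN].
{ apply Rlt_le, exp_pos. }
exists (S N). intros k Hk. rewrite Rminus_0_r, Rabs_pos_eq by apply Rlt_le, exp_pos.
assert (Hpos : (0 < Rpower eps (- / s))%R) by apply exp_pos.
assert (Hlt : (Rpower eps (- / s) < INR (S k))%R).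
{ apply Rlt_le_trans with (INR N + 1)%R; [apply HN|]. rewrite <- S_INR. apply le_INR. lia. }
rewrite Rpower_Ropp.
apply Rlt_le_trans with (/ Rpower (Rpower eps (- / s)) s)%R.
- apply Rinv_lt_contravar; [apply Rmult_lt_0_compat; apply exp_pos|].
  apply exp_increasing. apply Rmult_lt_compat_l; [exact Hs|]. now apply ln_increasing.
- rewrite Rpower_mult. replace (- / s * s)%R with (- (1))%R by (field; lra).
  rewrite Rpower_Ropp, Rinv_inv, Rpower_1 by apply cond_pos. lra.
Qed.

Lemma is_series_C (a : nat -> C) (l : C) (u : nat -> R) :
  (forall N, (Cmod (sum_n a N - l) <= u N)%R) -> is_lim_seq u 0 ->
  @is_series C_AbsRing C_NormedModule a l.
Proof.
intros H Hu. apply is_lim_seq_spec in Hu.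
apply (filterlim_locally (U := C_UniformSpace) (F := eventually)).
intros eps. destruct (Hu eps) as [N HN]. exists N. intros k Hk.
apply C_NormedModule_mixin_compat1. specialize (HN k Hk).
rewrite Rminus_0_r in HN. eapply Rle_lt_trans; [exact (H k)|].
eapply Rle_lt_trans; [apply Rle_abs|exact HN].
Qed.

Lemma is_series_C_unique (a : nat -> C) (l l' : C) :
  @is_series C_AbsRing C_NormedModule a l -> @is_series C_AbsRing C_NormedModule a l' -> l = l'.
Proof.
exact (@filterlim_locally_unique nat C_AbsRing C_NormedModule eventually _ (sum_n a) l l').
Qed.

Lemma Csum_cons {A : Type} (x : A) (s : list A) (f : A -> C) : Csum (x :: s) f = f x + Csum s f.
Proof. reflexivity. Qed.

Lemma Csum_app {A : Type} (s s' : list A) (f : A -> C) : Csum (s ++ s') f = Csum s f + Csum s' f.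
Proof.
induction s as [|x s IH]; simpl app.
- unfold Csum at 2; simpl. ring.
- rewrite !Csum_cons, IH. ring.
Qed.

Lemma Csum_ext {A : Type} (s : list A) (f g : A -> C) :
  (forall x, In x s -> f x = g x) -> Csum s f = Csum s g.
Proof. intros H. unfold Csum. f_equal. now apply map_ext_in. Qed.

Lemma Csum_map {A B : Type} (h : A -> B) (s : list A) (f : B -> C) :
  Csum (map h s) f = Csum s (fun x => f (h x)).
Proof. unfold Csum. now rewrite map_map. Qed.

Lemma Csum_scal {A : Type} (c : C) (s : list A) (f : A -> C) :
  Csum s (fun x => c * f x) = c * Csum s f.
Proof.
induction s as [|x s IH]; [unfold Csum; simpl; ring|]. rewrite !Csum_cons, IH. ring.
Qed.

Lemma Cmod_Csum {A : Type} (s : list A) (f : A -> C) (M : R) :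
  (forall x, In x s -> (Cmod (f x) <= M)%R) -> (Cmod (Csum s f) <= INR (length s) * M)%R.
Proof.
induction s as [|x s IH]; intros H.
- unfold Csum; simpl. rewrite Cmod_0. lra.
- rewrite Csum_cons. eapply Rle_trans; [apply Cmod_triangle|].
  change (length (x :: s)) with (S (length s)). rewrite S_INR.
  assert (H1 := H x (or_introl eq_refl)). assert (H2 := IH (fun y Hy => H y (or_intror Hy))). lra.
Qed.

Lemma sum_n_m_Csum (f : nat -> C) (n : nat) : (1 <= n)%nat ->
  sum_n_m f 0 (n - 1) = Csum (seq 0 n) f.
Proof.
intros Hn. destruct n as [|n]; [lia|]. replace (S n - 1)%nat with n by lia. clear Hn.
induction n as [|n IH].
- rewrite sum_n_n. unfold Csum; simpl. ring.
- rewrite sum_n_Sm by lia. rewrite IH. rewrite (seq_S (S n)), Csum_app.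
  unfold Csum at 3. simpl. unfold plus; simpl. ring.
Qed.

(** * The function t^(-h) G(t) and its residues *)

Definition weighted_G (g : C -> C) (n : nat) (h : Z) (t : C) : C :=
  Cpowz t (- h) * Cprod (seq 1 n) (fun j => g (eta n ^ j * t)).

(** The zeros of t -> eta^(n-l) t + 2 m pi i, where the factor g(eta^(n-l) t) is singular. *)
Definition ray_pole (n l : nat) (m : Z) : C := two_pi_i m * eta n ^ l.

(** The summand of index (l, m); it will turn out to be a residue of t^(-h) G(t). *)
Definition residue_term (g : C -> C) (n : nat) (h : Z) (l : nat) (m : Z) : C :=
  Cpowz (two_pi_i m) (- h) *
  (Cpowz (eta n) (Z.of_nat l * (1 - h)) *
   Cprod (filter (fun j => negb (j + l =? n)%nat) (seq 1 n))
     (fun j => g (two_pi_i m * eta n ^ (j + l)))) *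
  Res (fun t => g (- t)) (two_pi_i m).

Lemma weighted_G_holomorphic (g : C -> C) (n : nat) (h : Z) (z : C) : (1 <= n)%nat ->
  (forall t, ~ in_two_pi_i_Z t -> holomorphic_at g t) ->
  (forall l m, (l < n)%nat -> z <> ray_pole n l m) ->
  holomorphic_at (weighted_G g n h) z.
Proof.
intros Hn Hg Hz. apply (holomorphic_at_mult (fun t => Cpowz t (- h))).
- apply holomorphic_at_Cpowz. intros ->. apply (Hz 0%nat 0%Z); [lia|].
  unfold ray_pole. rewrite two_pi_i_0. ring.
- apply (holomorphic_at_Cprod (seq 1 n) (fun j t => g (eta n ^ j * t))).
  intros j Hj. apply in_seq in Hj. apply holomorphic_at_rotate; [apply Cmod_eta_pow; lia|].
  apply Hg. intros HL. apply lattice_preimage in HL; [|lia]. destruct HL as [m E].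
  apply (Hz (n - j)%nat m); [lia|exact E].
Qed.

(** Keeps hold of a local representation of g that computes the residue of g(-t). *)
Lemma Res_reflect (g : C -> C) (m : Z) : pole_order_le 1 g (two_pi_i (- m)) ->
  exists phi : C -> C, holomorphic_at phi (two_pi_i (- m)) /\
    near_punctured (two_pi_i (- m)) (fun z => g z = phi z / (z - two_pi_i (- m))) /\
    Res (fun t => g (- t)) (two_pi_i m) = - phi (two_pi_i (- m)).
Proof.
intros [phi [Hphi [r [Hr E]]]]. exists phi. split; [exact Hphi|].
assert (E' : forall z, (0 < Cmod (z - two_pi_i (- m)) < r)%R -> g z = phi z / (z - two_pi_i (- m))).
{ intros z Hz. rewrite E by assumption. simpl. now rewrite Cmult_1_r. }
split; [now exists r|]. apply Res_eq.
rewrite two_pi_i_opp in *.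
replace (- phi (- two_pi_i m)) with ((fun t => - (1) * phi (- (1) * t)) (two_pi_i m)).
2:{ cbv beta. replace (- (1) * two_pi_i m) with (- two_pi_i m) by ring. ring. }
apply (is_residue_simple (fun t => g (- t)) (fun t => - (1) * phi (- (1) * t)) (two_pi_i m)).
- apply (holomorphic_at_mult (fun _ => - (1))); [apply holomorphic_at_const|].
  apply holomorphic_at_rotate; [apply Cmod_m1|].
  now replace (- (1) * two_pi_i m) with (- two_pi_i m) by ring.
- exists r. split; [exact Hr|]. intros z Hz.
  assert (H0 : z - two_pi_i m <> 0) by (apply Cmod_gt_0; lra).
  rewrite E'.
  + replace (- (1) * z) with (- z) by ring.
    replace (- z - - two_pi_i m) with (- (z - two_pi_i m)) by ring. set (w := z - two_pi_i m) in *. field. exact H0.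
  + replace (- z - - two_pi_i m) with (- (z - two_pi_i m)) by ring. now rewrite Cmod_opp.
Qed.

(** Near 2 m pi i eta^l the single singular factor is g(eta^(n-l) t) = g(-eta^(-l) t), which has a
    simple pole there; the other factors and t^(-h) are holomorphic and are evaluated at the
    pole. The substitution eta^(-l) t scales the residue by eta^l, which together with
    (eta^l)^(-h) gives eta^(l(1-h)). *)
Lemma weighted_G_residue (g : C -> C) (n : nat) (h : Z) (l : nat) (m : Z) :
  (forall t, ~ in_two_pi_i_Z t -> holomorphic_at g t) ->
  (forall m, m <> 0%Z -> pole_order_le 1 g (two_pi_i m)) ->
  (l < n)%nat -> m <> 0%Z ->
  is_residue (weighted_G g n h) (ray_pole n l m) (residue_term g n h l m).
Proof.
intros Hg Hs Hl Hm. assert (Hn : n <> 0%nat) by lia.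
destruct (Res_reflect g m (Hs (- m)%Z ltac:(lia))) as [phi [Hphi [[r [Hr E]] ER]]].
set (a := two_pi_i (- m)) in *. set (t0 := ray_pole n l m).
set (j0 := (n - l)%nat). set (s := filter (fun j => negb (j + l =? n)%nat) (seq 1 n)).
set (A := fun t => Cpowz t (- h) * Cprod s (fun j => g (eta n ^ j * t))).
assert (Ea : eta n ^ j0 * t0 = a).
{ unfold a, t0, ray_pole, j0. rewrite two_pi_i_opp.
  replace (eta n ^ (n - l) * (two_pi_i m * eta n ^ l)) with (two_pi_i m * (eta n ^ (n - l) * eta n ^ l)) by ring.
  rewrite <- Cpow_add_r. replace (n - l + l)%nat with n by lia. rewrite eta_pow_n by exact Hn. ring. }
assert (Ht0 : t0 <> 0).
{ apply Cmult_neq_0; [now apply two_pi_i_nz|now apply Cpow_nz, eta_neq0]. }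
assert (He0 : eta n ^ j0 <> 0) by now apply Cpow_nz, eta_neq0.
assert (Earg : forall j, eta n ^ j * t0 = two_pi_i m * eta n ^ (j + l)).
{ intros j. unfold t0, ray_pole. rewrite Cpow_add_r. ring. }
assert (HA : holomorphic_at A t0).
{ apply (holomorphic_at_mult (fun t => Cpowz t (- h))); [now apply holomorphic_at_Cpowz|].
  apply (holomorphic_at_Cprod s (fun j t => g (eta n ^ j * t))).
  intros j Hj. apply filter_In in Hj. destruct Hj as [Hj1 Hj2]. apply in_seq in Hj1.
  apply negb_true_iff, Nat.eqb_neq in Hj2.
  apply holomorphic_at_rotate; [now apply Cmod_eta_pow|]. apply Hg.
  rewrite Earg. apply off_lattice; [lia|exact Hj2|exact Hm]. }
replace (residue_term g n h l m) with ((fun t => A t * (/ eta n ^ j0 * phi (eta n ^ j0 * t))) t0).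
- apply (is_residue_simple (weighted_G g n h) (fun t => A t * (/ eta n ^ j0 * phi (eta n ^ j0 * t))) t0).
  + apply (holomorphic_at_mult A (fun t => / eta n ^ j0 * phi (eta n ^ j0 * t))); [exact HA|].
    apply (holomorphic_at_mult (fun _ => / eta n ^ j0)); [apply holomorphic_at_const|].
    apply holomorphic_at_rotate; [now apply Cmod_eta_pow|]. now rewrite Ea.
  + exists r. split; [exact Hr|]. intros z Hz.
    assert (H0 : z - t0 <> 0) by (apply Cmod_gt_0; lra).
    unfold weighted_G. rewrite (Cprod_remove (fun j => negb (j + l =? n)%nat) j0).
    * fold s. rewrite E.
      -- rewrite <- Ea. replace (eta n ^ j0 * z - eta n ^ j0 * t0) with (eta n ^ j0 * (z - t0)) by ring.
         unfold A. field. split; assumption.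
      -- rewrite <- Ea. replace (eta n ^ j0 * z - eta n ^ j0 * t0) with (eta n ^ j0 * (z - t0)) by ring.
         now rewrite Cmod_mult, Cmod_eta_pow, Rmult_1_l by exact Hn.
    * apply seq_NoDup.
    * apply in_seq. unfold j0. lia.
    * intros j Hj. apply in_seq in Hj. f_equal. unfold j0.
      destruct (Nat.eqb_spec (j + l) n); destruct (Nat.eqb_spec j (n - l)); try reflexivity; lia.
- cbv beta. rewrite Ea. unfold residue_term. rewrite ER. unfold A.
  rewrite (Cprod_ext s _ (fun j => g (two_pi_i m * eta n ^ (j + l)))) by (intros j _; now rewrite Earg).
  unfold t0, ray_pole. rewrite Cpowz_mult by (now apply two_pi_i_nz || now apply Cpow_nz, eta_neq0).
  replace (Z.of_nat l * (1 - h))%Z with (Z.of_nat l + Z.of_nat l * - h)%Z by ring.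
  rewrite Cpowz_add, Cpowz_of_nat, Cpowz_pow by now apply eta_neq0.
  assert (Ei : / eta n ^ j0 = - eta n ^ l).
  { apply (f_equal (fun x => / eta n ^ j0 * x)) in Ea.
    assert (E1 : eta n ^ j0 * eta n ^ l = - (1)).
    { rewrite <- Cpow_add_r. unfold j0. replace (n - l + l)%nat with n by lia. now apply eta_pow_n. }
    replace (- eta n ^ l) with (/ eta n ^ j0 * - (eta n ^ j0 * eta n ^ l)) by (field; exact He0).
    rewrite E1. ring. }
  rewrite Ei. fold s. ring.
Qed.

Lemma pole_order_mult (f g : C -> C) (a : C) (N M : nat) :
  pole_order_le N f a -> pole_order_le M g a -> pole_order_le (N + M) (fun z => f z * g z) a.
Proof.
intros [p [Hp [r1 [Hr1 E1]]]] [q [Hq [r2 [Hr2 E2]]]].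
exists (fun z => p z * q z). split; [now apply holomorphic_at_mult|].
exists (Rmin r1 r2). split; [now apply Rmin_pos|].
intros z [Hz1 Hz2]. rewrite E1, E2.
- rewrite Cpow_add_r. field. split; apply Cpow_nz, Cmod_gt_0; lra.
- split; [assumption|]. eapply Rlt_le_trans; [exact Hz2|apply Rmin_r].
- split; [assumption|]. eapply Rlt_le_trans; [exact Hz2|apply Rmin_l].
Qed.

Lemma pole_order_rotate (f : C -> C) (u : C) (N : nat) : Cmod u = 1%R ->
  pole_order_le N f 0 -> pole_order_le N (fun z => f (u * z)) 0.
Proof.
intros Hu [p [Hp [r [Hr E]]]]. assert (Hu0 : u <> 0) by (apply Cmod_gt_0; lra).
exists (fun z => / u ^ N * p (u * z)). split.
- apply (holomorphic_at_mult (fun _ => / u ^ N)); [apply holomorphic_at_const|].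
  apply holomorphic_at_rotate; [exact Hu|]. now rewrite Cmult_0_r.
- exists r. split; [exact Hr|]. intros z Hz.
  assert (H0 : z - 0 <> 0) by (apply Cmod_gt_0; lra).
  rewrite E.
  + replace (u * z - 0) with (u * (z - 0)) by ring. rewrite Cpow_mult_l.
    field. split; now apply Cpow_nz.
  + replace (u * z - 0) with (u * (z - 0)) by ring. now rewrite Cmod_mult, Hu, Rmult_1_l.
Qed.

Lemma pole_order_Cpowz (k : Z) : exists N : nat, pole_order_le N (fun z => Cpowz z k) 0.
Proof.
destruct (Z_sub_nat k) as [a [b ->]]. exists b, (fun z => z ^ a). split.
- exists 1%R. split; [lra|]. intros z _. apply (Cdiff_pow (fun z => z)), Cdiff_id.
- exists 1%R. split; [lra|]. intros z [Hz _]. replace (z - 0) with z in * by ring.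
  apply Cpowz_sub_nat. now apply Cmod_gt_0.
Qed.

Lemma pole_order_Cprod (s : list nat) (F : nat -> C -> C) (a : C) :
  (forall j, In j s -> exists N, pole_order_le N (F j) a) ->
  exists N, pole_order_le N (fun z => Cprod s (fun j => F j z)) a.
Proof.
induction s as [|j s IH]; intros H.
- exists 0%nat, (fun _ => RtoC 1). split; [apply holomorphic_at_const|].
  exists 1%R. split; [lra|]. intros z _. unfold Cprod; simpl. field.
- destruct (H j (or_introl eq_refl)) as [N1 H1].
  destruct IH as [N2 H2]; [intros i Hi; apply H; now right|].
  exists (N1 + N2)%nat. now apply (pole_order_mult (F j)).
Qed.

Lemma weighted_G_residue_0 (g : C -> C) (n : nat) (h : Z) : (1 <= n)%nat -> meromorphic g ->
  exists r : C, is_residue (weighted_G g n h) 0 r.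
Proof.
intros Hn Hg. destruct (pole_order_Cpowz (- h)) as [N1 H1].
destruct (pole_order_Cprod (seq 1 n) (fun j t => g (eta n ^ j * t)) 0) as [N2 H2].
{ intros j Hj. destruct (Hg 0) as [N H]. exists N.
  apply pole_order_rotate; [apply Cmod_eta_pow; lia|exact H]. }
apply (pole_has_residue (N1 + N2)).
now apply (pole_order_mult (fun z => Cpowz z (- h))).
Qed.

(** * Estimates from the growth condition *)

Lemma Cmod_ray_pole (n l : nat) (m : Z) : (l < n)%nat ->
  Cmod (ray_pole n l m) = (2 * PI * IZR (Z.abs m))%R.
Proof.
intros Hl. unfold ray_pole. rewrite Cmod_mult, Cmod_eta_pow, Cmod_two_pi_i by lia. ring.
Qed.

(** Consecutive poles on one ray are 2 pi apart; poles on different rays are also 2 pi apart once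
    |m| is large, because rays diverge. *)
Lemma ray_pole_gap (n : nat) : exists m0 : nat, (1 <= m0)%nat /\
  forall (l l' : nat) (m m' : Z), (l < n)%nat -> (l' < n)%nat -> (Z.of_nat m0 <= Z.abs m)%Z ->
  (l, m) <> (l', m') ->
  (2 * PI <= Cmod (ray_pole n l m - ray_pole n l' m'))%R.
Proof.
destruct (eta_rays_separated n) as [s [Hs H]].
destruct (nfloor_ex (/ s)) as [m0 Hm0]; [now apply Rlt_le, Rinv_0_lt_compat|].
exists (S m0). split; [lia|]. intros l l' m m' Hl Hl' Hm Hne. pose proof two_PI_pos as HPI.
destruct (Nat.eq_dec l l') as [<-|Hll].
- assert (Hmm : m <> m') by (intros ->; now apply Hne).
  replace (ray_pole n l m - ray_pole n l m') with (ray_pole n l (m - m'))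
    by (unfold ray_pole, two_pi_i; rewrite minus_IZR, RtoC_minus; ring).
  rewrite Cmod_ray_pole by exact Hl. rewrite <- (Rmult_1_r (2 * PI)) at 1.
  apply Rmult_le_compat_l; [lra|]. apply IZR_le. lia.
- eapply Rle_trans; [|now apply H]. rewrite Rmult_assoc, <- (Rmult_1_r (2 * PI)) at 1.
  apply Rmult_le_compat_l; [lra|].
  assert (Hm' : (/ s <= IZR (Z.abs m))%R).
  { apply Rle_trans with (INR (S m0)); [rewrite S_INR; lra|]. rewrite INR_IZR_INZ. now apply IZR_le. }
  rewrite <- (Rinv_l s) by lra. apply Rmult_le_compat_r; lra.
Qed.

Definition off_disks (n : nat) (eps : R) (t : C) : Prop :=
  ~ (exists (l : nat) (m : Z), (l <= n - 1)%nat /\ closed_disk (two_pi_i m * eta n ^ l) eps t).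

Definition G_decay (g : C -> C) (n : nat) (gamma1 gamma2 eps : R) : Prop :=
  forall t : C, off_disks n eps t ->
    (Cmod (Gprod n g t) <= gamma1 * Rpower (Cmod t) (- gamma2))%R.

Lemma off_disks_intro (n : nat) (eps : R) (t : C) : (1 <= n)%nat ->
  (forall l m, (l < n)%nat -> (eps < Cmod (t - ray_pole n l m))%R) -> off_disks n eps t.
Proof.
intros Hn H [l [m [Hl Hd]]]. unfold closed_disk in Hd.
specialize (H l m ltac:(lia)). unfold ray_pole in H. lra.
Qed.

(** The two exponents add up: |t^(-h)| |t|^(-gamma2) = |t|^(-(h + gamma2)). *)
Lemma weighted_G_bound (g : C -> C) (n : nat) (h : Z) (gamma1 gamma2 eps : R) (t : C) :
  G_decay g n gamma1 gamma2 eps -> off_disks n eps t -> t <> 0 ->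
  (Cmod (weighted_G g n h t) <= gamma1 * Rpower (Cmod t) (- (IZR h + gamma2)))%R.
Proof.
intros HG Ht H0. unfold weighted_G. rewrite Cmod_mult, Cmod_Cpowz by exact H0.
replace (- (IZR h + gamma2))%R with (IZR (- h) + - gamma2)%R by (rewrite opp_IZR; ring).
rewrite Rpower_plus, (Rmult_comm gamma1), Rmult_assoc, (Rmult_comm _ gamma1).
apply Rmult_le_compat_l; [apply Rlt_le, exp_pos|]. now apply HG.
Qed.

(** Cauchy's estimate on a circle slightly larger than the excluded disk. For large |m| this
    circle avoids all other disks, and |t| is comparable to |m| on it, so the growth condition
    gives a bound of order |m|^(-(h + gamma2)). *)
Lemma residue_term_bound (g : C -> C) (n : nat) (h : Z) (gamma1 gamma2 eps : R) :
  (forall t, ~ in_two_pi_i_Z t -> holomorphic_at g t) ->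
  (forall m, m <> 0%Z -> pole_order_le 1 g (two_pi_i m)) ->
  (1 <= n)%nat -> (0 < gamma1)%R -> (0 < eps)%R -> (eps < PI)%R ->
  (0 <= IZR h + gamma2)%R -> G_decay g n gamma1 gamma2 eps ->
  exists (m0 : nat) (K : R), (0 <= K)%R /\
  forall l m, (l < n)%nat -> m <> 0%Z -> (Z.of_nat m0 <= Z.abs m)%Z ->
    (Cmod (residue_term g n h l m) <= K * Rpower (IZR (Z.abs m)) (- (IZR h + gamma2)))%R.
Proof.
intros Hg Hs Hn Hg1 He HePI Hk HG.
destruct (ray_pole_gap n) as [m0 [Hm0 Hgap]]. set (rho := ((eps + PI) / 2)%R).
pose proof PI_RGT_0 as HPI. pose proof PI2_1 as HPI2.
exists m0, (gamma1 * rho)%R. split; [apply Rmult_le_pos; unfold rho; lra|].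
intros l m Hl Hm Hmm.
assert (Hm1 : (1 <= IZR (Z.abs m))%R) by (apply IZR_le; lia).
(* rho + eps < 2 pi, so the closed disk of radius rho about the pole avoids the other
   excluded disks *)
assert (Hfar : forall z l' m', (Cmod (z - ray_pole n l m) <= rho)%R -> (l' < n)%nat ->
  (l, m) <> (l', m') -> (eps < Cmod (z - ray_pole n l' m'))%R).
{ intros z l' m' Hz Hl' Hne. specialize (Hgap l l' m m' Hl Hl' Hmm Hne).
  pose proof (Cmod_triangle (ray_pole n l m - z) (z - ray_pole n l' m')) as T.
  replace (ray_pole n l m - z + (z - ray_pole n l' m')) with (ray_pole n l m - ray_pole n l' m') in T by ring.
  rewrite Cmod_minus_sym in T. rewrite (Cmod_minus_sym (ray_pole n l m) z) in T.
  rewrite (Cmod_minus_sym (ray_pole n l' m')) in T. unfold rho in Hz. lra. }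
replace (gamma1 * rho * Rpower (IZR (Z.abs m)) (- (IZR h + gamma2)))%R
  with (gamma1 * Rpower (IZR (Z.abs m)) (- (IZR h + gamma2)) * rho)%R by ring.
apply (residue_bound (weighted_G g n h) (ray_pole n l m)).
- unfold rho; lra.
- now apply weighted_G_residue.
- intros z Hz Hne. apply holomorphic_at_Cdiff, weighted_G_holomorphic; [exact Hn|exact Hg|].
  intros l' m' Hl' E. destruct (Nat.eq_dec l l') as [<-|Hll].
  + destruct (Z.eq_dec m m') as [<-|Hm']; [contradiction|].
    specialize (Hfar z l m' Hz Hl' ltac:(intros F; injection F; auto)).
    rewrite E in Hfar. replace (ray_pole n l m' - ray_pole n l m') with (RtoC 0) in Hfar by ring.
    rewrite Cmod_0 in Hfar. lra.
  + specialize (Hfar z l' m' Hz Hl' ltac:(intros F; injection F; auto)).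
    rewrite E in Hfar. replace (ray_pole n l' m' - ray_pole n l' m') with (RtoC 0) in Hfar by ring.
    rewrite Cmod_0 in Hfar. lra.
- intros z Hz.
  assert (Hzm : (IZR (Z.abs m) <= Cmod z)%R).
  { pose proof (Cmod_triangle_rev (ray_pole n l m) (ray_pole n l m - z)) as T.
    replace (ray_pole n l m - (ray_pole n l m - z)) with z in T by ring.
    rewrite (Cmod_minus_sym (ray_pole n l m)), Hz, Cmod_ray_pole in T by exact Hl.
    unfold rho in T. nra. }
  eapply Rle_trans.
  + apply (weighted_G_bound g n h gamma1 gamma2 eps z HG).
    * apply off_disks_intro; [exact Hn|]. intros l' m' Hl'.
      destruct (Nat.eq_dec l l') as [<-|Hll].
      -- destruct (Z.eq_dec m m') as [<-|Hm']; [rewrite Hz; unfold rho; lra|].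
         apply Hfar; [lra|exact Hl'|]. intros F; injection F; auto.
      -- apply Hfar; [lra|exact Hl'|]. intros F; injection F; auto.
    * apply Cmod_gt_0. lra.
  + apply Rmult_le_compat_l; [lra|]. apply Rpower_neg_antitone; lra.
Qed.

(** Comparison with the series of k^(-kappa), after dropping finitely many terms. *)
Lemma abs_summable (a : Z -> C) (m0 : nat) (K kappa : R) : (1 < kappa)%R -> (0 <= K)%R ->
  (forall m, m <> 0%Z -> (Z.of_nat m0 <= Z.abs m)%Z ->
    (Cmod (a m) <= K * Rpower (IZR (Z.abs m)) (- kappa))%R) ->
  ex_series (fun k : nat => Cmod (a (Z.of_nat (S k)))) /\
  ex_series (fun k : nat => Cmod (a (- Z.of_nat (S k))%Z)).
Proof.
intros Hk HK H.
assert (B : forall e : nat -> Z, (forall k, Z.abs (e k) = Z.of_nat (S k)) ->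
  ex_series (fun k => Cmod (a (e k)))).
{ intros e He. apply (ex_series_incr_n _ m0).
  apply (ex_series_le (V := R_CompleteNormedModule)) with (fun k => K * Rpower (INR (S (m0 + k))) (- kappa))%R.
  - intros k. apply Rle_trans with (Cmod (a (e (m0 + k)%nat))).
    { right. apply Rabs_pos_eq, Cmod_ge_0. }
    specialize (He (m0 + k)%nat). rewrite INR_IZR_INZ, <- He. apply H; lia.
  - apply (ex_series_scal_l (V := R_NormedModule) K (fun k => Rpower (INR (S (m0 + k))) (- kappa))).
    apply (ex_series_incr_n (fun k => Rpower (INR (S k)) (- kappa)) m0).
    now apply ex_series_Rpower. }
split; apply B; intros k; lia.
Qed.

(** * Summation of the residues *)

(** The poles of modulus at most 2 pi M, arranged by modulus so that enlarging M adds the two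
    layers m = M and m = -M. *)
Fixpoint poles (n M : nat) : list C :=
  match M with
  | O => RtoC 0 :: nil
  | S M' => map (fun l => ray_pole n l (Z.of_nat M)) (seq 0 n) ++
            map (fun l => ray_pole n l (- Z.of_nat M)%Z) (seq 0 n) ++ poles n M'
  end.

Lemma poles_sound (n M : nat) (p : C) : (1 <= n)%nat -> In p (poles n M) ->
  exists l m, (l < n)%nat /\ (Z.abs m <= Z.of_nat M)%Z /\ p = ray_pole n l m.
Proof.
intros Hn. induction M as [|M IH]; intros H.
- destruct H as [<-|[]]. exists 0%nat, 0%Z. split; [lia|]. split; [lia|].
  unfold ray_pole. rewrite two_pi_i_0. ring.
- simpl poles in H. apply in_app_iff in H. destruct H as [H|H]; [|apply in_app_iff in H; destruct H as [H|H]].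
  + apply in_map_iff in H. destruct H as [l [E Hl]]. apply in_seq in Hl.
    eexists l, _. split; [lia|]. split; [|symmetry; exact E]. lia.
  + apply in_map_iff in H. destruct H as [l [E Hl]]. apply in_seq in Hl.
    eexists l, _. split; [lia|]. split; [|symmetry; exact E]. lia.
  + destruct (IH H) as [l [m [Hl [Hm E]]]]. exists l, m. split; [exact Hl|]. split; [lia|exact E].
Qed.

Lemma poles_complete (n M l : nat) (m : Z) : (l < n)%nat -> (Z.abs m <= Z.of_nat M)%Z ->
  In (ray_pole n l m) (poles n M).
Proof.
intros Hl. induction M as [|M IH]; intros Hm.
- left. replace m with 0%Z by lia. unfold ray_pole. rewrite two_pi_i_0. ring.
- simpl poles. apply in_app_iff.
  destruct (Z.eq_dec m (Z.of_nat (S M))) as [->|H1].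
  { left. apply (in_map (fun l => ray_pole n l (Z.of_nat (S M)))). apply in_seq. lia. }
  right. apply in_app_iff.
  destruct (Z.eq_dec m (- Z.of_nat (S M))) as [->|H2].
  { left. apply (in_map (fun l => ray_pole n l (- Z.of_nat (S M))%Z)). apply in_seq. lia. }
  right. apply IH. lia.
Qed.

Lemma poles_NoDup (n M : nat) : (1 <= n)%nat -> NoDup (poles n M).
Proof.
intros Hn. induction M as [|M IH].
- apply NoDup_cons; [easy|constructor].
- assert (Hmap : forall m, m <> 0%Z -> NoDup (map (fun l => ray_pole n l m) (seq 0 n))).
  { intros m Hm. apply NoDup_map_NoDup_ForallPairs; [|apply seq_NoDup].
    intros l l' Hl Hl' E. apply in_seq in Hl, Hl'.
    apply ray_pole_inj in E; [easy|lia|lia|exact Hm]. }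
  assert (Hdisj : forall m p, (Z.abs m = Z.of_nat (S M))%Z ->
    In p (map (fun l => ray_pole n l m) (seq 0 n)) -> ~ In p (poles n M)).
  { intros m p Hm H1 H2. apply in_map_iff in H1. destruct H1 as [l [E Hl]]. apply in_seq in Hl.
    destruct (poles_sound n M p Hn H2) as [l' [m' [Hl' [Hm' E']]]].
    rewrite E' in E. apply ray_pole_inj in E; lia. }
  simpl poles. apply NoDup_app; [apply Hmap; lia| |].
  + apply NoDup_app; [apply Hmap; lia|exact IH|]. intros p. apply Hdisj. lia.
  + intros p H1 H2. apply in_app_iff in H2. destruct H2 as [H2|H2].
    * apply in_map_iff in H1. destruct H1 as [l [E Hl]]. apply in_seq in Hl.
      apply in_map_iff in H2. destruct H2 as [l' [E' Hl']]. apply in_seq in Hl'.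
      rewrite <- E' in E. apply ray_pole_inj in E; lia.
    * revert H2. revert H1. apply Hdisj. lia.
Qed.

Lemma Csum_poles (n N : nat) (r : C -> C) :
  Csum (poles n (S N)) r =
  sum_n (fun k => Csum (seq 0 n) (fun l => r (ray_pole n l (Z.of_nat (S k)))) +
                  Csum (seq 0 n) (fun l => r (ray_pole n l (- Z.of_nat (S k))%Z))) N + r 0.
Proof.
assert (Hstep : forall M, Csum (poles n (S M)) r =
  Csum (seq 0 n) (fun l => r (ray_pole n l (Z.of_nat (S M)))) +
  Csum (seq 0 n) (fun l => r (ray_pole n l (- Z.of_nat (S M))%Z)) + Csum (poles n M) r).
{ intros M. cbn [poles]. rewrite !Csum_app, !Csum_map. ring. }
induction N as [|N IH].
- rewrite Hstep, sum_O. replace (Csum (poles n 0) r) with (r 0) by (symmetry; exact (Cplus_0_r (r 0))).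
  reflexivity.
- rewrite Hstep, IH, sum_Sn.
  match goal with |- context [plus ?x ?y] => change (plus x y) with (Cplus x y) end. ring.
Qed.

(** The circle of radius (2N+1) pi passes half-way between the poles of modulus 2 pi N and
    2 pi (N+1), hence at distance at least pi > eps from all of them. Its length contributes one
    power of the radius, and h + gamma2 > 1 leaves a negative exponent. *)
Lemma weighted_G_circle_bound (g : C -> C) (n : nat) (h : Z) (gamma1 gamma2 eps : R) (N : nat) :
  (forall t, ~ in_two_pi_i_Z t -> holomorphic_at g t) ->
  (1 <= n)%nat -> (0 < gamma1)%R -> (eps < PI)%R ->
  (1 < IZR h + gamma2)%R -> G_decay g n gamma1 gamma2 eps ->
  (Cmod (oint (weighted_G g n h) 0 ((2 * INR N + 1) * PI)) <=
   2 * PI * (gamma1 * Rpower (INR N + 1) (- (IZR h + gamma2 - 1))))%R.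
Proof.
intros Hg Hn Hg1 HePI Hk HG. pose proof PI_RGT_0 as HPI. pose proof PI2_1 as HPI2.
set (Rad := ((2 * INR N + 1) * PI)%R). pose proof (pos_INR N) as HN.
assert (HR0 : (INR N + 1 <= Rad)%R) by (unfold Rad; nra).
assert (Hfar : forall z l m, Cmod (z - 0) = Rad -> (l < n)%nat -> (PI <= Cmod (z - ray_pole n l m))%R).
{ intros z l m Hz Hl. replace (z - 0) with z in Hz by ring.
  pose proof (Cmod_triangle_rev z (ray_pole n l m)) as T1.
  pose proof (Cmod_triangle_rev (ray_pole n l m) z) as T2.
  rewrite (Cmod_minus_sym (ray_pole n l m)) in T2.
  rewrite Hz, Cmod_ray_pole in T1, T2 by exact Hl.
  unfold Rad in T1, T2. rewrite INR_IZR_INZ in T1, T2.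
  destruct (Z_le_gt_dec (Z.abs m) (Z.of_nat N)) as [L|L].
  - apply IZR_le in L. nra.
  - assert (L' : (IZR (Z.of_nat N) + 1 <= IZR (Z.abs m))%R) by (rewrite <- plus_IZR; apply IZR_le; lia).
    nra. }
assert (Hoff : forall z, Cmod (z - 0) = Rad -> off_disks n eps z).
{ intros z Hz. apply off_disks_intro; [exact Hn|]. intros l m Hl.
  specialize (Hfar z l m Hz Hl). lra. }
eapply Rle_trans.
- apply (oint_bound (weighted_G g n h) 0 Rad (gamma1 * Rpower Rad (- (IZR h + gamma2)))).
  + lra.
  + intros z Hz. apply holomorphic_at_Cdiff, weighted_G_holomorphic; [exact Hn|exact Hg|].
    intros l m Hl E. specialize (Hfar z l m Hz Hl). rewrite E in Hfar.
    replace (ray_pole n l m - ray_pole n l m) with (RtoC 0) in Hfar by ring.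
    rewrite Cmod_0 in Hfar. lra.
  + intros z Hz. assert (Hz' : Cmod z = Rad) by (rewrite <- Hz; f_equal; ring).
    rewrite <- Hz'. apply weighted_G_bound with eps; [exact HG|now apply Hoff|]. apply Cmod_gt_0. lra.
- apply Rmult_le_compat_l; [lra|].
  rewrite (Rmult_assoc gamma1). apply Rmult_le_compat_l; [lra|].
  rewrite <- (Rpower_1 Rad) at 2 by lra. rewrite <- Rpower_plus.
  replace (- (IZR h + gamma2) + 1)%R with (- (IZR h + gamma2 - 1))%R by ring.
  apply Rpower_neg_antitone; lra.
Qed.

(** The N-th partial sum, plus the residue at 0, is the integral over the circle of radius
    (2N+3) pi divided by 2 pi i, and this tends to 0. *)
Lemma residue_series (g : C -> C) (n : nat) (h : Z) (gamma1 gamma2 eps : R) (r0 : C) :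
  (forall t, ~ in_two_pi_i_Z t -> holomorphic_at g t) ->
  (forall m, m <> 0%Z -> pole_order_le 1 g (two_pi_i m)) ->
  (1 <= n)%nat -> (0 < gamma1)%R -> (eps < PI)%R ->
  (1 < IZR h + gamma2)%R -> G_decay g n gamma1 gamma2 eps ->
  is_residue (weighted_G g n h) 0 r0 ->
  @is_series C_AbsRing C_NormedModule (fun k : nat =>
    Csum (seq 0 n) (fun l => residue_term g n h l (Z.of_nat (S k))) +
    Csum (seq 0 n) (fun l => residue_term g n h l (- Z.of_nat (S k))%Z)) (- r0).
Proof.
intros Hg Hs Hn Hg1 HePI Hk HG Hr0. pose proof PI_RGT_0 as HPI.
apply is_series_C with (fun N => gamma1 * Rpower (INR (S (S N))) (- (IZR h + gamma2 - 1)))%R.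
- intros N.
  assert (Ht : forall l m, (l < n)%nat -> m <> 0%Z -> Res (weighted_G g n h) (ray_pole n l m) = residue_term g n h l m).
  { intros l m Hl Hm. apply Res_eq. now apply weighted_G_residue. }
  assert (E : oint (weighted_G g n h) 0 ((2 * INR (S N) + 1) * PI) =
    2 * PI * Ci * Csum (poles n (S N)) (Res (weighted_G g n h))).
  { pose proof (pos_INR (S N)) as HN. apply residue_theorem.
    - nra.
    - now apply poles_NoDup.
    - intros p Hp. destruct (poles_sound _ _ _ Hn Hp) as [l [m [Hl [Hm ->]]]].
      replace (ray_pole n l m - 0) with (ray_pole n l m) by ring.
      rewrite Cmod_ray_pole by exact Hl. apply IZR_le in Hm. rewrite <- INR_IZR_INZ in Hm. nra.
    - intros p Hp. destruct (poles_sound _ _ _ Hn Hp) as [l [m [Hl [Hm ->]]]].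
      destruct (Z.eq_dec m 0) as [->|Hm0].
      + replace (ray_pole n l 0) with (RtoC 0) by (unfold ray_pole; rewrite two_pi_i_0; ring).
        now rewrite (Res_eq _ _ _ Hr0).
      + rewrite Ht by assumption. now apply weighted_G_residue.
    - intros z Hz Hin. apply holomorphic_at_Cdiff, weighted_G_holomorphic; [exact Hn|exact Hg|].
      intros l m Hl ->. apply Hin, poles_complete; [exact Hl|].
      replace (ray_pole n l m - 0) with (ray_pole n l m) in Hz by ring.
      rewrite Cmod_ray_pole in Hz by exact Hl.
      rewrite INR_IZR_INZ in Hz.
      destruct (Z_le_gt_dec (Z.abs m) (Z.of_nat (S N))) as [L|L]; [exact L|].
      assert (L' : (IZR (Z.of_nat (S N)) + 1 <= IZR (Z.abs m))%R) by (rewrite <- plus_IZR; apply IZR_le; lia).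
      nra. }
  rewrite Csum_poles, (Res_eq _ _ _ Hr0) in E.
  match type of E with _ = _ * (?x + _) => set (S1 := x) in E end.
  match goal with |- (Cmod (?x - _) <= _)%R => set (S2 := x) end.
  assert (ES : S1 = S2).
  { apply sum_n_ext. intros k. f_equal; apply Csum_ext; intros l Hl; apply in_seq in Hl; apply Ht; lia. }
  rewrite ES in E.
  pose proof (weighted_G_circle_bound g n h gamma1 gamma2 eps (S N) Hg Hn Hg1 HePI Hk HG) as B.
  rewrite E, !Cmod_mult, Cmod_Ci, !Cmod_R, !Rabs_pos_eq, Rmult_1_r in B by lra.
  apply Rmult_le_reg_l in B; [|lra].
  replace (S2 - - r0) with (S2 + r0) by ring. rewrite (S_INR (S N)). exact B.
- replace (Finite 0) with (Rbar_mult gamma1 0) by (simpl; f_equal; ring).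
  apply (is_lim_seq_scal_l (fun N => Rpower (INR (S (S N))) (- (IZR h + gamma2 - 1))) gamma1 0).
  apply (is_lim_seq_incr_1 (fun N => Rpower (INR (S N)) (- (IZR h + gamma2 - 1)))).
  apply Rpower_neg_lim. lra.
Qed.

(** * Even functions *)

Definition even_term (g : C -> C) (n : nat) (h : Z) (m : Z) : C :=
  Cpowz (two_pi_i m) (- h) *
  Cprod (seq 1 (n - 1)) (fun j => g (two_pi_i m * eta n ^ j)) * Res g (two_pi_i m).

Lemma near_two_pi_i_off (m : Z) : near_punctured (two_pi_i m) (fun z => ~ in_two_pi_i_Z z).
Proof.
exists 1%R. split; [lra|]. intros z Hz [m' ->].
replace (two_pi_i m' - two_pi_i m) with (two_pi_i (m' - m)) in Hz
  by (unfold two_pi_i; rewrite minus_IZR, RtoC_minus; ring).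
rewrite Cmod_two_pi_i in Hz. pose proof PI_RGT_0. pose proof PI2_1.
destruct (Z.eq_dec m' m) as [->|Hne].
- rewrite Z.sub_diag in Hz. simpl in Hz. lra.
- assert (1 <= IZR (Z.abs (m' - m)))%R by (apply IZR_le; lia). nra.
Qed.

Lemma Res_even (g : C -> C) (m : Z) : even_off_poles g -> pole_order_le 1 g (two_pi_i m) ->
  Res (fun t => g (- t)) (two_pi_i m) = Res g (two_pi_i m).
Proof.
intros Hev Hp. destruct (pole_has_residue _ _ _ Hp) as [r Hr].
rewrite (Res_eq _ _ _ Hr). apply Res_eq. apply (is_residue_ext g); [|exact Hr].
destruct (near_two_pi_i_off m) as [d [Hd H]]. exists d. split; [exact Hd|].
intros z Hz. symmetry. apply Hev. now apply H.
Qed.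

Lemma filter_seq_remove (n l : nat) : (l < n)%nat ->
  filter (fun j => negb (j + l =? n)%nat) (seq 1 n) = seq 1 (n - l - 1) ++ seq (n - l + 1) l.
Proof.
intros Hl.
replace (seq 1 n) with (seq 1 (n - l - 1) ++ (n - l)%nat :: seq (n - l + 1) l).
2:{ replace ((n - l)%nat :: seq (n - l + 1) l) with (seq (1 + (n - l - 1)) (S l)).
    - rewrite <- seq_app. f_equal. lia.
    - cbn [seq]. f_equal; [lia|]. f_equal. lia. }
rewrite filter_app. cbn [filter].
replace (n - l + l =? n)%nat with true by (symmetry; apply Nat.eqb_eq; lia). cbn [negb].
f_equal; apply forallb_filter_id, forallb_forall; intros j Hj; apply in_seq in Hj;
  apply negb_true_iff, Nat.eqb_neq; lia.
Qed.

Lemma Cprod_shift (s len a : nat) (f : nat -> C) :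
  Cprod (seq (s + a) len) f = Cprod (seq s len) (fun j => f (j + a)%nat).
Proof.
revert s. induction len as [|len IH]; intros s; [reflexivity|].
cbn [seq]. rewrite !Cprod_cons. f_equal. apply (IH (S s)).
Qed.

(** For j + l > n, evenness and eta^n = -1 lower the exponent j + l by n; the exponents then
    run through 1, ..., n-1 for every l, so the product does not depend on l. *)
Lemma residue_term_even (g : C -> C) (n : nat) (h : Z) (l : nat) (m : Z) :
  even_off_poles g -> pole_order_le 1 g (two_pi_i m) -> (l < n)%nat -> m <> 0%Z ->
  residue_term g n h l m = Cpowz (eta n) (Z.of_nat l * (1 - h)) * even_term g n h m.
Proof.
intros Hev Hp Hl Hm. unfold residue_term, even_term. rewrite Res_even by assumption.
assert (E : Cprod (filter (fun j => negb (j + l =? n)%nat) (seq 1 n))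
     (fun j => g (two_pi_i m * eta n ^ (j + l))) =
   Cprod (seq 1 (n - 1)) (fun j => g (two_pi_i m * eta n ^ j))).
{ rewrite filter_seq_remove, Cprod_app by exact Hl.
  replace (n - 1)%nat with (l + (n - l - 1))%nat by lia. rewrite seq_app, Cprod_app, Cmult_comm.
  f_equal.
  - replace (n - l + 1)%nat with (1 + (n - l))%nat by lia. rewrite Cprod_shift.
    apply Cprod_ext. intros j Hj. apply in_seq in Hj.
    rewrite <- Hev by (apply off_lattice; lia). f_equal.
    replace (j + (n - l) + l)%nat with (n + j)%nat by lia.
    rewrite Cpow_add_r, eta_pow_n by lia. ring.
  - now rewrite (Cprod_shift 1 (n - l - 1) l). }
rewrite E. ring.
Qed.

(** * The constant Z_h *)

Lemma Csum_geometric (w : C) (n : nat) : (1 - w) * Csum (seq 0 n) (fun j => w ^ j) = 1 - w ^ n.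
Proof.
induction n as [|n IH].
- unfold Csum; simpl. ring.
- rewrite seq_S, Csum_app, Cmult_plus_distr_l, IH. unfold Csum; simpl. ring.
Qed.

Lemma calZ_Csum (n : nat) (h : Z) : (1 <= n)%nat ->
  calZ n h = Csum (seq 0 n) (fun j => Cpowz (eta n) (1 - h) ^ j).
Proof.
intros Hn. unfold calZ. rewrite sum_n_m_Csum by exact Hn. apply Csum_ext. intros j _.
assert (H0 := eta_neq0 n ltac:(lia)).
clear Hn. induction j as [|j IH].
- reflexivity.
- rewrite Nat2Z.inj_succ, Z.mul_succ_l, Cpowz_add, IH by exact H0. rewrite Cpow_S. ring.
Qed.

Lemma Cpowz_eta_cis (n : nat) (k : Z) : n <> 0%nat ->
  Cpowz (eta n) k = cis (IZR k * (PI / INR n)).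
Proof.
intros Hn. assert (H0 := eta_neq0 n Hn). destruct (Z_sub_nat k) as [a [b ->]].
rewrite Cpowz_sub_nat, !eta_pow, minus_IZR, <- !INR_IZR_INZ by assumption.
replace (INR a * (PI / INR n))%R
  with ((INR a - INR b) * (PI / INR n) + INR b * (PI / INR n))%R by ring.
rewrite cis_plus. field. apply cis_neq0.
Qed.

Lemma cis_eq_1 (x : R) : cis x = 1 -> exists k : Z, x = (2 * IZR k * PI)%R.
Proof.
intros H. apply (f_equal fst) in H. simpl in H.
replace x with (2 * (x / 2))%R in H by field. rewrite cos_2a_sin in H.
assert (Hs : sin (x / 2) = 0%R).
{ apply Rsqr_0_uniq. unfold Rsqr. lra. }
apply sin_eq_0_0 in Hs. destruct Hs as [k Hk]. exists k. lra.
Qed.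

Lemma Cpowz_1_l (k : Z) : Cpowz 1 k = 1.
Proof. destruct k; simpl; rewrite ?Cpow_1_l; [reflexivity|reflexivity|field]. Qed.

Lemma eta_power_eq_1 (n : nat) (k : Z) : n <> 0%nat ->
  Cpowz (eta n) k = 1 <-> (2 * Z.of_nat n | k)%Z.
Proof.
intros Hn. assert (HnR : INR n <> 0%R) by now apply not_0_INR.
pose proof PI_RGT_0 as HPI. rewrite Cpowz_eta_cis by exact Hn. split.
- intros H. apply cis_eq_1 in H. destruct H as [z Hz]. exists z.
  apply eq_IZR. rewrite !mult_IZR, <- INR_IZR_INZ.
  apply Rmult_eq_reg_r with (PI / INR n)%R.
  + rewrite Hz. field. exact HnR.
  + apply Rgt_not_eq. apply Rdiv_lt_0_compat; [lra|]. apply lt_0_INR. lia.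
- intros [z ->]. rewrite <- Cpowz_eta_cis, Z.mul_comm by exact Hn.
  replace (2 * Z.of_nat n)%Z with (Z.of_nat (n + n)) by lia.
  rewrite Cpowz_pow by now apply eta_neq0.
  rewrite Cpow_add_r, eta_pow_n by exact Hn.
  replace (- (1) * - (1)) with (RtoC 1) by ring. apply Cpowz_1_l.
Qed.

Lemma eta_power_n (n : nat) (k : Z) : n <> 0%nat ->
  Cpowz (eta n) k ^ n = if Z.even k then 1 else - (1).
Proof.
intros Hn. assert (H0 := eta_neq0 n Hn).
assert (E : Cpowz (eta n) k ^ n = Cpowz (- (1)) k).
{ destruct (Z_sub_nat k) as [a [b ->]].
  assert (H1 : - (1) <> 0) by (apply Cmod_gt_0; rewrite Cmod_m1; lra).
  rewrite !Cpowz_sub_nat by assumption. rewrite <- (eta_pow_n n Hn), <- !Cpow_mult_r.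
  unfold Cdiv. rewrite Cpow_mult_l, Cpow_inv, <- !Cpow_mult_r by now apply Cpow_nz.
  f_equal; [f_equal; lia|]. f_equal. f_equal. lia. }
rewrite E. destruct (Z.even k) eqn:Ek.
- apply Z.even_spec in Ek. destruct Ek as [j ->].
  change 2%Z with (Z.of_nat 2). rewrite Cpowz_pow by (apply Cmod_gt_0; rewrite Cmod_m1; lra).
  replace ((- (1)) ^ 2) with (RtoC 1) by (simpl; ring). apply Cpowz_1_l.
- assert (Ho : Z.odd k = true) by (rewrite <- Z.negb_even, Ek; reflexivity).
  apply Z.odd_spec in Ho. destruct Ho as [j ->].
  rewrite Cpowz_add by (apply Cmod_gt_0; rewrite Cmod_m1; lra).
  change 2%Z with (Z.of_nat 2). rewrite Cpowz_pow by (apply Cmod_gt_0; rewrite Cmod_m1; lra).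
  replace ((- (1)) ^ 2) with (RtoC 1) by (simpl; ring). rewrite Cpowz_1_l. simpl. ring.
Qed.

(** Z_h is a geometric sum with ratio w = eta^(1-h), where w^n = (-1)^(1-h): the numerator
    1 - w^n is 0 for odd h and 2 for even h, and w = 1 exactly when 2n divides 1 - h. *)
Lemma calZ_values (n : nat) (h : Z) : (1 <= n)%nat ->
  ((2 * Z.of_nat n | h - 1)%Z -> calZ n h = INR n) /\
  (~ (2 * Z.of_nat n | h - 1)%Z -> ~ (2 | h)%Z -> calZ n h = 0) /\
  ((2 | h)%Z -> calZ n h = 2 / (1 - Cpowz (eta n) (1 - h))).
Proof.
intros Hn. assert (Hn0 : n <> 0%nat) by lia.
pose proof (eta_power_eq_1 n (1 - h) Hn0) as H1.
pose proof (eta_power_n n (1 - h) Hn0) as Hpow.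
pose proof (Csum_geometric (Cpowz (eta n) (1 - h)) n) as Hgeo.
rewrite (calZ_Csum n h Hn). set (w := Cpowz (eta n) (1 - h)) in *.
split; [|split].
- intros Hd. assert (Ew : w = 1).
  { apply H1. replace (1 - h)%Z with (- (h - 1))%Z by ring. now apply Z.divide_opp_r. }
  rewrite Ew. clear. induction n as [|n IH]; [reflexivity|].
  rewrite seq_S, Csum_app, IH, S_INR, RtoC_plus. unfold Csum; simpl. rewrite Cpow_1_l. ring.
- intros Hd Hh. assert (Hw : w <> 1).
  { intros E. apply Hd. apply H1 in E. replace (h - 1)%Z with (- (1 - h))%Z by ring.
    now apply Z.divide_opp_r. }
  assert (Ee : Z.even (1 - h) = true).
  { rewrite Z.even_sub. destruct (Z.even h) eqn:Eh; [|reflexivity].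
    exfalso. apply Hh. apply Z.even_spec in Eh. destruct Eh as [j ->]. exists j. ring. }
  rewrite Ee in Hpow. rewrite Hpow in Hgeo. replace (1 - 1) with (RtoC 0) in Hgeo by ring.
  assert (H0 : 1 - w <> 0) by (apply Cminus_neq0; congruence).
  replace (Csum (seq 0 n) (fun j => w ^ j)) with (/ (1 - w) * ((1 - w) * Csum (seq 0 n) (fun j => w ^ j)))
    by (field; exact H0).
  rewrite Hgeo. ring.
- intros [j Hj].
  assert (Ee : Z.even (1 - h) = false).
  { rewrite Z.even_sub, Hj, Z.even_mul. simpl. now rewrite orb_true_r. }
  rewrite Ee in Hpow. rewrite Hpow in Hgeo.
  assert (H0 : 1 - w <> 0).
  { intros E. rewrite E, Cmult_0_l in Hgeo. apply (f_equal fst) in Hgeo. simpl in Hgeo. lra. }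
  replace (Csum (seq 0 n) (fun j => w ^ j)) with (/ (1 - w) * ((1 - w) * Csum (seq 0 n) (fun j => w ^ j)))
    by (field; exact H0).
  rewrite Hgeo. field. exact H0.
Qed.

(** * The residue identity *)

Theorem theorem5p1 (g : C -> C) (n : nat) (gamma1 gamma2 eps : R)
    (g_mero : meromorphic g)
    (g_holo : forall t : C, ~ in_two_pi_i_Z t -> holomorphic_at g t)
    (g_simple : forall m : Z, m <> 0%Z -> pole_order_le 1 g (two_pi_i m))
    (n_ge2 : (2 <= n)%nat)
    (gamma1_gt0 : (0 < gamma1)%R)
    (eps_gt0 : (0 < eps)%R) (eps_small : (eps < PI)%R)
    (G_bound : forall t : C,
      ~ (exists (l : nat) (m : Z), (l <= n - 1)%nat /\
           closed_disk (two_pi_i m * eta n ^ l) eps t) ->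
      (Cmod (Gprod n g t) <= gamma1 * Rpower (Cmod t) (- gamma2))%R)
    (h : Z) (h_large : (IZR h + gamma2 > 1)%R) :
  is_sum_nonzero
    (fun m =>
       Cpowz (two_pi_i m) (- h) *
       sum_n_m (fun l =>
         Cpowz (eta n) (Z.of_nat l * (1 - h)) *
         Cprod (filter (fun j => negb (j + l =? n)%nat) (seq 1 n))
           (fun j => g (two_pi_i m * eta n ^ (j + l)))) 0 (n - 1) *
       Res (fun t => g (- t)) (two_pi_i m))
    (- Res (fun t => Cpowz t (- h) *
                     Cprod (seq 1 n) (fun j => g (eta n ^ j * t))) 0)
  /\
  (even_off_poles g ->
   exists s : C,
     is_sum_nonzero
       (fun m =>
          Cpowz (two_pi_i m) (- h) *
          Cprod (seq 1 (n - 1)) (fun j => g (two_pi_i m * eta n ^ j)) *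
          Res g (two_pi_i m)) s
     /\
     calZ n h * s =
       - Res (fun t => Cpowz t (- h) *
                       Cprod (seq 0 n) (fun j => g (eta n ^ j * t))) 0)
  /\
  ((2 * Z.of_nat n | h - 1)%Z -> calZ n h = INR n)
  /\
  (~ (2 * Z.of_nat n | h - 1)%Z -> ~ (2 | h)%Z -> calZ n h = 0)
  /\
  (~ (2 * Z.of_nat n | h - 1)%Z -> (2 | h)%Z ->
   calZ n h = 2 / (1 - Cpowz (eta n) (1 - h))).
Proof.
assert (Hn : (1 <= n)%nat) by lia.
destruct (weighted_G_residue_0 g n h Hn g_mero) as [r0 Hr0].
fold (weighted_G g n h). rewrite (Res_eq _ _ _ Hr0).
pose proof (residue_series g n h gamma1 gamma2 eps r0 g_holo g_simple Hn gamma1_gt0 eps_small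
  h_large G_bound Hr0) as Hseries.
destruct (residue_term_bound g n h gamma1 gamma2 eps g_holo g_simple Hn gamma1_gt0 eps_gt0 eps_small
  ltac:(lra) G_bound) as [m0 [K [HK Hbound]]].
pose proof (Rgt_lt _ _ h_large) as Hkappa.
destruct (calZ_values n h Hn) as [Z1 [Z2 Z3]].
split; [|split; [|split; [exact Z1|split; [exact Z2|intros _; exact Z3]]]].
- match goal with |- is_sum_nonzero ?A _ =>
    assert (EA : forall m, A m = Csum (seq 0 n) (fun l => residue_term g n h l m)) end.
  { intros m. rewrite sum_n_m_Csum by exact Hn. unfold residue_term.
    rewrite <- Csum_scal, Cmult_comm, <- Csum_scal. apply Csum_ext. intros l _. ring. }
  match goal with |- is_sum_nonzero ?A _ => set (a := A) in * end.
  destruct (abs_summable a m0 (INR n * K) _ Hkappa) as [S1 S2].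
  { apply Rmult_le_pos; [apply pos_INR|exact HK]. }
  { intros m Hm Hmm. rewrite EA, Rmult_assoc. rewrite <- (length_seq n 0) at 2.
    apply Cmod_Csum. intros l Hl. apply in_seq in Hl. apply Hbound; [lia|exact Hm|exact Hmm]. }
  split; [exact S1|split; [exact S2|]].
  apply (is_series_ext (K := C_AbsRing) (V := C_NormedModule)) with (2 := Hseries).
  intros k. now rewrite !EA.
- intros Hev. fold (even_term g n h).
  assert (Et : forall l m, (l < n)%nat -> m <> 0%Z ->
    residue_term g n h l m = Cpowz (eta n) (Z.of_nat l * (1 - h)) * even_term g n h m).
  { intros l m Hl Hm. apply residue_term_even; auto. }
  (* the case l = 0 of the bound, where the power of eta is 1 *)
  destruct (abs_summable (even_term g n h) m0 K _ Hkappa HK) as [S1 S2].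
  { intros m Hm Hmm. replace (even_term g n h m) with (residue_term g n h 0 m).
    - apply Hbound; [lia|exact Hm|exact Hmm].
    - rewrite Et by (assumption || lia). change (Cpowz (eta n) (Z.of_nat 0 * (1 - h))) with (RtoC 1). ring. }
  assert (Hex : @ex_series C_AbsRing C_NormedModule (fun k : nat =>
    even_term g n h (Z.of_nat (S k)) + even_term g n h (- Z.of_nat (S k))%Z)).
  { apply (ex_series_le (K := C_AbsRing) (V := C_CompleteNormedModule)) with
      (fun k => plus (Cmod (even_term g n h (Z.of_nat (S k)))) (Cmod (even_term g n h (- Z.of_nat (S k))%Z))).
    - intros k. apply Cmod_triangle.
    - now apply (ex_series_plus (V := R_NormedModule)). }
  destruct Hex as [s Hs]. exists s. split; [split; [exact S1|split; [exact S2|exact Hs]]|].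
  transitivity (- r0).
  + apply (is_series_C_unique (fun k : nat => calZ n h *
      (even_term g n h (Z.of_nat (S k)) + even_term g n h (- Z.of_nat (S k))%Z))).
    * exact (is_series_scal (K := C_AbsRing) (V := C_NormedModule) (calZ n h) _ s Hs).
    * apply (is_series_ext (K := C_AbsRing) (V := C_NormedModule)) with (2 := Hseries).
      intros k. unfold calZ. rewrite sum_n_m_Csum by exact Hn.
      assert (E : forall m, m <> 0%Z -> Csum (seq 0 n) (fun l => residue_term g n h l m) =
        Csum (seq 0 n) (fun l => Cpowz (eta n) (Z.of_nat l * (1 - h))) * even_term g n h m).
      { intros m Hm. rewrite Cmult_comm, <- Csum_scal. apply Csum_ext. intros l Hl.
        apply in_seq in Hl. rewrite Et by (assumption || lia). ring. }
      rewrite !E by lia. match goal with |- ?x = ?y => change (@eq C x y) end. ring.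
  + f_equal. symmetry. apply Res_eq. apply (is_residue_ext (weighted_G g n h)); [|exact Hr0].
    (* near 0 the factors g(eta^n z) = g(-z) and g(eta^0 z) agree *)
    destruct (near_two_pi_i_off 0) as [d [Hd H]]. rewrite two_pi_i_0 in H.
    exists d. split; [exact Hd|]. intros z Hz. unfold weighted_G. f_equal.
    destruct n as [|n']; [lia|]. rewrite (seq_S n' 1), Cprod_app. cbn [seq]. rewrite Cprod_cons, Cmult_comm.
    f_equal. unfold Cprod; simpl map; simpl fold_right. rewrite Cmult_1_r.
    replace (1 + n')%nat with (S n') by lia. rewrite eta_pow_n by lia.
    replace (- (1) * z) with (- z) by ring. rewrite Hev by now apply H. simpl. now rewrite Cmult_1_l.
Qed.
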